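(* Let $G$ be the graph of a braced triangulation with exactly two braces. Then $G$ is minimally rigid in the hypercylinder $\Sigma$: $G$ is rigid in $\Sigma$ and $G-e$ is not rigid in $\Sigma$ for every edge $e$ of $G$.
   Context: A braced triangulation is the simple graph obtained from a sphere triangulation $P$ (a maximal planar graph embedded in the 2-sphere, with at least 3 vertices) by adding a set $B$ of extra edges (braces) between vertices non-adjacent in $P$; its graph is this simple graph $P\cup B$. Let $\Sigma=\{(x,y,z,w)\in\mathbb{R}^4: x^2+y^2+z^2=1\}$ and $\pi:\mathbb{R}^4\to\mathbb{R}^3$, $\pi(x,y,z,w)=(x,y,z)$. An infinitesimal rigid motion of $\mathbb{R}^4$ is an affine map $\eta(x)=Mx+c$ with $M$ a $4\times 4$ skew-symmetric matrix and $c\in\mathbb{R}^4$; let $\mathcal{T}(\Sigma)$ be the set of such $\eta$ with $\pi(\eta(x))\cdot\pi(x)=0$ for all $x\in\Sigma$. For a finite simple graph $G=(V,E)$, a placement is $q\in\Sigma^V$. An infinitesimal flex of $(G,q)$ is $m\in(\mathbb{R}^4)^V$ with $(m_u-m_v)\cdot(q_u-q_v)=0$ for all $uv\in E$ and $\pi(m_v)\cdot\pi(q_v)=0$ for all $v\in V$; it is trivial if there is $\eta\in\mathcal{T}(\Sigma)$ with $m_v=\eta(q_v)$ for all $v$. $(G,q)$ is infinitesimally rigid if all its infinitesimal flexes are trivial. The rigidity matrix $R(G,q)$ is the $(|E|+|V|)\times 4|V|$ matrix of this linear system: the row of $uv\in E$ has $q_u-q_v$ in the four columns of $u$, $q_v-q_u$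 in those of $v$, zeros elsewhere; the row of $v\in V$ has $(\pi(q_v),0)$ in the columns of $v$, zeros elsewhere. A placement $q$ is regular if $\operatorname{rank}R(G,q)$ is maximal over all $q\in\Sigma^V$. $G$ is rigid in $\Sigma$ if $(G,q)$ is infinitesimally rigid for a regular placement $q$ (equivalently for every regular placement). *)

(* Defs.v *)
From HB Require Import structures.
From mathcomp Require Import all_boot all_order all_fingroup all_algebra reals.

Set Implicit Arguments.
Unset Strict Implicit.
Unset Printing Implicit Defensive.

Import GRing.Theory.

(* A finite simple graph with vertex set the whole of V is given by its edge
   set, a set of 2-element subsets of V.  Isolated vertices are allowed. *)
Definition simple_graph (V : finType) (E : {set {set V}}) : Prop :=
  forall A, A \in E -> #|A| = 2.

(* Graphs embedded in the sphere, as combinatorial maps: an embedding is a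
   rotation system, i.e. a permutation [node] of the darts (oriented edges)
   that cycles through all the darts leaving each vertex. *)
Section Planarity.
Variables (V : finType) (E : {set {set V}}).

Definition dart := {d : V * V | [set d.1; d.2] \in E}.
HB.instance Definition _ := Finite.on dart.

Definition source (d : dart) : V := (val d).1.

Lemma flip_proof (d : dart) : [set (val d).2; (val d).1] \in E.
Proof. by rewrite setUC; exact: (valP d). Qed.

Definition flip_fun (d : dart) : dart :=
  exist _ ((val d).2, (val d).1) (flip_proof d).

Lemma flip_funK : involutive flip_fun.
Proof. by move=> d; apply: val_inj => /=; case: (val d). Qed.

Definition flip : {perm dart} := perm (inv_inj flip_funK).

Definition rotation_system (node : {perm dart}) : Prop :=
  forall d, porbit node d = [set d' | source d' == source d].

(* The orbits of [face] are the boundary walks of the faces: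
   (u, v) is sent to the dart following (v, u) around v. *)
Definition face (node : {perm dart}) : {perm dart} := (flip * node)%g.

Definition linked (node : {perm dart}) : rel dart :=
  [rel x y | (node x == y) || (flip x == y)].

(* Euler's formula V - E + F = 2 summed over the components having an edge;
   each of them is then embedded with genus 0.  Isolated vertices carry no
   dart and do not contribute. *)
Definition genus0 (node : {perm dart}) : Prop :=
  #|porbits node| + #|porbits (face node)|
    = #|E| + 2 * n_comp (linked node) predT.

Definition planar : Prop :=
  exists node : {perm dart}, rotation_system node /\ genus0 node.

End Planarity.

Definition maximal_planar (V : finType) (E : {set {set V}}) : Prop :=
  [/\ simple_graph E, planar E &
      forall A : {set V}, #|A| = 2 -> A \notin E -> ~ planar (A |: E)].

Definition sphere_triangulation (V : finType) (P : {set {set V}}) : Prop :=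
  3 <= #|V| /\ maximal_planar P.

(* G is the graph of a braced triangulation with exactly b braces. *)
Definition braced_triangulation (V : finType) (b : nat) (G : {set {set V}})
    : Prop :=
  exists P B : {set {set V}},
    [/\ sphere_triangulation P, simple_graph B, [disjoint P & B],
        #|B| = b & G = P :|: B].

Local Open Scope ring_scope.

Section Hypercylinder.
Variable R : realType.

Definition dot (n : nat) (x y : 'cV[R]_n) : R := \sum_i x i 0 * y i 0.

Definition proj (x : 'cV[R]_4) : 'cV[R]_3 := @usubmx R 3 1 1 x.

Definition hypercylinder (x : 'cV[R]_4) : Prop := dot (proj x) (proj x) = 1.

Definition rigid_motion (M : 'M[R]_4) (c x : 'cV[R]_4) : 'cV[R]_4 :=
  M *m x + c.

(* The motion x |-> M x + c belongs to T(Sigma). *)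
Definition cylinder_motion (M : 'M[R]_4) (c : 'cV[R]_4) : Prop :=
  M^T = - M /\
  forall x, hypercylinder x -> dot (proj (rigid_motion M c x)) (proj x) = 0.

Variables (V : finType) (E : {set {set V}}).

Definition placement (q : V -> 'cV[R]_4) : Prop :=
  forall v, hypercylinder (q v).

Definition infinitesimal_flex (q m : V -> 'cV[R]_4) : Prop :=
  (forall u v, [set u; v] \in E -> dot (m u - m v) (q u - q v) = 0) /\
  (forall v, dot (proj (m v)) (proj (q v)) = 0).

Definition trivial_flex (q m : V -> 'cV[R]_4) : Prop :=
  exists M c, cylinder_motion M c /\ forall v, m v = rigid_motion M c (q v).

Definition infinitesimally_rigid (q : V -> 'cV[R]_4) : Prop :=
  forall m, infinitesimal_flex q m -> trivial_flex q m.

(* A row of the rigidity matrix, with its columns in blocks of four indexed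
   by the vertices. *)
Definition flatten_row (r : V -> 'cV[R]_4) : 'rV[R]_(#|V| * 4) :=
  mxvec (\matrix_(i < #|V|, k < 4) r (enum_val i) k 0).

(* For A = {u, v} the sum has one term: the block of u is q u - q v. *)
Definition edge_row (q : V -> 'cV[R]_4) (A : {set V}) (w : V) : 'cV[R]_4 :=
  if w \in A then \sum_(x in A :\ w) (q w - q x) else 0.

Definition vertex_row (q : V -> 'cV[R]_4) (v w : V) : 'cV[R]_4 :=
  if w == v then col_mx (proj (q v)) (0 : 'cV[R]_1) else 0.

Definition rigidity_matrix (q : V -> 'cV[R]_4)
    : 'M[R]_(#|E| + #|V|, #|V| * 4) :=
  col_mx (\matrix_(i < #|E|) flatten_row (edge_row q (enum_val i)))
         (\matrix_(i < #|V|) flatten_row (vertex_row q (enum_val i))).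

Definition regular (q : V -> 'cV[R]_4) : Prop :=
  placement q /\
  forall q', placement q' ->
    (\rank (rigidity_matrix q') <= \rank (rigidity_matrix q))%N.

Definition rigid : Prop :=
  exists q, regular q /\ infinitesimally_rigid q.

End Hypercylinder.

Definition minimally_rigid (R : realType) (V : finType) (G : {set {set V}})
    : Prop :=
  rigid R G /\ forall e, e \in G -> ~ rigid R (G :\ e).

(* Main.v *)
(* Let [P] be a triangulation with at most two braces [B].  By induction on the
   number of vertices, a generic placement has a space of flexes of dimension at
   most [6 - #|B|].  A vertex [v] of degree at most 5, outside the braces if
   possible, is contracted onto a neighbour [w] so that the result is again a
   triangulation.  Conversely, when [v] leaves [w] along a rational curve, the
   flexes of the split framework tend to a flex of the contracted one together
   with a vector determined by the edges at [v], so the dimension does not grow.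
   If the contraction destroys a brace, the contracted framework has one more
   flex; the direction in which [v] leaves [w] is then chosen so that the limit
   system forces one more linear equation.  This equation is not trivial because a
   triangulation with one face pinned is generically rigid.
   With two braces there are exactly [4 * #|V| - 4] rows in the rigidity matrix,
   and the trivial flexes form a space of dimension 4: the framework is rigid, and
   no edge can be removed. *)
Require Import Defs.
From mathcomp Require Import all_boot all_order all_fingroup all_algebra reals boolp.
From mathcomp Require Import zify ring lra.
Set Implicit Arguments.
Unset Strict Implicit.
Unset Printing Implicit Defensive.

(** * Triangulated spheres *)

(** The bound [6 - #|B|] comes from a count: [4 * #|V|] coordinates, minus [#|V|] tangency
    conditions and [3 * #|V| - 6] edges, leaves six, and each brace should remove one more. A vertex
    to contract is found because the numbers [6 - deg] sum to 12 and none exceeds 3, so at least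
    four vertices have degree at most 5, while two braces cover at most four. When exactly these are
    covered, the braces are disjoint and all their ends have degree 3, a case treated apart. A
    contraction must not double an edge, so the vertices that become adjacent to [w] may not be
    adjacent to it before; planarity provides such a [w], since crossing diagonals of a link cannot
    both be edges. The Jordan property behind this is carried as a field of the structure [tri]. It
    survives edge flips and the removal of vertices of degree 3, and contractions are composed of
    these two moves. For a maximal planar graph it is derived from Euler's formula by linear algebra
    over the field with two elements. Genericity is expressed along rational curves so that finitely
    many conditions, among them the induction hypotheses, can be met by one placement. *)

Section Tri.
Variable V : finType.
Implicit Types (S : {set V}) (adj : rel V) (n : V -> V -> V).

Definition upair (a b x y : V) := ((x == a) && (y == b)) || ((x == b) && (y == a)).

Lemma upairC a b x y : upair a b x y = upair a b y x.
Proof. by rewrite /upair orbC andbC [(x == a) && _]andbC. Qed.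

Lemma upair_sum_addb a b x : a != b ->
  \big[addb/false]_y upair a b x y = (x == a) || (x == b).
Proof.
move=> nab; have e (c : V) : \big[addb/false]_y (y == c) = true.
  by rewrite (bigD1 c) //= eqxx big1 // => y /negbTE.
rewrite /upair; have [->|na] := eqVneq x a.
  by apply: etrans (e b); apply: eq_bigr => y _; rewrite (negbTE nab) orbF.
have [_|_] := eqVneq x b; last by rewrite big1.
by apply: etrans (e a); apply: eq_bigr.
Qed.

Lemma upair_sum_nat a b : a != b -> \sum_x \sum_y (upair a b x y : nat) = 2.
Proof.
move=> nab; have e (c : V) : \sum_y (y == c : nat) = 1.
  by rewrite (bigD1 c) //= eqxx big1 // => y /negbTE->.
rewrite (bigD1 a) //= [X in _ + X](bigD1 b) 1?eq_sym //=.
rewrite [X in _ + (_ + X)]big1 ?addn0 => [|x /andP[/negbTE na /negbTE nb]].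
  rewrite -[2]/(1 + 1) -{1}(e b) -(e a); congr (_ + _); apply: eq_bigr => y _.
    by rewrite /upair eqxx (negbTE nab) orbF.
  by rewrite /upair eqxx eq_sym (negbTE nab).
by rewrite big1 // => y _; rewrite /upair na nb.
Qed.

Definition triangle (a b d x y : V) := [&& x != y, x \in [:: a; b; d] & y \in [:: a; b; d]].

Lemma triangleC a b d x y : triangle a b d x y = triangle a b d y x.
Proof. by rewrite /triangle eq_sym [(x \in _) && _]andbC. Qed.

(** Makes a triangle an admissible [Z] in [tri_jordan], so that it can serve as a separating
    curve. *)
Lemma triangle_sum_addb a b d x : a != b -> b != d -> d != a ->
  \big[addb/false]_y triangle a b d x y = false.
Proof.
move=> ab bd da.
have key (u v w : V) : u != v -> v != w -> w != u ->
    \big[addb/false]_y ((u != y) && [|| y == u, y == v | y == w]) = false.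
  move=> uv vw wu; transitivity (\big[addb/false]_y ((y == v) (+) (y == w))).
    apply: eq_bigr => y _; rewrite eq_sym.
    have [->|yu] := eqVneq y u; first by rewrite (negbTE uv) eq_sym (negbTE wu).
    by have [->|] := eqVneq y v; rewrite ?(negbTE vw).
  have one (t : V) : \big[addb/false]_y (y == t) = true.
    by rewrite (bigD1 t) //= eqxx big1 // => y /negbTE.
  by rewrite big_split /= !one.
rewrite /triangle; have [|hx] := boolP (x \in _); last by rewrite big1 // => y _; rewrite andbF.
rewrite !inE => /or3P[]/eqP->; [apply: etrans (key a b d ab bd da)
  |apply: etrans (key b d a bd da ab)|apply: etrans (key d a b da ab bd)];
by apply: eq_bigr => y _; rewrite !inE; case: (y == a); case: (y == b); case: (y == d).
Qed.

Lemma triangle_sub (adj : rel V) a b d x y : symmetric adj -> adj a b -> adj b d -> adj d a ->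
  triangle a b d x y -> adj x y.
Proof.
move=> sy ab bd da; rewrite /triangle !inE => /and3P[nxy /or3P[]/eqP ex /or3P[]/eqP ey];
by move: nxy; rewrite ex ey ?eqxx // => _; rewrite // sy.
Qed.

(* [n x y] is the third vertex of the face on the left of the directed edge [x y].
   By [tri_link] the neighbours of a vertex form one cycle; [tri_jordan], which
   replaces the Jordan curve theorem, says that every even subgraph [Z] is the set
   of edges where a two-colouring of the faces changes.
   [tri_count] is Euler's formula. *)
Record tri S adj n : Prop := Tri {
  tri_sym : forall x y, adj x y = adj y x;
  tri_irr : forall x, adj x x = false;
  tri_dom : forall x, (x \in S) = [exists y, adj x y];
  tri_adj : forall x y, adj x y -> adj y (n x y);
  tri_rot : forall x y, adj x y -> n y (n x y) = x;
  tri_two : forall x y, adj x y -> n x y != n y x;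
  tri_link : forall (A : pred V) x y, adj x y -> A y ->
     (forall z, adj x z -> A z -> A (n x z)) -> forall z, adj x z -> A z;
  tri_conn : forall (A : pred V) x, x \in S -> A x ->
     (forall y z, adj y z -> A y -> A z) -> forall y, y \in S -> A y;
  tri_jordan : forall Z : V -> V -> bool,
     (forall x y, Z x y = Z y x) -> (forall x y, Z x y -> adj x y) ->
     (forall x, \big[addb/false]_y Z x y = false) ->
     exists c : V -> V -> bool, forall x y, adj x y ->
       c x y = c y (n x y) /\ Z x y = c x y (+) c y x;
  tri_count : \sum_x \sum_y (adj x y : nat) + 12 = 6 * #|S| }.

Section Basics.
Variables (S : {set V}) (adj : rel V) (n : V -> V -> V).
Hypothesis T : tri S adj n.

Lemma tri_adj' x y : adj x y -> adj (n x y) x.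
Proof.
move=> h; have := tri_adj T (tri_adj T h).
by rewrite (tri_rot T h).
Qed.

Lemma tri_rot' x y : adj x y -> n (n x y) x = y.
Proof. by move=> h; have := tri_rot T (tri_adj T h); rewrite (tri_rot T h). Qed.

Lemma tri_neq x y : adj x y -> x != y.
Proof. by apply: contraTneq => ->; rewrite (tri_irr T). Qed.

Lemma tri_inS x y : adj x y -> x \in S.
Proof. by move=> h; rewrite (tri_dom T); apply/existsP; exists y. Qed.

Lemma tri_inj x y z : adj x y -> adj x z -> n x y = n x z -> y = z.
Proof. by move=> hy hz e; rewrite -(tri_rot' hy) -(tri_rot' hz) e. Qed.

(* The colour of the faces around [x] is constant as long as [Z] has no edge at [x]. *)
Lemma colour_const (Z c : V -> V -> bool) x :
  (forall x y, adj x y -> c x y = c y (n x y) /\ Z x y = c x y (+) c y x) ->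
  (forall y, Z x y = false) -> forall y z, adj x y -> adj x z -> c x y = c x z.
Proof.
move=> hc hZ y z hy hz; symmetry; apply/eqP.
pose A := [pred z | c x z == c x y].
apply: (@tri_link _ _ _ T A x y) => //=.
move=> u hu /eqP <-.
have h1 := tri_adj' hu.
have [e1 e2] := hc _ _ h1.
rewrite (tri_rot' hu) in e1.
have h2 : adj x (n x u) by rewrite (tri_sym T).
have [_ e3] := hc _ _ h2; rewrite hZ in e3.
by apply/eqP; move: e3; rewrite e1; case: (c x u) (c x (n x u)) => [] [].
Qed.

(* The triangle [v x0 x2] separates [x1] from [x3]. *)
Lemma noncrossing v x0 x1 x2 x3 : adj v x0 -> n v x0 = x1 -> n v x1 = x2 ->
  n v x2 = x3 -> x3 != x0 -> adj x0 x2 -> adj x1 x3 -> False.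
Proof.
move=> h0 e1 e2 e3 n30 a02 a13.
have h1 : adj v x1 by rewrite -e1 (tri_sym T) tri_adj'.
have h2 : adj v x2 by rewrite -e2 (tri_sym T) tri_adj'.
have h3 : adj v x3 by rewrite -e3 (tri_sym T) tri_adj'.
have v0 := tri_neq h0; have v1 := tri_neq h1; have v2 := tri_neq h2.
have v3 := tri_neq h3; have n02 := tri_neq a02; have n13 := tri_neq a13.
have n01 : x0 != x1 by rewrite -e1 (tri_neq (tri_adj T h0)).
have n12 : x1 != x2 by rewrite -e2 (tri_neq (tri_adj T h1)).
have n23 : x2 != x3 by rewrite -e3 (tri_neq (tri_adj T h2)).
pose Z := triangle v x0 x2.
have Z0 x : x \notin [:: v; x0; x2] -> forall y, Z x y = false.
  by move=> /negbTE h y; rewrite /Z /triangle h /= andbF.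
have v20 : x2 != v by rewrite eq_sym.
have Za x y : Z x y -> adj x y by apply: triangle_sub => //; [exact: tri_sym T|rewrite (tri_sym T)].
have Zs : forall x y, Z x y = Z y x := triangleC v x0 x2.
have [c hc] := tri_jordan T Zs Za (fun x => triangle_sum_addb x v0 n02 v20).
(* Turning around [v], the face colour changes exactly when an edge of [Z] is crossed: the face left
   of [v y] is also the face left of the edge from [n v y] to [v]. *)
have step y : adj v y -> c v (n v y) = c v y (+) Z v (n v y).
  move=> hy; have h' : adj v (n v y) by rewrite (tri_sym T) tri_adj'.
  have [_ ->] := hc _ _ h'; have [e _] := hc _ _ (tri_adj' hy).
  rewrite (tri_rot' hy) in e.
  by rewrite e; case: (c v y) (c v (n v y)) => [] [].
have Z1 := Z0 x1; have Z3 := Z0 x3.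
rewrite !inE ![x1 == _]eq_sym (negbTE v1) (negbTE n01) [x2 == _]eq_sym (negbTE n12) in Z1.
rewrite !inE ![x3 == v]eq_sym (negbTE v3) (negbTE n30) [x3 == _]eq_sym (negbTE n23) in Z3.
have s2 := step _ h1; have s3 := step _ h2.
rewrite e2 in s2; rewrite e3 in s3.
have Z2 : Z v x2 by rewrite /Z /triangle !inE !eqxx v2 !orbT.
rewrite Z2 in s2; rewrite Zs Z3 // in s3.
have h1' : adj x1 v by rewrite (tri_sym T).
have h3' : adj x3 v by rewrite (tri_sym T).
have a31 : adj x3 x1 by rewrite (tri_sym T).
have k1 := colour_const hc (Z1 isT) h1' a13.
have k3 := colour_const hc (Z3 isT) h3' a31.
have [_ m1] := hc _ _ h1'; have [_ m3] := hc _ _ h3'; have [_ m13] := hc _ _ a13.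
(* The faces at [x1] have one colour, so do those at [x3], and the edge [x1 x3] makes the two
   colours equal; but crossing [v x2] made them differ. *)
rewrite Z1 // in m1; rewrite Z3 // in m3; rewrite Z1 // in m13.
move: s2 s3 k1 k3 m1 m3 m13.
by move=> -> -> -> ->; case: (c x1 x3) (c x3 x1) (c v x1) => [] [] [].
Qed.

End Basics.

(* The edge [p r], between the faces [p r s] and [r p q], is replaced by [q s]. *)
Section Flip.
Variables (S : {set V}) (adj : rel V) (n : V -> V -> V).
Hypothesis T : tri S adj n.
Variables p q r s : V.
Hypotheses (pr : adj p r) (defq : n r p = q) (defs : n p r = s) (nqs : ~~ adj q s).

Definition flip_adj x y := adj x y && ~~ upair p r x y || upair q s x y.

Definition flip_n x y :=
  if (x == s) && (y == p) then q else
  if (x == p) && (y == q) then s else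
  if (x == q) && (y == s) then p else
  if (x == q) && (y == r) then s else
  if (x == r) && (y == s) then q else
  if (x == s) && (y == q) then r else n x y.

(** The directed sides of the faces [s p q] and [q r s], which replace [p r s] and [r p q]. *)
Let six := [:: (s, p); (p, q); (q, s); (q, r); (r, s); (s, q)].

Let rp : adj r p. Proof. by rewrite (tri_sym T). Qed.
Let rs : adj r s. Proof. by rewrite -defs; apply: tri_adj T _ _ pr. Qed.
Let sp : adj s p. Proof. by rewrite -defs; apply: tri_adj' T _ _ pr. Qed.
Let pq : adj p q. Proof. by rewrite -defq; apply: tri_adj T _ _ rp. Qed.
Let qr : adj q r. Proof. by rewrite -defq; apply: tri_adj' T _ _ rp. Qed.
Let n_rs : n r s = p. Proof. by rewrite -defs; apply: tri_rot T _ _ pr. Qed.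
Let n_sp : n s p = r. Proof. by rewrite -defs; apply: tri_rot' T _ _ pr. Qed.
Let n_pq : n p q = r. Proof. by rewrite -defq; apply: tri_rot T _ _ rp. Qed.
Let n_qr : n q r = p. Proof. by rewrite -defq; apply: tri_rot' T _ _ rp. Qed.
Let Dqs : q != s. Proof. by rewrite -defq -defs; apply: tri_two T _ _ rp. Qed.
Let Dpr := tri_neq T pr.
Let Dpq := tri_neq T pq.
Let Dqr := tri_neq T qr.
Let Drs := tri_neq T rs.
Let Dsp := tri_neq T sp.
Let D := (negbTE Dpr, negbTE Dpq, negbTE Dqr, negbTE Drs, negbTE Dsp, negbTE Dqs).
Let E x y : (x == y :> V) = (y == x). Proof. exact: eq_sym. Qed.
Let D' : ((r == p) = false) * ((q == p) = false) * ((r == q) = false) *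
  ((s == r) = false) * ((p == s) = false) * ((s == q) = false).
Proof. by rewrite ![r == _]E ![q == p]E ![s == _]E ![p == s]E !D. Qed.
Let DD := (D, D', eqxx).

Lemma flip_nsp : flip_n s p = q. Proof. by rewrite /flip_n !DD. Qed.
Lemma flip_npq : flip_n p q = s. Proof. by rewrite /flip_n !DD. Qed.
Lemma flip_nqs : flip_n q s = p. Proof. by rewrite /flip_n !DD. Qed.
Lemma flip_nqr : flip_n q r = s. Proof. by rewrite /flip_n !DD. Qed.
Lemma flip_nrs : flip_n r s = q. Proof. by rewrite /flip_n !DD. Qed.
Lemma flip_nsq : flip_n s q = r. Proof. by rewrite /flip_n !DD. Qed.

Lemma flip_nE x y : (x, y) \notin six -> flip_n x y = n x y.
Proof.
rewrite !inE !xpair_eqE /flip_n !negb_or.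
by case/and5P=> /negbTE-> /negbTE-> /negbTE-> /negbTE-> /andP[/negbTE-> /negbTE->].
Qed.

Lemma flip_adjE x y : flip_adj x y -> (x, y) \in six \/
  [/\ (x, y) \notin six, adj x y & ~~ upair p r x y].
Proof.
have [_|h] := boolP ((x, y) \in six); first by left.
rewrite /flip_adj => /orP[/andP[-> ->]|]; first by right.
by move: h; rewrite !inE !xpair_eqE /upair => /norP[_] /norP[_] /norP[/negbTE->] /norP[_] /norP[_] /negbTE->.
Qed.

(** Outside [six] nothing changes, and inside it [flip_n] turns around the two new faces; this
    settles the local conditions. The work lies in the link condition at the four corners and in the
    Jordan property. *)
Lemma flip_tri : tri S flip_adj flip_n.
Proof.
have Ds x y : flip_adj x y -> flip_adj y x.
  by rewrite /flip_adj [upair p r _ _]upairC [upair q s _ _]upairC (tri_sym T).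
have sixa x y : (x, y) \in six -> flip_adj x y.
  rewrite !inE !xpair_eqE /flip_adj /upair.
  by do ! [case/orP|]; case/andP=> /eqP-> /eqP->;
    rewrite ?DD ?pr ?sp ?pq ?qr ?rs ?orbT ?andbT.
have old x y : adj x y -> (x, y) \notin six -> ~~ upair p r x y ->
    (y, n x y) \notin six /\ ~~ upair p r y (n x y).
  move=> a h1 h2; have e := tri_rot T a.
  have a2 := tri_adj T a.
  split; last first.
    apply/negP => /orP[]/andP[/eqP ey /eqP ez]; move: e h1;
    by rewrite ez ey ?defs ?defq => <-; rewrite !inE !xpair_eqE ?eqxx ?orbT.
  rewrite !inE !xpair_eqE; apply/negP.
  do ! [case/orP|]; case/andP=> /eqP ey /eqP ez; move: e h1 h2 a2;
    rewrite ez ey ?n_sp ?n_pq ?n_qr ?n_rs ?[adj s q](tri_sym T) ?(negbTE nqs) //;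
    by move=> <-; rewrite !inE !xpair_eqE /upair ?eqxx ?orbT.
have sixn x y : (x, y) \in six -> (y, flip_n x y) \in six /\ flip_n y (flip_n x y) = x.
  rewrite !inE !xpair_eqE.
  by do ! [case/orP|]; case/andP=> /eqP-> /eqP->;
    rewrite ?(flip_nsp, flip_npq, flip_nqs, flip_nqr, flip_nrs, flip_nsq) ?eqxx ?orbT.
have ofadj x y : adj x y -> ~~ upair p r x y -> flip_adj x y.
  by rewrite /flip_adj => -> ->.
have toadj x y : flip_adj x y -> ~~ upair q s x y -> adj x y.
  by rewrite /flip_adj => /orP[/andP[]|->].
have Dadj x y : adj x y -> x != y := @tri_neq _ _ _ T x y.
split.
- by move=> x y; apply/idP/idP; apply: Ds.
- move=> x; rewrite /flip_adj (tri_irr T) /upair /=.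
  by rewrite [_ && (x == q)]andbC orbb; case: eqP => // ->; rewrite !DD.
- move=> x; apply/idP/existsP => [|[y h]].
    rewrite (tri_dom T) => /existsP[y h].
    have [|hh] := boolP (upair p r x y); last by exists y; apply: ofadj.
    case/orP=> /andP[/eqP-> _]; exists q; apply: ofadj; rewrite ?[adj r q](tri_sym T) //;
      by rewrite /upair !DD.
  have [/orP[]/andP[/eqP-> _]|hh] := boolP (upair q s x y).
  + exact: tri_inS T _ _ qr.
  + exact: tri_inS T _ _ sp.
  + exact: tri_inS T _ _ (toadj _ _ h hh).
- move=> x y h; have [k|[k a u]] := flip_adjE h; first by apply: sixa; case: (sixn _ _ k).
  rewrite flip_nE //; have [k1 k2] := old _ _ a k u.
  by apply: ofadj => //; apply: tri_adj T _ _ a.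
- move=> x y h; have [k|[k a u]] := flip_adjE h; first by case: (sixn _ _ k).
  rewrite [flip_n x y]flip_nE //; have [k1 k2] := old _ _ a k u.
  by rewrite flip_nE // (tri_rot T).
- have two6 x y : (x, y) \in six -> flip_n x y != flip_n y x.
    have nsq : adj s q = false by rewrite (tri_sym T) (negbTE nqs).
    rewrite !inE !xpair_eqE.
    do ! [case/orP|]; case/andP=> /eqP-> /eqP->;
      rewrite ?(flip_nsp, flip_npq, flip_nqs, flip_nqr, flip_nrs, flip_nsq) ?DD //;
      rewrite flip_nE ?inE ?xpair_eqE ?DD //; apply/eqP => e.
    + by have := tri_adj T (etrans (tri_sym T _ _) sp); rewrite -e nsq.
    + by have := tri_adj' T (etrans (tri_sym T _ _) pq); rewrite -e nsq.
    + by have := tri_adj T (etrans (tri_sym T _ _) qr); rewrite -e (negbTE nqs).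
    + by have := tri_adj' T (etrans (tri_sym T _ _) rs); rewrite -e (negbTE nqs).
  move=> x y h; have [k|[k a u]] := flip_adjE h; first exact: two6.
  have [k'|[k' _ _]] := flip_adjE (Ds _ _ h); first by rewrite eq_sym two6.
  by rewrite !flip_nE // (tri_two T).
(* Link condition: the cycles around [p] and [r] lose a neighbour, those around [q] and [s] gain
   one, and all others are unchanged. *)
- move=> A x y hxy Ay cl.
  have nonsix u v : u != v -> u \notin [:: p; q; r; s] -> flip_n u v = n u v.
    rewrite !inE !negb_or => _ /and4P[/negbTE u1 /negbTE u2 /negbTE u3 /negbTE u4].
    by apply: flip_nE; rewrite !inE !xpair_eqE u1 u2 u3 u4.
  have [ex|xp] := eqVneq x p.
    subst x.
    have ns : flip_adj p r = false by rewrite /flip_adj /upair !DD /= andbF.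
    (* The lost neighbour [r] sat between [q] and [s] in the old cycle around [p]; it borrows the
       truth value of its successor [s]. *)
    pose A' := [pred z | if z == r then A s else A z].
    have nyr : y != r by apply: contraTneq hxy => ->; rewrite ns.
    have ha : adj p y by apply: toadj => //; rewrite /upair !DD.
    have cl' z : adj p z -> A' z -> A' (n p z).
      rewrite /A' /=; have [->|nzr] := eqVneq z r; first by rewrite defs !DD.
      move=> az Az; have [ez|nzq] := eqVneq z q.
        rewrite ez n_pq eqxx -flip_npq; apply: cl; last by rewrite -ez.
        by apply: sixa; rewrite !inE !xpair_eqE !eqxx orbT.
      have [e|nr] := eqVneq (n p z) r.
        by move: nzq; rewrite -(tri_rot' T az) e defq eqxx.
      have fz : flip_adj p z by apply: ofadj => //; rewrite /upair !DD (negbTE nzr).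
      by have := cl z fz Az; rewrite flip_nE // !inE !xpair_eqE !DD (negbTE nzq).
    move=> z hz.
    have nzr : z != r by apply: contraTneq hz => ->; rewrite ns.
    have az : adj p z by apply: toadj => //; rewrite /upair !DD.
    have Ay' : A' y by rewrite /A' /= (negbTE nyr).
    by have := tri_link T ha Ay' cl' az; rewrite /A' /= (negbTE nzr).
  have [ex|xr] := eqVneq x r.
    subst x.
    have ns : flip_adj r p = false by rewrite /flip_adj /upair !DD /= andbF.
    pose A' := [pred z | if z == p then A q else A z].
    have nyr : y != p by apply: contraTneq hxy => ->; rewrite ns.
    have ha : adj r y by apply: toadj => //; rewrite /upair !DD.
    have cl' z : adj r z -> A' z -> A' (n r z).
      rewrite /A' /=; have [->|nzr] := eqVneq z p; first by rewrite defq !DD.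
      move=> az Az; have [ez|nzq] := eqVneq z s.
        rewrite ez n_rs eqxx -flip_nrs; apply: cl; last by rewrite -ez.
        by apply: sixa; rewrite !inE !xpair_eqE !eqxx !orbT.
      have [e|nr] := eqVneq (n r z) p.
        by move: nzq; rewrite -(tri_rot' T az) e defs eqxx.
      have fz : flip_adj r z by apply: ofadj => //; rewrite /upair !DD (negbTE nzr).
      by have := cl z fz Az; rewrite flip_nE // !inE !xpair_eqE !DD (negbTE nzq).
    move=> z hz.
    have nzr : z != p by apply: contraTneq hz => ->; rewrite ns.
    have az : adj r z by apply: toadj => //; rewrite /upair !DD.
    have Ay' : A' y by rewrite /A' /= (negbTE nyr).
    by have := tri_link T ha Ay' cl' az; rewrite /A' /= (negbTE nzr).
  (* Here [v] is the neighbour gained by [x], inserted between [w] and [z0]: one step of the old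
     cycle becomes two steps of the new one. *)
  have key v w z0 : adj x w -> flip_n x w = v -> n x w = z0 ->
      flip_n x v = z0 -> ~~ adj x v -> flip_adj x v -> adj x z0 ->
      (forall z, adj x z -> z != w -> flip_n x z = n x z) ->
      (forall z, flip_adj x z -> z != v -> adj x z) ->
      (forall z, adj x z -> flip_adj x z) ->
      forall z, flip_adj x z -> A z.
    move=> aw e1 e2 e3 nv fv a0 hn fo fi.
    have cl' z : adj x z -> A z -> A (n x z).
      move=> az Az; have fz := fi _ az; have := cl _ fz Az.
      have [->|nz] := eqVneq z w; last by rewrite hn.
      by rewrite e1 e2 -e3; apply: cl.
    have hA z : adj x z -> A z.
      have [ey|ny] := eqVneq y v; last by move=> az; apply: (tri_link T (fo _ hxy ny) Ay cl' az).
      by apply: (tri_link T a0) => //; rewrite -e3; apply: cl; rewrite -?ey.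
    move=> z; have [-> _|nz fz] := eqVneq z v; last by apply: hA; apply: fo.
    by rewrite -e1; apply: cl; [apply: fi|apply: hA].
  have ups (u v w : V) : upair u v w w = (u == w) && (v == w).
    by rewrite /upair ![w == _]eq_sym; do 2 case: (_ == w).
  have [ex|xq] := eqVneq x q.
    subst x; apply: (key s r p); rewrite ?flip_nqr ?flip_nqs //.
    + by apply: sixa; rewrite !inE !xpair_eqE !eqxx !orbT.
    + by rewrite (tri_sym T).
    + move=> z az nz; rewrite flip_nE // !inE !xpair_eqE !DD (negbTE nz) /=.
      by rewrite orbF; apply: contraNneq nqs => <-.
    + by move=> z fz nz; apply: toadj => //; rewrite /upair !DD (negbTE nz).
    + by move=> z az; apply: ofadj => //; rewrite /upair !DD.
  have [ex|xs] := eqVneq x s.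
    subst x; apply: (key q p r); rewrite ?flip_nsp ?flip_nsq //.
    + by rewrite (tri_sym T).
    + by apply: sixa; rewrite !inE !xpair_eqE !eqxx !orbT.
    + by rewrite (tri_sym T).
    + move=> z az nz; rewrite flip_nE // !inE !xpair_eqE !DD (negbTE nz) /=.
      by apply: contraNneq nqs => <-; rewrite (tri_sym T).
    + by move=> z fz nz; apply: toadj => //; rewrite /upair !DD (negbTE nz).
    + by move=> z az; apply: ofadj => //; rewrite /upair !DD.
  have xo : x \notin [:: p; q; r; s] by rewrite !inE !negb_or xp xq xr xs.
  have fa z : flip_adj x z = adj x z.
    by rewrite /flip_adj /upair (negbTE xp) (negbTE xq) (negbTE xr) (negbTE xs) orbF andbT.
  move=> z; rewrite fa => az; rewrite fa in hxy.
  apply: (tri_link T hxy Ay _ az) => u au Au.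
  by rewrite -nonsix ?(Dadj _ _ au) //; apply: cl => //; rewrite fa.
- move=> A x xS Ax cl y yS; apply: (tri_conn T xS Ax _ yS) => u v uv Au.
  have fa u1 v1 : (u1, v1) \in [:: (p, q); (q, r); (r, q); (q, p)] -> A u1 -> A v1.
    rewrite !inE !xpair_eqE => huv; apply: cl; apply: ofadj; move: huv;
    do ! [case/orP|]; case/andP=> /eqP-> /eqP->; rewrite ?[adj _ q](tri_sym T) //;
    by rewrite ?[adj q p](tri_sym T) // /upair !DD.
  have [|h] := boolP (upair p r u v); last by apply: cl Au; apply: ofadj.
  case/orP=> /andP[/eqP eu /eqP ev]; move: Au; rewrite eu ev => Au.
    by apply: (fa q r); [|apply: (fa p q)]; rewrite // !inE !xpair_eqE !eqxx ?orbT.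
  by apply: (fa q p); [|apply: (fa r q)]; rewrite // !inE !xpair_eqE !eqxx ?orbT.
(* If [Z'] uses [q s], adding the boundary of the face [s p q] gives an even subgraph [Z] of the old
   graph. Since [Z] avoids [p r], both old faces have one colour [k]; the new face [q r s] keeps it
   and [s p q] is coloured [k (+) ze]. *)
- move=> Z' Zs Za Ze; pose ze := Z' q s.
  pose Z x y := Z' x y (+) (ze && (upair q s x y (+) upair q p x y (+) upair p s x y)).
  have Dps : p != s by rewrite eq_sym.
  have Dqp : q != p by rewrite eq_sym.
  have upE (u v : V) x y : upair u v x y -> (x = u /\ y = v) \/ (x = v /\ y = u).
    by case/orP=> /andP[/eqP-> /eqP->]; [left|right].
  have Z'pr x y : upair p r x y -> Z' x y = false.
    move=> h; apply/negP => /Za; rewrite /flip_adj h andbF /=.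
    by case/upE: h => -[-> ->]; rewrite /upair !DD.
  have ZZs x y : Z x y = Z y x by rewrite /Z Zs !(upairC _ _ x y).
  have ZZa x y : Z x y -> adj x y.
    rewrite /Z; have [/upE[] [-> ->]|h1] := boolP (upair q s x y).
    + by rewrite /upair !DD /= andbT addbb.
    + by rewrite /upair !DD /= andbT Zs addbb.
    have [/upE[] [-> ->]|h2] := boolP (upair q p x y) => //.
    + by rewrite (tri_sym T).
    have [/upE[] [-> ->]|h3] := boolP (upair p s x y) => //.
    + by rewrite (tri_sym T).
    by rewrite andbF addbF => /Za /toadj; apply.
  have ZZe x : \big[addb/false]_y Z x y = false.
    rewrite /Z big_split /= Ze /= -big_distrr /= !big_split /= !upair_sum_addb //.
    have [->|_] := eqVneq x q; first by rewrite !DD /= andbF.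
    have [->|_] := eqVneq x p; first by rewrite !DD /= andbF.
    by case: (x == s); rewrite /= ?andbF.
  have [c hc] := tri_jordan T ZZs ZZa ZZe.
  pose k := c p r.
  have hZ x y : upair q s x y = false -> upair q p x y = false -> upair p s x y = false ->
      Z' x y = Z x y.
    by rewrite /Z => -> -> ->; rewrite andbF addbF.
  have crp : c r p = k.
    have [_] := hc _ _ pr; rewrite -hZ ?Z'pr /upair ?DD ?eqxx // -/k.
    by case: k; case: (c r p).
  have cpq : c p q = k by have [e _] := hc _ _ rp; rewrite -crp e defq.
  have cqr : c q r = k by have [e _] := hc _ _ pq; rewrite -cpq e n_pq.
  have crs : c r s = k by have [e _] := hc _ _ pr; rewrite /k e defs.
  have csp : c s p = k by have [e _] := hc _ _ rs; rewrite -crs e n_rs.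
  pose c' x y := if (x == s) && (y == q) then k else
    if [|| (x == q) && (y == s), (x == s) && (y == p) | (x == p) && (y == q)]
    then k (+) ze else c x y.
  have c'E x y : (x, y) \notin six -> c' x y = c x y.
    rewrite !inE !xpair_eqE /c' !negb_or.
    by case/and5P=> /negbTE-> /negbTE-> /negbTE-> _ /andP[_ /negbTE->].
  have c'sq : c' s q = k by rewrite /c' !DD.
  have c'qs : c' q s = k (+) ze by rewrite /c' !DD.
  have c'sp : c' s p = k (+) ze by rewrite /c' !DD.
  have c'pq : c' p q = k (+) ze by rewrite /c' !DD.
  have c'qr : c' q r = k by rewrite /c' !DD.
  have c'rs : c' r s = k by rewrite /c' !DD.
  have Z6 x y : (x, y) \in six -> Z' x y = c' x y (+) c' y x.
    rewrite !inE !xpair_eqE.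
    have o u v : (u, v) \notin six -> adj v u -> c' u v = Z v u (+) c v u.
      move=> h a; rewrite c'E //; have [_ ->] := hc _ _ a.
      by case: (c v u); case: (c u v).
    have b3 (u v w : bool) : v = u (+) w (+) (v (+) w (+) u) by move: u v w => [] [] [].
    have b2 (u v : bool) : v = u (+) (v (+) u) by move: u v => [] [].
    do ! [case/orP|]; case/andP=> /eqP-> /eqP->;
      rewrite ?(c'sq, c'qs, c'sp, c'pq, c'qr, c'rs).
    + rewrite o // ?csp; last by rewrite !inE !xpair_eqE !DD.
      by rewrite /Z /upair !DD /= andbT; exact: b3.
    + rewrite o // ?cpq; last by rewrite !inE !xpair_eqE !DD.
      by rewrite /Z /upair !DD /= andbT; exact: b3.
    + by rewrite -addbA -b2.
    + rewrite o // ?cqr; last by rewrite !inE !xpair_eqE !DD.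
      by rewrite -hZ /upair ?DD //; exact: b2.
    + rewrite o // ?crs; last by rewrite !inE !xpair_eqE !DD.
      by rewrite -hZ /upair ?DD //; exact: b2.
    + by rewrite Zs addbC -addbA -b2.
  exists c' => x y h; split.
    have [k6|[k6 a u]] := flip_adjE h; last first.
      have [k7 _] := old _ _ a k6 u.
      by rewrite flip_nE // !c'E //; case: (hc _ _ a).
    move: k6; rewrite !inE !xpair_eqE.
    by do ! [case/orP|]; case/andP=> /eqP-> /eqP->;
      rewrite ?(flip_nsp, flip_npq, flip_nqs, flip_nqr, flip_nrs, flip_nsq)
              ?(c'sq, c'qs, c'sp, c'pq, c'qr, c'rs).
  have [k6|[k6 a u]] := flip_adjE h; first exact: Z6.
  have [k7|[k7 _ _]] := flip_adjE (Ds _ _ h); first by rewrite Zs Z6 // addbC.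
  rewrite !c'E // hZ; first by case: (hc _ _ a).
  + by apply/negP => /upE[] [ex ey]; move: k6; rewrite ex ey !inE !xpair_eqE !eqxx ?orbT.
  + by apply/negP => /upE[] [ex ey]; move: k6 k7; rewrite ex ey !inE !xpair_eqE !eqxx ?orbT.
  + by apply/negP => /upE[] [ex ey]; move: k6 k7; rewrite ex ey !inE !xpair_eqE !eqxx ?orbT.
- rewrite -(tri_count T); congr (_ + _).
  apply: (@addIn 2); rewrite -{1}(upair_sum_nat Dpr) -(upair_sum_nat Dqs) -!big_split /=.
  apply: eq_bigr => x _; rewrite -!big_split /=; apply: eq_bigr => y _.
  rewrite /flip_adj; have [|h] := boolP (upair p r x y).
    by case/orP=> /andP[/eqP-> /eqP->]; rewrite /upair !DD ?pr ?rp.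
  have [|h'] := boolP (upair q s x y); last by rewrite andbT orbF.
  by case/orP=> /andP[/eqP-> /eqP->]; rewrite ?[adj s q](tri_sym T) (negbTE nqs).
Qed.
End Flip.

(** * Removal of a vertex of degree 3 *)

Section Remove.
Variables (S : {set V}) (adj : rel V) (n : V -> V -> V).
Hypothesis T : tri S adj n.
Variable v : V.
Hypotheses (vS : v \in S) (rot3 : forall x, adj v x -> n v (n v (n v x)) = x).

Definition rem_adj x y := [&& adj x y, x != v & y != v].
(** The three faces at [v] merge into one: an edge whose face had the apex [v] now sees the
    remaining neighbour of [v]. *)
Definition rem_n x y := if n x y == v then n v y else n x y.

Let av x : adj v x -> adj v (n v x).
Proof. by move=> h; rewrite (tri_sym T); apply: tri_adj' T _ _ h. Qed.

Lemma rem_link_nbr x : adj v x -> n x v = n v (n v x).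
Proof.
move=> h; have h' : adj x v by rewrite (tri_sym T).
apply: (tri_inj T (x := v)).
- exact: tri_adj T _ _ h'.
- by do 2 apply: av.
- by rewrite (tri_rot T h') rot3.
Qed.

(** Needed for [tri_two] after the removal: if an edge opposite to [v] has the third neighbour of
    [v] as its other apex, then [v] and its neighbours are closed under adjacency and exhaust
    [S]. *)
Lemma rem_K4 x : adj v x -> n (n v x) x = n v (n v x) -> #|S| <= 4.
Proof.
move=> h; set y := n v x; set z := n v y => e.
have hy : adj v y := av h.
have hz : adj v z := av hy.
have zx : n v z = x := rot3 h.
have yx : adj y x by rewrite (tri_sym T); apply: tri_adj T _ _ h.
have nx : forall u, adj x u -> u \in [:: v; y; z].
  apply: (tri_link T (y := v)); rewrite ?inE ?eqxx // 1?(tri_sym T) // => u _ /=.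
  rewrite !inE => /or3P[] /eqP->.
  - by rewrite (rem_link_nbr h) eqxx !orbT.
  - by rewrite /y (tri_rot T h) eqxx.
  - by rewrite -e (tri_rot T yx) eqxx orbT.
have ny : forall u, adj y u -> u \in [:: v; x; z].
  apply: (tri_link T (y := v)); rewrite ?inE ?eqxx // 1?(tri_sym T) // => u _ /=.
  rewrite !inE => /or3P[] /eqP->.
  - by rewrite (rem_link_nbr hy) -/z zx eqxx !orbT.
  - by rewrite e eqxx !orbT.
  - by rewrite (tri_rot T hy) eqxx.
have nz : forall u, adj z u -> u \in [:: v; x; y].
  apply: (tri_link T (y := v)); rewrite ?inE ?eqxx // 1?(tri_sym T) // => u _ /=.
  rewrite !inE => /or3P[] /eqP->.
  - by rewrite (rem_link_nbr hz) zx eqxx !orbT.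
  - by rewrite -[in n z x]zx (tri_rot T hz) eqxx.
  - by rewrite -e (tri_rot' T yx) eqxx !orbT.
have nv : forall u, adj v u -> u \in [:: x; y; z].
  apply: (tri_link T h); rewrite ?inE ?eqxx // => u _ /=.
  by rewrite !inE => /or3P[] /eqP->; rewrite -?/y -?/z ?zx eqxx ?orbT.
have sub : S \subset [:: v; x; y; z].
  apply/subsetP => u; apply: (tri_conn T (A := [pred w | w \in [:: v; x; y; z]]) vS).
    by rewrite /= !inE eqxx.
  move=> a b ab /=; rewrite !inE => /or4P[] /eqP ea; move: ab; rewrite ea.
  - by move/nv; rewrite !inE => ->; rewrite orbT.
  - by move/nx; rewrite !inE => /or3P[]->; rewrite ?orbT.
  - by move/ny; rewrite !inE => /or3P[]->; rewrite ?orbT.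
  - by move/nz; rewrite !inE => /or3P[]->; rewrite ?orbT.
exact: leq_trans (subset_leq_card sub) (card_size _).
Qed.

Lemma rem_deg : \sum_y (adj v y : nat) = 3.
Proof.
have /existsP[x h] : [exists y, adj v y] by rewrite -(tri_dom T).
have hy := av h; have hz := av hy.
have n1 := tri_neq T (tri_adj T h); have n2 := tri_neq T (tri_adj T hy).
have n3 := tri_neq T (tri_adj T hz); rewrite rot3 // in n3.
have nv : forall u, adj v u -> u \in [:: x; n v x; n v (n v x)].
  apply: (tri_link T h); rewrite ?inE ?eqxx // => u _ /=.
  by rewrite !inE => /or3P[] /eqP->; rewrite ?(rot3 h) eqxx ?orbT.
have u3 : uniq [:: x; n v x; n v (n v x)].
  by rewrite /= !inE negb_or n1 n2 eq_sym n3.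
rewrite -[3]/(size [:: x; n v x; n v (n v x)]) -(card_uniqP u3) -sum1_card [RHS]big_mkcond /=.
apply: eq_bigr => u _; have [/nv -> //|nu] := boolP (adj v u).
by case: ifP => //; rewrite !inE => /or3P[] /eqP eu; move: nu; rewrite eu ?h ?hy ?hz.
Qed.

Lemma rem_tri : 4 < #|S| -> tri (S :\ v) rem_adj rem_n.
Proof.
move=> S5; have Dv x y : rem_adj x y -> rem_adj y x.
  by rewrite /rem_adj (tri_sym T) => /and3P[-> -> ->].
have toadj x y : rem_adj x y -> adj x y by case/and3P.
have face x y : adj x y -> n x y = v -> [/\ adj v x, n v x = y, adj v y & n y v = x].
  move=> h e; have h1 := tri_adj' T h; have h2 := tri_adj T h.
  rewrite e in h1 h2; split=> //; first by rewrite -e (tri_rot' T).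
    by rewrite (tri_sym T).
  by rewrite -e (tri_rot T).
split.
- by move=> x y; apply/idP/idP; apply: Dv.
- by move=> x; rewrite /rem_adj (tri_irr T).
- move=> x; apply/idP/existsP => [|[y /and3P[a xv _]]]; last first.
    by rewrite !inE xv (tri_inS T a).
  rewrite !inE (tri_dom T) => /andP[xv /existsP[y a]].
  have [ey|yv] := eqVneq y v; last by exists y; rewrite /rem_adj a xv yv.
  exists (n x y); rewrite /rem_adj xv (tri_sym T) (tri_adj' T a) /=.
  by rewrite ey eq_sym (tri_neq T) // -ey (tri_adj T).
- move=> x y /and3P[a xv yv]; rewrite /rem_n /rem_adj.
  have [e|e] := eqVneq (n x y) v; last by rewrite yv e (tri_adj T).
  have [h1 h2 h3 _] := face _ _ a e.
  by rewrite (tri_adj T h3) yv eq_sym (tri_neq T (av h3)).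
- move=> x y /and3P[a xv yv]; rewrite /rem_n.
  have [e|e] := eqVneq (n x y) v; last by rewrite (tri_rot T a) (negbTE xv).
  have [h1 h2 h3 _] := face _ _ a e.
  by rewrite (tri_rot T h3) eqxx -h2 rot3.
- have key x y : adj x y -> n x y = v -> n v y != n y x.
    move=> a e; have [h1 h2 h3 _] := face _ _ a e.
    apply/eqP => e2; have := @rem_K4 x h1; rewrite h2 e2 => /(_ erefl).
    by rewrite leqNgt S5.
  move=> x y /and3P[a xv yv]; rewrite /rem_n.
  have a' : adj y x by rewrite (tri_sym T).
  have tw := tri_two T a.
  have [e|e] := eqVneq (n x y) v; have [e'|e'] := eqVneq (n y x) v => //.
  + by rewrite e e' eqxx in tw.
  + exact: key.
  + by rewrite eq_sym; apply: key.
- move=> A x y /and3P[a xv yv] Ay cl z /and3P[az _ zv].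
  (* Around [x] the removed vertex borrows the value of its successor. *)
  pose A' := [pred u | if u == v then A (n x v) else A u].
  have Ay' : A' y by rewrite /A' /= (negbTE yv).
  suff cl' u : adj x u -> A' u -> A' (n x u).
    by have := tri_link T a Ay' cl' az; rewrite /A' /= (negbTE zv).
  rewrite /A' /= => au; have [->|uv] := eqVneq u v => [|Au].
    by case: ifP.
  have ru : rem_adj x u by rewrite /rem_adj au xv uv.
  have := cl _ ru Au; rewrite /rem_n.
  have [e|e] := eqVneq (n x u) v => //.
  have [h1 h2 h3 _] := face _ _ au e.
  by rewrite (rem_link_nbr h1) h2.
- move=> A x; rewrite !inE => /andP[xv xS] Ax cl y; rewrite !inE => /andP[yv yS].
  have /existsP[a ha] : [exists y, adj v y] by rewrite -(tri_dom T).
  have all_nbr u w : adj v u -> adj v w -> A u -> A w.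
    move=> hu hw Au; apply: (tri_link T hu Au _ hw) => t ht; apply: cl.
    rewrite /rem_adj (tri_adj T ht) eq_sym (tri_neq T ht) eq_sym.
    exact: tri_neq T _ _ (av ht).
  (* The neighbours of [v] lie on the surviving triangle, so [A] holds at all of them or at none;
     [v] receives the common value. *)
  pose A' := [pred u | if u == v then A a else A u].
  have Ax' : A' x by rewrite /A' /= (negbTE xv).
  suff cl' u w : adj u w -> A' u -> A' w.
    by have := tri_conn T xS Ax' cl' yS; rewrite /A' /= (negbTE yv).
  rewrite /A' /= => uw; have [eu|uv] := eqVneq u v; have [ew|wv] := eqVneq w v.
  + by [].
  + by apply: all_nbr => //; rewrite -eu.
  + by apply: all_nbr => //; rewrite -ew (tri_sym T).
  + by apply: cl; rewrite /rem_adj uw uv wv.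
(* [Z] has no edge at [v], so the three merged faces already have the same colour. *)
- move=> Z Zs Za Ze.
  have [c hc] := tri_jordan T Zs (fun x y h => toadj _ _ (Za x y h)) Ze.
  exists c => x y /and3P[a xv yv]; have [e1 e2] := hc _ _ a; split=> //.
  rewrite /rem_n; have [e|e] := eqVneq (n x y) v => //.
  have [h1 h2 h3 h4] := face _ _ a e.
  have [f1 _] := hc _ _ h3; have [f2 _] := hc _ _ (tri_adj T h3).
  rewrite (tri_rot T h3) in f2.
  have a' : adj y v by rewrite (tri_sym T).
  have [f3 _] := hc _ _ a'; rewrite h4 in f3.
  rewrite e1 e f3 -f1.
  apply: (colour_const T hc) => // u; apply/negP => /Za.
  by rewrite /rem_adj eqxx andbF.
(* Six directed edges disappear, three leaving [v] and three entering it. *)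
- have := tri_count T; rewrite (cardsD1 v S) vS mulnDr => e.
  apply/eqP; rewrite -(eqn_add2r 6) addnC [6 * _ + 6]addnC -e addnA; apply/eqP.
  congr (_ + _); rewrite addnC -[6]/(3 + 3) -rem_deg.
  rewrite {2}(_ : \sum_y (adj v y : nat) = \sum_x \sum_y ((x == v) && adj v y : nat)); last first.
    by rewrite [RHS](bigD1 v) //= eqxx [X in _ + X]big1 ?addn0 // => x /negbTE-> ; rewrite big1.
  rewrite (_ : \sum_y (adj v y : nat) = \sum_x \sum_y ((y == v) && adj x v : nat)); last first.
    rewrite [RHS]exchange_big [RHS](bigD1 v) //= eqxx [X in _ + X]big1 ?addn0 => [|x /negbTE->]; last by rewrite big1.
    by apply: eq_bigr => y _; rewrite (tri_sym T).
  rewrite -!big_split /=; apply: eq_bigr => x _; rewrite -!big_split /=; apply: eq_bigr => y _.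
  rewrite /rem_adj; have [->|xv] := eqVneq x v; have [->|yv] := eqVneq y v;
  by rewrite ?(tri_irr T) ?andbT ?andbF /= ?addn0.
Qed.
End Remove.
End Tri.

(** * Contraction of an edge at a vertex of degree at most 5 *)

Section Contract.
Variable V : finType.
Implicit Types (S : {set V}) (adj : rel V) (n : V -> V -> V).

Definition deg adj v := \sum_y (adj v y : nat).

Definition new_adj adj v w (zs : seq V) : rel V := fun x y =>
  [|| [&& adj x y, x != v & y != v], (x == w) && (y \in zs) | (y == w) && (x \in zs)].

Section Link.
Variables (S : {set V}) (adj : rel V) (n : V -> V -> V).
Hypothesis T : tri S adj n.

Lemma tri_rotl v x : adj v x -> adj v (n v x).
Proof. by move=> h; rewrite (tri_sym T) (tri_adj' T). Qed.

(** [n v] is injective on the neighbours of [v]; extended by the identity it is injective on [V],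
    and by [tri_link] a single orbit contains all the neighbours. Lengths 1 and 2 are excluded by
    [tri_neq] and [tri_two]. *)
Lemma link_cycle v : v \in S -> exists s : seq V,
  [/\ uniq s, (forall y, (y \in s) = adj v y), 2 < size s, size s = deg adj v &
      forall i, i < size s -> n v (nth v s i) = nth v s (i.+1 %% size s)].
Proof.
rewrite (tri_dom T) => /existsP[x hx].
pose f y := if adj v y then n v y else y.
have fadj y : adj v (f y) = adj v y.
  by rewrite /f; case: ifP => // h; rewrite tri_rotl.
have finj : injective f.
  move=> y z e; have := congr1 (adj v) e; rewrite !fadj.
  move: e; rewrite /f; case: ifP => hy; case: ifP => hz e; rewrite ?hy ?hz // => _.
  exact: (tri_inj T hy hz e).
have mem y : (y \in fingraph.orbit f x) = adj v y.
  rewrite -fconnect_orbit; apply/idP/idP => [/iter_findex <-|].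
    by elim: (findex _ _ _) => //= m; rewrite fadj.
  apply: (tri_link T (A := fconnect f x) hx); first exact: connect0.
  move=> z hz xz; apply: connect_trans xz _.
  by apply: connect1; rewrite /= /f hz.
have un := orbit_uniq f x.
have cyc i : i < size (fingraph.orbit f x) ->
    n v (nth v (fingraph.orbit f x) i) = nth v (fingraph.orbit f x) (i.+1 %% size (fingraph.orbit f x)).
  move=> hi; have hm : adj v (nth v (fingraph.orbit f x) i) by rewrite -mem mem_nth.
  have e : n v (nth v (fingraph.orbit f x) i) = f (nth v (fingraph.orbit f x) i) by rewrite /f hm.
  rewrite e; move: hi; rewrite size_orbit => hi.
  have o0 : 0 < fingraph.order f x by apply: leq_ltn_trans hi.
  have nthE j : j < fingraph.order f x -> nth v (fingraph.orbit f x) j = iter j f x.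
    by move=> hj; rewrite (set_nth_default x) ?size_orbit // nth_traject.
  rewrite !nthE ?ltn_mod // -iterS.
  have [lt|ge] := ltnP i.+1 (fingraph.order f x); first by rewrite modn_small.
  have ei : i.+1 = fingraph.order f x by apply/eqP; rewrite eqn_leq hi.
  by rewrite -ei modnn ei /= iter_order.
exists (fingraph.orbit f x); split=> //; last first.
  rewrite -(card_uniqP un) -sum1_card big_mkcond; apply: eq_bigr => y _.
  by rewrite mem; case: (adj v y).
case: (fingraph.orbit f x) cyc mem un => [|x0 [|x1 [|x2 s]]] // cyc mem _.
- by have := mem x; rewrite hx.
- have := cyc 0 isT; rewrite /= => e.
  have h0 : adj v x0 by rewrite -mem inE.
  by have := tri_neq T (tri_adj T h0); rewrite e eqxx.
- have e0 := cyc 0 isT; have e1 := cyc 1 isT; rewrite /= in e0 e1.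
  have h0 : adj v x0 by rewrite -mem inE eqxx.
  have h1 : adj v x1 by rewrite -mem !inE eqxx orbT.
  have := tri_two T h0; rewrite e0 -e1.
  by rewrite (tri_rot' T h1) eqxx.
Qed.

Lemma deg_ge3 v : v \in S -> 3 <= deg adj v.
Proof. by case/link_cycle => s [_ _ h <- _]. Qed.

Lemma sum_deg : \sum_(v in S) deg adj v + 12 = 6 * #|S|.
Proof.
rewrite -(tri_count T); congr (_ + _); rewrite [LHS]big_mkcond; apply: eq_bigr => v _.
case: ifPn => // vS; rewrite big1 // => y _.
by apply/eqP; rewrite eqb0; apply: contra vS => h; rewrite (tri_inS T h).
Qed.

(* The degrees are at least 3 and the numbers [6 - deg] add up to 12. *)
Lemma exists_low (U : {set V}) : #|U| <= 4 ->
  (exists v, [/\ v \in S, v \notin U & deg adj v <= 5]) \/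
  (#|U| = 4 /\ forall v, v \in U -> v \in S /\ deg adj v = 3).
Proof.
move=> U4; have [/existsP[v /and3P[h1 h2 h3]]|no] :=
  boolP [exists v, [&& v \in S, v \notin U & deg adj v <= 5]]; first by left; exists v.
right; have hi v : v \in S -> v \notin U -> 6 <= deg adj v.
  move=> vS vU; rewrite ltnNge; apply: contra no => h; apply/existsP; exists v.
  by rewrite vS vU.
have e := sum_deg.
(* A deficit [6 - deg] is at most 3 and is positive only on [U]; four vertices reach the total 12
   only if each has deficit exactly 3. *)
have lb v : v \in S -> 6 <= deg adj v + 3 * (v \in U).
  move=> vS; have := deg_ge3 vS; have := hi v vS.
  by case: (v \in U) => /=; lia.
pose ex v := deg adj v + 3 * (v \in U) - 6.
have eq1 : \sum_(v in S) (deg adj v + 3 * (v \in U)) = 6 * #|S| + \sum_(v in S) ex v.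
  rewrite mulnC -sum_nat_const -big_split /=; apply: eq_bigr => v vS.
  by rewrite /ex subnKC ?lb.
have cU : \sum_(v in S) (v \in U : nat) = #|S :&: U|.
  rewrite -sum1_card [RHS]big_mkcond [LHS]big_mkcond; apply: eq_bigr => v _.
  by rewrite inE; case: (v \in S); case: (v \in U).
rewrite big_split /= -big_distrr /= cU in eq1.
have sub : #|S :&: U| <= #|U| by rewrite subset_leq_card // subsetIr.
have cU4 : #|U| = 4 by lia.
have ex0 : \sum_(v in S) ex v = 0 by lia.
have USe : S :&: U = U by apply/eqP; rewrite eqEcard subsetIr; lia.
split=> // v vU; have vS : v \in S by move: vU; rewrite -USe inE => /andP[].
split=> //; move/eqP: ex0; rewrite sum_nat_eq0 => /forallP/(_ v).
by rewrite vS /ex vU /=; have := deg_ge3 vS; lia.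
Qed.

(** A vertex has at least three neighbours, which together with it fill [S]. *)
Lemma neighbours_lt v : v \in S -> #|S| <= 4 -> forall x, x \in S -> x != v -> adj v x.
Proof.
move=> vS S4 x xS xv; apply: contraT => nx.
have [s [us ms s2 _ _]] := link_cycle vS.
have sub : [set y in [:: v, x & s]] \subset S.
  apply/subsetP => y; rewrite !inE ms => /or3P[/eqP->|/eqP->|h] //.
  by rewrite (tri_inS T (y := v)) // (tri_sym T).
have := subset_leq_card sub; rewrite cardsE (card_uniqP _) /=; first lia.
by rewrite us !inE !ms nx eq_sym (negbTE xv) (tri_irr T).
Qed.

End Link.

(** Flip [v x1] into [x0 x2]; then [v] has degree 3 and is removed. *)
Lemma contract4 S adj n v x0 x1 x2 x3 : tri S adj n -> v \in S -> 4 < #|S| ->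
  uniq [:: x0; x1; x2; x3] -> (forall y, adj v y = (y \in [:: x0; x1; x2; x3])) ->
  n v x0 = x1 -> n v x1 = x2 -> n v x2 = x3 -> n v x3 = x0 -> ~~ adj x0 x2 ->
  exists n', [/\ tri (S :\ v) (new_adj adj v x0 [:: x2]) n',
    n' x0 x1 = x2, n' x0 x2 = x3 &
    forall x y, adj x y -> x != v -> y != v -> n x y != v -> n' x y = n x y].
Proof.
move=> T vS S5 un N e0 e1 e2 e3 na.
have h0 : adj v x0 by rewrite N !inE eqxx.
have h1 : adj v x1 by rewrite N !inE eqxx orbT.
have h2 : adj v x2 by rewrite N !inE eqxx !orbT.
have h3 : adj v x3 by rewrite N !inE eqxx !orbT.
have v0 := tri_neq T h0; have v1 := tri_neq T h1.
have v2 := tri_neq T h2; have v3 := tri_neq T h3.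
have q : n x1 v = x0 by rewrite -e0 (tri_rot' T h0).
have TF := flip_tri T h1 q e1 na.
move: un; rewrite /= !inE !negb_or andbT => /and3P[/and3P[n01 n02 n03] /andP[n12 n13] n23].
have fE := flip_nE; set fn := flip_n n v x0 x1 x2 in fE TF *.
set fa := flip_adj adj v x0 x1 x2 in TF *.
have f20 : fn v x0 = x2 by rewrite /fn (flip_npq T h1 q e1).
have f23 : fn v x2 = x3.
  by rewrite /fn fE // !inE !xpair_eqE ?eqxx /= ?(negbTE v0) ?(negbTE v1) ?(negbTE v2)
    ?[x2 == x0]eq_sym ?(negbTE n02) // ?andbF.
have f30 : fn v x3 = x0.
  by rewrite /fn fE // !inE !xpair_eqE ?eqxx /= ?(negbTE v0) ?(negbTE v1) ?(negbTE v2)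
    ?[x3 == x0]eq_sym ?(negbTE n03) // ?andbF.
have rot3 x : fa v x -> fn v (fn v (fn v x)) = x.
  rewrite /fa /flip_adj /upair eqxx (negbTE v0) (negbTE v2) (negbTE v1) /= !orbF N !inE.
  by case/andP => /or4P[]/eqP->; rewrite ?eqxx ?f20 ?f23 ?f30 ?f20 ?f23 ?f30.
have TR := rem_tri TF vS rot3 S5.
exists (rem_n fn v); split.
- have -> // : new_adj adj v x0 [:: x2] = rem_adj fa v.
  apply/funext => x; apply/funext => y; rewrite /new_adj /rem_adj /fa /flip_adj /upair !inE.
  have [->|xv] := eqVneq x v; first by rewrite ?(negbTE v0) ?(negbTE v2) /= !andbF.
  have [->|yv] := eqVneq y v; first by rewrite ?(negbTE v0) ?(negbTE v2) /= !andbF.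
  by rewrite /= ?andbF ?andbT /= ?andbT; case: (adj x y) (x == x0) (y == x0) (x == x2) (y == x2) => [] [] [] [] [].
- rewrite /rem_n; have -> : fn x0 x1 = x2 by rewrite /fn (flip_nqr T h1 q e1).
  by rewrite eq_sym (negbTE v2).
- rewrite /rem_n; have -> : fn x0 x2 = v by rewrite /fn (flip_nqs T h1 q e1).
  by rewrite eqxx.
move=> x y a xv yv nv; rewrite /rem_n.
have -> : fn x y = n x y; last by rewrite (negbTE nv).
rewrite /fn fE // !inE !xpair_eqE (negbTE xv) (negbTE yv) ?andbF /=.
apply/negP => /or4P[]/andP[/eqP ex /eqP ey]; move: a nv; rewrite ex ey.
- by rewrite (negbTE na).
- by rewrite -[x1]e0 (tri_rot T h0) eqxx.
- by rewrite -[x2]e1 (tri_rot T h1) eqxx.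
- by rewrite (tri_sym T) (negbTE na).
Qed.

(** Flipping [v x1] into [x0 x2] lowers the degree of [v] to 4; [contract4] then flips [v x2] into
    [x0 x3] and removes [v]. *)
Lemma contract5 S adj n v x0 x1 x2 x3 x4 : tri S adj n -> v \in S -> 4 < #|S| ->
  uniq [:: x0; x1; x2; x3; x4] -> (forall y, adj v y = (y \in [:: x0; x1; x2; x3; x4])) ->
  n v x0 = x1 -> n v x1 = x2 -> n v x2 = x3 -> n v x3 = x4 -> n v x4 = x0 ->
  ~~ adj x0 x2 -> ~~ adj x0 x3 ->
  exists n', [/\ tri (S :\ v) (new_adj adj v x0 [:: x2; x3]) n',
    n' x0 x1 = x2, n' x0 x3 = x4 &
    forall x y, adj x y -> x != v -> y != v -> n x y != v -> n' x y = n x y].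
Proof.
move=> T vS S5 un N e0 e1 e2 e3 e4 na nb.
have h0 : adj v x0 by rewrite N !inE eqxx.
have h1 : adj v x1 by rewrite N !inE eqxx orbT.
have h2 : adj v x2 by rewrite N !inE eqxx !orbT.
have h3 : adj v x3 by rewrite N !inE eqxx !orbT.
have h4 : adj v x4 by rewrite N !inE eqxx !orbT.
have v0 := tri_neq T h0; have v1 := tri_neq T h1.
have v2 := tri_neq T h2; have v3 := tri_neq T h3; have v4 := tri_neq T h4.
have q : n x1 v = x0 by rewrite -e0 (tri_rot' T h0).
have TF := flip_tri T h1 q e1 na.
move: un; rewrite /= !inE !negb_or andbT.
case/and4P=> [/and4P[n01 n02 n03 n04] /and3P[n12 n13 n14] /andP[n23 n24] n34].
have fE := flip_nE; set fn := flip_n n v x0 x1 x2 in fE TF *.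
set fa := flip_adj adj v x0 x1 x2 in TF *.
have f20 : fn v x0 = x2 by rewrite /fn (flip_npq T h1 q e1).
have f23 : fn v x2 = x3.
  by rewrite /fn fE // !inE !xpair_eqE ?eqxx /= ?(negbTE v0) ?(negbTE v1) ?(negbTE v2)
    ?[x2 == x0]eq_sym ?(negbTE n02) // ?andbF.
have f34 : fn v x3 = x4.
  by rewrite /fn fE // !inE !xpair_eqE ?eqxx /= ?(negbTE v0) ?(negbTE v1) ?(negbTE v2)
    ?[x3 == x0]eq_sym ?(negbTE n03) // ?andbF.
have f40 : fn v x4 = x0.
  by rewrite /fn fE // !inE !xpair_eqE ?eqxx /= ?(negbTE v0) ?(negbTE v1) ?(negbTE v2)
    ?[x4 == x0]eq_sym ?(negbTE n04) // ?andbF.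
have Nf y : fa v y = (y \in [:: x0; x2; x3; x4]).
  rewrite /fa /flip_adj /upair eqxx (negbTE v0) (negbTE v2) (negbTE v1) /= !orbF N !inE.
  have [->|ny] := eqVneq y x1; last by rewrite andbT.
  rewrite orbT [x1 == x0]eq_sym.
  by rewrite (negbTE n01) (negbTE n12) (negbTE n13) (negbTE n14).
have nf : ~~ fa x0 x3.
  rewrite /fa /flip_adj /upair eqxx [x3 == x0]eq_sym [x3 == x2]eq_sym.
  by rewrite (negbTE nb) (negbTE n23) (negbTE n03) (negbTE n02).
have uf : uniq [:: x0; x2; x3; x4].
  by rewrite /= !inE !negb_or n02 n03 n04 n23 n24 n34.
have [n' [Tn m1 m2 m3]] := contract4 TF vS S5 uf Nf f20 f23 f34 f40 nf.
have old x y : adj x y -> x != v -> y != v -> n x y != v -> fa x y /\ fn x y = n x y.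
  move=> a xv yv nv; split.
    by rewrite /fa /flip_adj a /upair (negbTE xv) (negbTE yv) andbF.
  rewrite /fn fE // !inE !xpair_eqE (negbTE xv) (negbTE yv) ?andbF /=.
  apply/negP => /or4P[]/andP[/eqP ex /eqP ey]; move: a nv; rewrite ex ey.
  - by rewrite (negbTE na).
  - by rewrite -[x1]e0 (tri_rot T h0) eqxx.
  - by rewrite -[x2]e1 (tri_rot T h1) eqxx.
  - by rewrite (tri_sym T) (negbTE na).
exists n'; split=> //.
- have -> // : new_adj adj v x0 [:: x2; x3] = new_adj fa v x0 [:: x3].
  apply/funext => x; apply/funext => y; rewrite /new_adj /fa /flip_adj /upair !inE.
  have [->|xv] := eqVneq x v; first by rewrite ?(negbTE v0) ?(negbTE v2) /= !andbF.
  have [->|yv] := eqVneq y v; first by rewrite ?(negbTE v0) ?(negbTE v2) /= !andbF.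
  rewrite /= !andbF !andbT /=.
  by case: (adj x y) (x == x0) (y == x0) (x == x2) (y == x2) (x == x3) (y == x3)
    => [] [] [] [] [] [] [].
- have f01 : fn x0 x1 = x2 by rewrite /fn (flip_nqr T h1 q e1).
  have a01 : fa x0 x1.
    have := tri_adj T h0; rewrite e0 => a; rewrite /fa /flip_adj a /upair.
    by rewrite ![_ == v]eq_sym (negbTE v0) (negbTE v1) /= andbF.
  by rewrite m3 ?f01 // eq_sym.
move=> x y a xv yv nv; have [a' e'] := old _ _ a xv yv nv.
by rewrite m3 ?e'.
Qed.

(* [v] is contracted onto its neighbour [w]; [a] and [b] are the common neighbours
   of [v] and [w], and the other neighbours [zs] of [v] become adjacent to [w]. *)
Record contraction S adj n (B : {set {set V}}) v w a b zs n' : Prop := Contraction {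
  ct_tri : tri (S :\ v) (new_adj adj v w zs) n';
  ct_w : adj v w;
  ct_a : adj v a /\ adj w a;
  ct_b : adj v b /\ adj w b;
  ct_ab : a != b;
  ct_z : forall z, z \in zs -> [/\ adj v z, ~~ adj w z, z != w, z != a & z != b];
  ct_face0 : zs = [::] -> n' w a = b;
  ct_face : forall z, z \in zs -> n' w a = z \/ n' w z = b;
  ct_old : forall x y, adj x y -> x != v -> y != v -> n x y != v -> n' x y = n x y;
  ct_B : forall z1 z2, z1 \in zs -> z2 \in zs ->
    [set w; z1] \in B -> [set w; z2] \in B -> z1 = z2;
  ct_deg : deg adj v = 3 -> zs = [::] }.

Lemma set2_eq (x y z t : V) : [set x; y] = [set z; t] ->
  (x = z /\ y = t) \/ (x = t /\ y = z).
Proof.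
move=> e.
have h1 : x = z \/ x = t by apply/set2P; rewrite -e set21.
have h2 : y = z \/ y = t by apply/set2P; rewrite -e set22.
have h3 : z = x \/ z = y by apply/set2P; rewrite e set21.
have h4 : t = x \/ t = y by apply/set2P; rewrite e set22.
case: h1 => h1; case: h2 => h2; case: h3 => h3; case: h4 => h4;
  solve [left; split; congruence | right; split; congruence].
Qed.

(** The target [w] must have no edge among its diagonals in the link of [v]. In degree 4,
    [noncrossing] leaves one of the two diagonals free. In degree 5, the diagonals that are edges
    pairwise do not cross, so there are at most two, and two of them share an end; at least two
    candidates for [w] remain. A candidate violates [ct_B] only if both its diagonals are braces,
    and two braces can spoil only one candidate. *)
Lemma contract_low S adj n (B : {set {set V}}) v : tri S adj n -> v \in S -> 4 < #|S| ->
  deg adj v <= 5 -> #|B| <= 2 ->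
  exists w a b zs n', contraction S adj n B v w a b zs n'.
Proof.
move=> T vS S5 d5 B2.
have [s [us ms s2 ds cyc]] := link_cycle T vS.
have nb y : adj v y = (y \in s) by rewrite ms.
have cons x y : adj v x -> n v x = y -> adj x y by move=> h <-; apply: tri_adj T _ _ h.
have snoc x y : adj v x -> n v x = y -> adj y x by move=> h e; rewrite (tri_sym T) cons.
rewrite -ds in d5.
case: s us ms s2 ds cyc nb d5 => [|x0 [|x1 [|x2 s]]] // us ms _ ds cyc nb d5.
have h0 : adj v x0 by rewrite nb !inE eqxx.
have h1 : adj v x1 by rewrite nb !inE eqxx orbT.
have h2 : adj v x2 by rewrite nb !inE eqxx !orbT.
have e0 := cyc 0 isT; have e1 := cyc 1 isT; have e2 := cyc 2 isT.
case: s us ms ds cyc nb d5 e0 e1 e2 => [|x3 s] us ms ds cyc nb d5 e0 e1 e2; rewrite /= in e0 e1 e2.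
  have rot3 x : adj v x -> n v (n v (n v x)) = x.
    by rewrite nb !inE => /or3P[]/eqP->; rewrite ?(e0, e1, e2) ?(e0, e1, e2) ?(e0, e1, e2).
  have TR := rem_tri T vS rot3 S5.
  move: us; rewrite /= !inE !negb_or => /and3P[/andP[n01 n02] n12 _].
  exists x0, x1, x2, [::], (rem_n n v); split=> //.
  - have -> // : new_adj adj v x0 [::] = rem_adj adj v.
    by apply/funext => x; apply/funext => y; rewrite /new_adj !in_nil !andbF !orbF.
  - by split=> //; apply: cons e0.
  - by split=> //; apply: snoc e2.
  - by move=> _; rewrite /rem_n -e0 (tri_rot T h0) eqxx e0.
  - by move=> x y a xv yv nv; rewrite /rem_n (negbTE nv).
have h3 : adj v x3 by rewrite nb !inE eqxx !orbT.
have e3 := cyc 3 isT.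
case: s us ms ds cyc nb d5 e0 e1 e2 e3 => [|x4 s] us ms ds cyc nb d5 e0 e1 e2 e3;
  rewrite /= in e0 e1 e2 e3.
  have main y0 y1 y2 y3 : uniq [:: y0; y1; y2; y3] ->
      (forall y, adj v y = (y \in [:: y0; y1; y2; y3])) ->
      n v y0 = y1 -> n v y1 = y2 -> n v y2 = y3 -> n v y3 = y0 -> ~~ adj y0 y2 ->
      exists w a b zs n', contraction S adj n B v w a b zs n'.
    move=> un N f0 f1 f2 f3 na.
    have [n' [T' m1 m2 m3]] := contract4 T vS S5 un N f0 f1 f2 f3 na.
    have g0 : adj v y0 by rewrite N !inE eqxx.
    have g1 : adj v y1 by rewrite N !inE eqxx orbT.
    have g2 : adj v y2 by rewrite N !inE eqxx !orbT.
    have g3 : adj v y3 by rewrite N !inE eqxx !orbT.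
    move: un; rewrite /= !inE !negb_or andbT => /and3P[/and3P[n01 n02 n03] /andP[n12 n13] n23].
    exists y0, y1, y3, [:: y2], n'; split=> //.
    - by split=> //; apply: cons f0.
    - by split=> //; apply: snoc f3.
    - by move=> z; rewrite inE => /eqP->; rewrite ![y2 == _]eq_sym [y3 == y2]eq_sym.
    - by move=> z; rewrite inE => /eqP->; left.
    - by move=> z1 z2; rewrite !inE => /eqP-> /eqP->.
    - by rewrite -ds.
  have [a02|] := boolP (adj x0 x2); last exact: (main x0 x1 x2 x3).
  have na13 : ~~ adj x1 x3.
    apply/negP => a13; apply: (noncrossing T h0 e0 e1 e2 _ a02 a13).
    by rewrite eq_sym; move: us; rewrite /= !inE !negb_or => /and4P[/and3P[]].
  apply: (main x1 x2 x3 x0) => //.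
    by move: us; rewrite -(rot_uniq 1).
  by move=> y; rewrite nb -(mem_rot 1).
have h4 : adj v x4 by rewrite nb !inE eqxx !orbT.
have e4 := cyc 4 isT.
case: s us ms ds cyc nb d5 e0 e1 e2 e3 e4 => [|x5 s] us ms ds cyc nb d5 e0 e1 e2 e3 e4 //;
  rewrite /= in e0 e1 e2 e3 e4.
have main y0 y1 y2 y3 y4 : uniq [:: y0; y1; y2; y3; y4] ->
    (forall y, adj v y = (y \in [:: y0; y1; y2; y3; y4])) ->
    n v y0 = y1 -> n v y1 = y2 -> n v y2 = y3 -> n v y3 = y4 -> n v y4 = y0 ->
    ~~ adj y0 y2 -> ~~ adj y0 y3 -> ~~ (([set y0; y2] \in B) && ([set y0; y3] \in B)) ->
    exists w a b zs n', contraction S adj n B v w a b zs n'.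
  move=> un N f0 f1 f2 f3 f4 na na' nB.
  have [n' [T' m1 m2 m3]] := contract5 T vS S5 un N f0 f1 f2 f3 f4 na na'.
  have g0 : adj v y0 by rewrite N !inE eqxx.
  have g1 : adj v y1 by rewrite N !inE eqxx orbT.
  have g2 : adj v y2 by rewrite N !inE eqxx !orbT.
  have g3 : adj v y3 by rewrite N !inE eqxx !orbT.
  have g4 : adj v y4 by rewrite N !inE eqxx !orbT.
  move: un; rewrite /= !inE !negb_or andbT.
  case/and4P=> [/and4P[n01 n02 n03 n04] /and3P[n12 n13 n14] /andP[n23 n24] n34].
  exists y0, y1, y4, [:: y2; y3], n'; split=> //.
  - by split=> //; apply: cons f0.
  - by split=> //; apply: snoc f4.
  - move=> z; rewrite !inE => /orP[]/eqP->; split=> //; by rewrite eq_sym.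
  - by move=> z; rewrite !inE => /orP[]/eqP->; [left|right].
  - move=> z1 z2; rewrite !inE => /orP[]/eqP-> /orP[]/eqP-> // b1 b2;
      by rewrite b1 b2 in nB.
  - by rewrite -ds.
pose r k := rot k [:: x0; x1; x2; x3; x4].
have ur k : uniq (r k) by rewrite rot_uniq.
have mr k y : adj v y = (y \in r k) by rewrite mem_rot nb.
have us' := us; move: us'; rewrite /= !inE !negb_or andbT.
case/and4P=> [/and4P[n01 n02 n03 n04] /and3P[n12 n13 n14] /andP[n23 n24] n34].
have sy x y : adj x y = adj y x := tri_sym T x y.
have x01 : ~~ (adj x0 x2 && adj x1 x3).
  by apply/negP => /andP[]; apply: (noncrossing T h0 e0 e1 e2); rewrite eq_sym.
have x12 : ~~ (adj x1 x3 && adj x2 x4).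
  by apply/negP => /andP[]; apply: (noncrossing T h1 e1 e2 e3); rewrite eq_sym.
have x23 : ~~ (adj x2 x4 && adj x3 x0).
  by apply/negP => /andP[]; apply: (noncrossing T h2 e2 e3 e4).
have x34 : ~~ (adj x3 x0 && adj x4 x1).
  by apply/negP => /andP[]; apply: (noncrossing T h3 e3 e4 e0).
have x40 : ~~ (adj x4 x1 && adj x0 x2).
  by apply/negP => /andP[]; apply: (noncrossing T h4 e4 e0 e1).
have sB x y : ([set x; y] \in B) = ([set y; x] \in B) by rewrite setUC.
pose b x y := ([set x; y] \in B : nat).
have cB : b x0 x2 + b x1 x3 + b x2 x4 + b x3 x0 + b x4 x1 <= 2.
  pose L := [:: [set x0; x2]; [set x1; x3]; [set x2; x4]; [set x3; x0]; [set x4; x1]].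
  have uL : uniq L.
    rewrite /= !inE !negb_or andbT.
    pose nn := (negbTE n01, negbTE n02, negbTE n03, negbTE n04, negbTE n12,
      negbTE n13, negbTE n14, negbTE n23, negbTE n24, negbTE n34).
    have cE (x y : V) : x = y -> x == y /\ y == x by move=> ->.
    do ! [apply/andP; split]; apply/eqP => /set2_eq[] [/cE[e1' e2'] /cE[e3' e4']];
      by move: e1' e2' e3' e4'; rewrite ?nn.
  have -> : b x0 x2 + b x1 x3 + b x2 x4 + b x3 x0 + b x4 x1 = count (mem B) L.
    by rewrite /= addn0 !addnA.
  apply: leq_trans B2; rewrite -size_filter -(card_uniqP (filter_uniq _ uL)).
  by apply: subset_leq_card; apply/subsetP => A; rewrite mem_filter => /andP[].
have := main _ _ _ _ _ (ur 0) (mr 0) e0 e1 e2 e3 e4.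
have := main _ _ _ _ _ (ur 1) (mr 1) e1 e2 e3 e4 e0.
have := main _ _ _ _ _ (ur 2) (mr 2) e2 e3 e4 e0 e1.
have := main _ _ _ _ _ (ur 3) (mr 3) e3 e4 e0 e1 e2.
have := main _ _ _ _ _ (ur 4) (mr 4) e4 e0 e1 e2 e3.
move: x01 x12 x23 x34 x40 cB; rewrite /b.
rewrite [adj x4 x2]sy [adj x3 x1]sy [adj x2 x0]sy [adj x1 x4]sy [adj x0 x3]sy.
rewrite [[set x4; x2] \in B]sB [[set x3; x1] \in B]sB [[set x2; x0] \in B]sB
  [[set x1; x4] \in B]sB [[set x0; x3] \in B]sB.
(* What remains is propositional: each of the five diagonals may be an edge and may be a brace. *)
move: (adj x0 x2) (adj x1 x3) (adj x2 x4) (adj x3 x0) (adj x4 x1).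
move: ([set x0; x2] \in B) ([set x1; x3] \in B) ([set x2; x4] \in B)
  ([set x3; x0] \in B) ([set x4; x1] \in B).
clear; set P := (exists w : V, _).
by do 10 case; move=> //= _ _ _ _ _ _ m4 m3 m2 m1 m0;
  solve [exact: m0 | exact: m1 | exact: m2 | exact: m3 | exact: m4].
Qed.

End Contract.

(** * Planar maps *)

(** The union [a] of the classes of [x] and [y] is closed for both relations. Outside it the classes
    agree; inside it [e'] has one class, and [e] has one or two. *)
Lemma n_comp_join (T : finType) (e e' : rel T) x y : connect_sym e -> connect_sym e' ->
  subrel e (connect e') -> connect e' x y ->
  (forall u w, e' u w -> connect e u w \/
     (connect e x u || connect e y u) && (connect e x w || connect e y w)) ->
  n_comp e' predT + ~~ connect e x y = n_comp e predT.
Proof.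
move=> sy sy' sub cxy back.
pose a := [pred u | connect e x u || connect e y u].
have cla : closed e a.
  apply: intro_closed => // u w uw; rewrite !inE.
  by case/orP=> h; rewrite (connect_trans h (connect1 uw)) ?orbT.
have cla' : closed e' a.
  apply: intro_closed => // u w uw; case: (back _ _ uw) => [c|/andP[_ h]] //.
  rewrite !inE; case/orP=> h; rewrite (connect_trans h c) ?orbT //.
have e1 : n_comp e a = (~~ connect e x y).+1.
  rewrite -(n_comp_closure2 sy); apply: eq_n_comp_r => u; rewrite !inE.
  apply/idP/existsP => [/orP[h|h]|[t /andP[/= h]]].
  - by exists x; rewrite !inE eqxx sy h.
  - by exists y; rewrite !inE eqxx orbT sy h.
  - by rewrite !inE => /orP[]/eqP et; have {h}: connect e u t := h; rewrite et sy => ->; rewrite ?orbT.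
have e2 : n_comp e' a = 1.
  rewrite -(n_comp_connect sy' x); apply: eq_n_comp_r => u; rewrite !inE.
  have cs := connect_sub sub.
  apply/idP/idP => [/orP[/cs //|/cs]|h]; first exact: connect_trans.
  by rewrite -[_ || _]/(u \in a) -(closed_connect cla' h) inE connect0.
have e3 : n_comp e' [predC a] = n_comp e [predC a].
  have ceq z : z \in [predC a] -> connect e' z =1 connect e z.
    move=> za w; apply/idP/idP; last exact: connect_sub.
    case/connectP=> p pth ->; elim: p z za pth => //= t p IH z za /andP[zt pth].
    have ta : t \in [predC a] by rewrite -(predC_closed cla' zt).
    apply: connect_trans (IH t ta pth).
    by case: (back _ _ zt) => // /andP[h _]; move: za; rewrite !inE h.
  apply: eq_card => z; rewrite !inE; case za: (~~ _); rewrite ?andbF // !andbT.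
  by rewrite /roots /fingraph.root (eq_pick (ceq z _)) // inE za.
rewrite (n_compC a) [RHS](n_compC a) e1 e2 e3; case: (connect e x y) => /=.
  by rewrite addn0.
by rewrite addn1 -addn1 addnC addnA.
Qed.

(** Points outside the image of [h] are isolated and count once each. This moves counts from the
    subtype of darts to all of [V * V], where graphs with different edges share one type. *)
Lemma n_comp_ext (T T' : finType) (h : T' -> T) (e : rel T) (e' : rel T') :
  connect_sym e -> connect_sym e' -> injective h ->
  (forall x y, e (h x) (h y) = e' x y) -> (forall x y, e x y -> x \notin codom h -> y = x) ->
  (forall x y, e x y -> x \in codom h -> y \in codom h) ->
  n_comp e predT = n_comp e' predT + #|[predC codom h]|.
Proof.
move=> sy sy' injh eh fix1 cl1.
pose a := [pred x | x \in codom h].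
have cla : closed e a by apply: intro_closed.
rewrite (n_compC a); congr (_ + _).
  have adj : rel_adjunction h e e' a.
    by apply: strict_adjunction.
  rewrite (adjunction_n_comp h sy sy' cla adj); apply: eq_n_comp_r => x.
  by rewrite !inE codom_f.
apply: eq_card => x; rewrite !inE; case hx: (x \notin codom h); rewrite ?andbF // andbT.
have : connect e x (fingraph.root e x) := connect_root _ _.
case/connectP=> p pth er; apply/eqP; rewrite er.
elim: p pth {er} => //= y p IH /andP[xy pth].
have ey := fix1 _ _ xy hx; subst y; exact: IH.
Qed.

Lemma porbit_fconnect (T : finType) (s : {perm T}) x y : (y \in porbit s x) = fconnect s x y.
Proof.
apply/porbitP/idP => [[i ->]|]; first by rewrite permX fconnect_iter.
by move/iter_findex => <-; exists (findex s x y); rewrite permX.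
Qed.

Lemma perm_fconnect_sym (T : finType) (s : {perm T}) : connect_sym (frel s).
Proof. exact: fconnect_sym (@perm_inj _ s). Qed.

Lemma card_porbits (T : finType) (s : {perm T}) : #|porbits s| = fcard s predT.
Proof.
have sy := perm_fconnect_sym s.
have -> : porbits s = [set porbit s x | x in [set x | roots (frel s) x]].
  apply/setP => A; apply/imsetP/imsetP => [[x _ ->]|[x _ ->]]; last by exists x.
  exists (fingraph.root (frel s) x); first by rewrite inE roots_root.
  by apply/eqP; rewrite eq_porbit_mem porbit_sym porbit_fconnect connect_root.
rewrite card_in_imset => [|x y].
  by rewrite cardsE; apply: eq_card => x; rewrite !inE andbT.
rewrite !inE => /eqP rx /eqP ry /eqP; rewrite eq_porbit_mem porbit_fconnect => c.
by rewrite -rx -ry; apply/(fingraph.rootP sy); rewrite sy.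
Qed.

Definition joinr (T : finType) (r : rel T) a b := relU r (upair a b).

Lemma joinr_sym (T : finType) (r : rel T) a b : connect_sym r -> connect_sym (joinr r a b).
Proof.
move=> h; apply: relU_sym => //; apply: sym_connect_sym => x y /=.
by rewrite upairC.
Qed.

Lemma n_comp_joinr (T : finType) (e : rel T) x y : connect_sym e ->
  n_comp (joinr e x y) predT + ~~ connect e x y = n_comp e predT.
Proof.
move=> sy; apply: n_comp_join => //; first exact: joinr_sym.
- by move=> u w uw; apply: connect1; rewrite /= uw.
- by apply: connect1; rewrite /= /upair !eqxx orbT.
move=> u w /= /orP[uw|]; first by left; apply: connect1.
by case/orP=> /andP[/eqP-> /eqP->]; right; rewrite !connect0 ?orbT.
Qed.

(** * Inserting a fixed point into a cycle of a permutation *)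

Section FixedPoint.
Variables (T : finType) (s : {perm T}) (e x : T).
Hypothesis se : s e = e.

(** The cycle of [x] absorbs the singleton cycle of [e]. The case [e = x], where nothing happens, is
    that of a dart at a vertex isolated so far. *)
Lemma card_porbits_insert : #|porbits (tperm e x * s)| + (e != x) = #|porbits s|.
Proof.
have [<-|ne] := eqVneq e x; first by rewrite tperm1 mul1g addn0.
have := porbits_mul_tperm s e x; rewrite /= ne.
have -> : e \notin porbit s x.
  rewrite porbit_sym; apply/porbitP => -[i].
  have -> : (s ^+ i)%g e = e by elim: i => [|i IH]; rewrite ?perm1 // expgSr permM IH.
  by move/eqP; rewrite eq_sym (negbTE ne).
by rewrite /= -[1.*2]/(1 + 1) addnA => /addIn.
Qed.

Lemma insertE y : (tperm e x * s)%g y = if y == e then s x else if y == x then e else s y.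
Proof.
rewrite permM; case: tpermP => [->|->|/eqP/negbTE-> /eqP/negbTE-> //]; rewrite ?eqxx //.
by case: eqP => [->|] //; rewrite se.
Qed.

Lemma insert_connect : fconnect (tperm e x * s)%g =2 connect (joinr (frel s) e x).
Proof.
set t := (tperm e x * s)%g.
have sy := perm_fconnect_sym t.
have ex : fconnect t e x.
  have [->|ne] := eqVneq x e; first exact: connect0.
  by rewrite sy; apply: connect1; rewrite /= insertE (negbTE ne) eqxx.
have sj : connect_sym (joinr (frel s) e x) by apply: joinr_sym; apply: perm_fconnect_sym.
have jx : connect (joinr (frel s) e x) e x by apply: connect1; rewrite /= /upair !eqxx orbT.
move=> a b; apply/idP/idP; apply: connect_sub => {a b} a b /=.
  move/eqP <-; rewrite insertE.
  have js c : connect (joinr (frel s) e x) c (s c) by apply: connect1; rewrite /= eqxx.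
  case: eqP => [->|_]; first exact: connect_trans jx (js x).
  by case: eqP => [->|_]; [rewrite sj|].
case/orP=> [/eqP<-|/orP[]/andP[/eqP-> /eqP->]] //; last by rewrite sy.
have [->|ne] := eqVneq a e; first by rewrite se connect0.
have [->|nx] := eqVneq a x.
  rewrite sy; apply: connect_trans ex; rewrite sy.
  by apply: connect1; rewrite /= insertE eqxx.
by apply: connect1; rewrite /= insertE (negbTE ne) (negbTE nx).
Qed.
End FixedPoint.

(** * Rotation systems extended to all pairs of vertices *)

Section PMap.
Variable V : finType.
Implicit Types (E : {set {set V}}) (x y d : V * V).

Definition isd E d := [set d.1; d.2] \in E.

Definition flp_fun E d := if isd E d then (d.2, d.1) else d.

Lemma flp_funK E : involutive (flp_fun E).
Proof.
case=> a b; rewrite /flp_fun; have [h|h] := boolP (isd E (a, b)).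
  by rewrite ifT //= /isd /= setUC.
by rewrite (negbTE h).
Qed.

Definition flp E : {perm V * V} := perm (inv_inj (@flp_funK E)).

Lemma flpE E d : flp E d = if isd E d then (d.2, d.1) else d.
Proof. by rewrite permE. Qed.

Lemma flpK E : involutive (flp E).
Proof. by move=> d; rewrite !permE flp_funK. Qed.

Lemma isd_flp E d : isd E (flp E d) = isd E d.
Proof. by rewrite flpE; case: ifP => h //; rewrite /isd /= setUC. Qed.

Definition lnk E (nd : {perm V * V}) : rel (V * V) := relU (frel nd) (frel (flp E)).

Lemma lnk_sym E nd : connect_sym (lnk E nd).
Proof. by apply: relU_sym; apply: perm_fconnect_sym. Qed.

(* A rotation system on the darts of [E], extended by the identity to all of
   [V * V]: every non-dart then counts once as a vertex, a face and a component. *)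
Record pmap E (nd : {perm V * V}) : Prop := PMap {
  pm_fix : forall d, ~~ isd E d -> nd d = d;
  pm_rot : forall d, isd E d -> porbit nd d = [set d' | isd E d' && (d'.1 == d.1)];
  pm_euler : #|porbits nd| + #|porbits (flp E * nd)%g|
               = #|E| + 2 * n_comp (lnk E nd) predT }.

Lemma codom_val E : codom (fun d : dart E => val d) =i isd E.
Proof.
move=> d; apply/codomP/idP => [[d' ->]|h]; first exact: (valP d').
by exists (exist _ d h).
Qed.

Lemma card_nondart E : #|[predC codom (fun d : dart E => val d)]| = #|[predC isd E]|.
Proof. by apply: eq_card => d; rewrite !inE codom_val. Qed.

Lemma porbits_ext E (s : {perm dart E}) (t : {perm V * V}) :
  (forall d : dart E, t (val d) = val (s d)) -> (forall d, ~~ isd E d -> t d = d) ->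
  #|porbits t| = #|porbits s| + #|[predC isd E]|.
Proof.
move=> ts tf; rewrite !card_porbits -card_nondart.
apply: (n_comp_ext (h := fun d : dart E => val d)); try exact: perm_fconnect_sym.
- exact: val_inj.
- by move=> x y; rewrite /= ts (inj_eq val_inj).
- by move=> x y /eqP <-; rewrite codom_val => h; rewrite tf.
- move=> x y xy; rewrite codom_val => h.
  have [x' ex] : exists x' : dart E, x = val x' by exists (exist _ x h).
  by move: xy; rewrite ex /= ts => /eqP <-; apply: codom_f.
Qed.

Lemma linked_sym E (nd : {perm dart E}) : connect_sym (linked nd).
Proof.
have : connect_sym (relU (frel nd) (frel (flip E))) by apply: relU_sym; apply: perm_fconnect_sym.
by [].
Qed.

Lemma flip_val E (d : dart E) : flp E (val d) = val (flip E d).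
Proof. by rewrite flpE permE ifT //; apply: (valP d). Qed.

Lemma n_comp_lnk E (s : {perm dart E}) (t : {perm V * V}) :
  (forall d : dart E, t (val d) = val (s d)) -> (forall d, ~~ isd E d -> t d = d) ->
  n_comp (lnk E t) predT = n_comp (linked s) predT + #|[predC isd E]|.
Proof.
move=> ts tf; rewrite -card_nondart.
apply: (n_comp_ext (h := fun d : dart E => val d)).
- exact: lnk_sym.
- exact: linked_sym.
- exact: val_inj.
- by move=> x y; rewrite /lnk /= /linked /= ts flip_val !(inj_eq val_inj).
- move=> x y xy; rewrite codom_val => h; have {}h : ~~ isd E x := h.
  by move: xy; rewrite /lnk /= flpE (negbTE h) tf // orbb => /eqP.
- move=> x y xy; rewrite codom_val => h.
  have [x' ex] : exists x' : dart E, x = val x' by exists (exist _ x h).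
  by move: xy; rewrite ex /lnk /= ts flip_val => /orP[]/eqP <-; apply: codom_f.
Qed.

(** Each non-dart adds one cycle to the rotation, one to the face permutation and one component, so
    both sides of Euler's formula grow by twice the number of non-darts. *)
Lemma pmap_of_planar E : planar E -> exists nd, pmap E nd.
Proof.
case=> s [rot g0].
pose f d := if insub d is Some d' then val (s d') else d : V * V.
have fE (d : dart E) : f (val d) = val (s d) by rewrite /f valK.
have fN d : ~~ isd E d -> f d = d by move=> h; rewrite /f insubN.
have finj : injective f.
  have cl d : isd E (f d) = isd E d.
    have [h|h] := boolP (isd E d); last by rewrite fN // (negbTE h).
    by rewrite -[d]/(val (exist _ d h : dart E)) fE; apply: (valP (s _)).
  move=> x y e; have := congr1 (isd E) e; rewrite !cl.
  have [hx|hx] := boolP (isd E x); have [hy|hy] := boolP (isd E y) => // _.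
    move: e; rewrite -[x]/(val (exist _ x hx : dart E)) -[y]/(val (exist _ y hy : dart E)).
    by rewrite !fE => /val_inj/perm_inj ->.
  by rewrite !fN // in e.
pose t := perm finj.
have ts (d : dart E) : t (val d) = val (s d) by rewrite permE.
have tf d : ~~ isd E d -> t d = d by move=> h; rewrite permE fN.
exists t; split=> //.
  move=> d hd; have := rot (exist _ d hd : dart E) => e.
  have it i (d' : dart E) : (t ^+ i)%g (val d') = val ((s ^+ i)%g d').
    by elim: i => [|i IH]; rewrite ?expg0 ?perm1 // !expgSr !permM IH ts.
  apply/setP => d'; rewrite inE; apply/porbitP/andP => [[i ->]|[h' /eqP e']].
    rewrite -[d]/(val (exist _ d hd : dart E)) it; split; first exact: (valP (_ : dart E)).
    have : (s ^+ i)%g (exist _ d hd) \in porbit s (exist _ d hd) by apply: mem_porbit.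
    by rewrite e inE.
  have : exist _ d' h' \in porbit s (exist _ d hd) by rewrite e inE /source /= e'.
  case/porbitP => i ei; exists i.
  by rewrite -[d]/(val (exist _ d hd : dart E)) it -ei.
rewrite (porbits_ext ts tf) (@porbits_ext _ (face s) (flp E * t)%g).
- by rewrite (n_comp_lnk ts tf) mulnDr [RHS]addnA -g0 mul2n -addnn addnACA.
- by move=> d; rewrite permM flip_val ts permM.
- by move=> d h; rewrite permM flpE (negbTE h) tf.
Qed.

Lemma planar_of_pmap E nd : pmap E nd -> planar E.
Proof.
case=> tf rot g0.
have cl d : isd E d -> isd E (nd d).
  move=> h; have : nd d \in porbit nd d by apply: (mem_porbit nd 1).
  by rewrite rot // inE => /andP[].
pose f (d : dart E) : dart E := exist _ (nd (val d)) (cl _ (valP d)).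
have finj : injective f.
  by move=> x y /(congr1 val) /= /perm_inj/val_inj.
pose s := perm finj.
have ts (d : dart E) : nd (val d) = val (s d) by rewrite permE.
have it i (d' : dart E) : (nd ^+ i)%g (val d') = val ((s ^+ i)%g d').
  by elim: i => [|i IH]; rewrite ?expg0 ?perm1 // !expgSr !permM IH ts.
exists s; split.
  move=> d; apply/setP => d'; rewrite inE; have := rot (val d) (valP d) => e.
  apply/porbitP/eqP => [[i ->]|e'].
    have : (nd ^+ i)%g (val d) \in porbit nd (val d) by apply: mem_porbit.
    by rewrite e inE it => /andP[_ /eqP].
  have : val d' \in porbit nd (val d).
    by rewrite e inE; apply/andP; split; [apply: (valP d')|apply/eqP].
  by case/porbitP => i; rewrite it => /val_inj ei; exists i.
move: g0; rewrite (porbits_ext ts tf) (@porbits_ext _ (face s) (flp E * nd)%g).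
- rewrite (n_comp_lnk ts tf) mulnDr [RHS]addnA [in RHS]mul2n -[in RHS]mul2n addnACA addnn -mul2n.
  by move=> /addIn.
- by move=> d; rewrite permM flip_val ts permM.
- by move=> d h; rewrite permM flpE (negbTE h) tf.
Qed.

End PMap.

Lemma connect_relU (T : finType) (r1 r2 r1' r2' : rel T) :
  connect r1 =2 connect r1' -> connect r2 =2 connect r2' ->
  connect (relU r1 r2) =2 connect (relU r1' r2').
Proof.
move=> e1 e2 x y; apply/idP/idP; apply: connect_sub => u w /orP[]/connect1.
- rewrite e1; apply: connect_sub => {u w} u w h; by apply: connect1; rewrite /= h.
- rewrite e2; apply: connect_sub => {u w} u w h; by apply: connect1; rewrite /= h orbT.
- rewrite -e1; apply: connect_sub => {u w} u w h; by apply: connect1; rewrite /= h.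
- rewrite -e2; apply: connect_sub => {u w} u w h; by apply: connect1; rewrite /= h orbT.
Qed.

(** The two products are conjugate by [s]; faces may thus be counted with the factors in either
    order. *)
Lemma porbits_mulC (T : finType) (s t : {perm T}) : #|porbits (s * t)%g| = #|porbits (t * s)%g|.
Proof.
have cod x : x \in codom s by apply/codomP; exists (s^-1%g x); rewrite permKV.
rewrite !card_porbits (@n_comp_ext T T s (frel (t * s)%g) (frel (s * t)%g)).
- by rewrite [X in _ + X]eq_card0 ?addn0 // => x; rewrite !inE cod.
- exact: perm_fconnect_sym.
- exact: perm_fconnect_sym.
- exact: perm_inj.
- by move=> x y; rewrite /= !permM (inj_eq perm_inj).
- by move=> x y _; rewrite cod.
- by [].
Qed.

Lemma connect_isolated (T : finType) (r : rel T) z y :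
  (forall y, r z y -> y = z) -> connect r z y = (z == y).
Proof.
move=> h; apply/idP/eqP => [/connectP[p pth ->]|->//].
by elim: p pth => //= t p IH /andP[/h->].
Qed.

Lemma lnk_isolated (V : finType) (E : {set {set V}}) nd z y : pmap E nd -> ~~ isd E z ->
  connect (lnk E nd) z y = (z == y).
Proof.
move=> pm zN; apply: connect_isolated => {}y.
by rewrite /lnk /= (pm_fix pm zN) flpE (negbTE zN) orbb => /eqP.
Qed.

(** * Adding an edge to a planar map *)

Section AddEdge.
Variables (V : finType) (E : {set {set V}}) (nd : {perm V * V}) (u v : V) (xu xv : V * V).
Hypotheses (pm : pmap E nd) (uv : u != v) (uvE : [set u; v] \notin E).

(* The dart [(w, w')] can be inserted after [x] in the rotation at [w]; if [w] is
   isolated, [x] is that dart itself. *)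
Definition corner w w' (x : V * V) :=
  (isd E x /\ x.1 = w) \/ (x = (w, w') /\ forall d, isd E d -> d.1 != w).

Hypotheses (cu : corner u v xu) (cv : corner v u xv).
Let e := (u, v).
Let e' := (v, u).
(** A conjugate of the face permutation, with the rotation as left factor: inserting a dart after
    [x] in the rotation is then also an insertion after [x] in [phi]. *)
Let phi := (nd * flp E)%g.
Hypothesis H : xu \in porbit phi xv \/ ~~ connect (lnk E nd) xu xv.

Let E' := [set u; v] |: E.
Let nd1 := (tperm e' xv * nd)%g.
Let nd2 := (tperm e xu * nd1)%g.

Let ee' : e != e'. Proof. by rewrite xpair_eqE negb_and uv. Qed.
Let eN : ~~ isd E e. Proof. by []. Qed.
Let e'N : ~~ isd E e'. Proof. by rewrite /isd /= setUC. Qed.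
Let nde : nd e = e. Proof. exact: (pm_fix pm eN). Qed.
Let nde' : nd e' = e'. Proof. exact: (pm_fix pm e'N). Qed.
Let xue' : xu != e'.
Proof.
case: cu => [[h _]|[-> _]] //; by apply: contraTneq h => ->.
Qed.
Let xve : xv != e.
Proof.
case: cv => [[h _]|[-> _]]; last by rewrite eq_sym.
by apply: contraTneq h => ->.
Qed.
Let nd1e : nd1 e = e.
Proof. by rewrite insertE // (negbTE ee') eq_sym (negbTE xve). Qed.
Let flpe : flp E e = e. Proof. by rewrite flpE (negbTE eN). Qed.
Let flpe' : flp E e' = e'. Proof. by rewrite flpE (negbTE e'N). Qed.

Lemma isd_add d : isd E' d = [|| isd E d, d == e | d == e'].
Proof.
case: d => a b; rewrite /isd /E' !inE /= orbC; congr (_ || _).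
apply/eqP/orP => [/set2_eq[] [-> ->]|[]/eqP[-> ->]];
  [by left; exact: eqxx|by right; exact: eqxx|by []|by rewrite setUC].
Qed.

Lemma flp_add : flp E' = (tperm e e' * flp E)%g.
Proof.
apply/permP => d; rewrite insertE // flpe' !flpE isd_add.
have [->|ne] := eqVneq d e; first by rewrite /= orbT.
have [->|ne'] := eqVneq d e'; first by rewrite /= orbT.
by rewrite /= !orbF.
Qed.

(** The darts [e'] and [e] and then the link between them are added one at a time, so that each
    change is one use of [n_comp_joinr]. *)
Let R1 := joinr (lnk E nd) e' xv.
Let R2 := joinr R1 e xu.
Let R3 := joinr R2 e e'.

Let nd2_connect : fconnect nd2 =2 connect (joinr (joinr (frel nd) e' xv) e xu).
Proof.
move=> x y; rewrite insert_connect //; apply: connect_relU => {x y} x y //.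
by rewrite insert_connect.
Qed.

Lemma lnk_add : connect (lnk E' nd2) =2 connect R3.
Proof.
have h1 : fconnect (flp E') =2 connect (joinr (frel (flp E)) e e').
  by move=> x y; rewrite flp_add insert_connect.
move=> x y; rewrite (connect_relU nd2_connect h1); apply: eq_connect => {x y} x y.
rewrite /R3 /R2 /R1 /joinr /lnk /=.
by case: (nd x == y) (flp E x == y) (upair e' xv x y) (upair e xu x y) (upair e e' x y)
  => [] [] [] [] [].
Qed.

Let R1_isol y : connect R1 e y = (e == y).
Proof.
apply: connect_isolated => {y} y; rewrite /R1 /joinr /lnk /= nde flpe orbb /upair.
by rewrite (negbTE ee') eq_sym [e == xv]eq_sym (negbTE xve) orbF => /eqP.
Qed.

Let sy0 := lnk_sym E nd.
Let sy1 : connect_sym R1 := joinr_sym e' xv sy0.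
Let sy2 : connect_sym R2 := joinr_sym e xu sy1.

Let phi1 := (tperm e' xv * phi)%g.
Let phi2 := (tperm e xu * phi1)%g.
Let phie' : phi e' = e'. Proof. by rewrite permM nde' flpe'. Qed.
Let phi1e : phi1 e = e.
Proof. by rewrite insertE // (negbTE ee') eq_sym (negbTE xve) permM nde flpe. Qed.

Let phi2_connect : fconnect phi2 =2 connect (joinr (joinr (frel phi) e' xv) e xu).
Proof.
move=> x y; rewrite insert_connect //; apply: connect_relU => {x y} x y //.
by rewrite insert_connect.
Qed.

(** The only use of [H]. Corners on one face put both darts on that face; corners in different
    components leave [e] and [e'] separated in [R2]. *)
Let split_iff : (e \notin porbit phi2 e') = ~~ connect R2 e e'.
Proof.
congr (~~ _); rewrite porbit_fconnect phi2_connect sy2; apply/idP/idP => [|c].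
  apply: connect_sub => x y /orP[/orP[/eqP <-|h]|h]; try by apply: connect1; rewrite /= h ?orbT.
  rewrite permM; apply: (@connect_trans _ _ (nd x)); apply: connect1;
    by rewrite /R2 /R1 /joinr /lnk /= ?eqxx ?orbT.
case: H => [h|nc].
  apply: (@connect_trans _ _ xv).
    by apply: connect1; rewrite /joinr /= /upair !eqxx orbT.
  apply: (@connect_trans _ _ xu).
    move: h; rewrite porbit_fconnect; apply: connect_sub => x y h.
    by apply: connect1; move: h; rewrite /joinr /= => ->.
  by apply: connect1; rewrite /joinr /= /upair !eqxx !orbT.
pose A := [pred d | connect (lnk E nd) xv d || (d == e')].
have Ae : e \in A = false.
  by rewrite inE sy0 (lnk_isolated _ pm) // eq_sym (negbTE xve) (negbTE ee').
have Axu : xu \in A = false by rewrite inE sy0 (negbTE nc) (negbTE xue').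
have cl : closed R2 A.
  apply: intro_closed => // x y /orP[/orP[h|h]|/orP[]/andP[/eqP-> /eqP->]]; rewrite ?Ae ?Axu //.
    rewrite !inE => /orP[c1|/eqP ex]; first by rewrite (connect_trans c1 (connect1 h)).
    by move: (connect1 h); rewrite ex (lnk_isolated _ pm) // eq_sym => ->; rewrite orbT.
  by case/orP: h => /andP[/eqP-> /eqP->]; rewrite !inE ?eqxx ?connect0 ?orbT.
by have := closed_connect cl c; rewrite inE eqxx orbT Ae.
Qed.

(** Inserting the darts only absorbs fixed points. Exchanging [e] and [e'] then multiplies the face
    permutation by a transposition: it splits a face if both darts lie on it and merges two faces
    otherwise. By [split_iff] a split occurs exactly when the components stay the same, a merge
    exactly when two components become one, so [V + F = E + 2 C] persists in both cases. *)
Lemma add_edge : pmap E' nd2.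
Proof.
split.
- move=> d; rewrite isd_add !negb_or => /and3P[dN de de'].
  have dx w w' x : corner w w' x -> d != (w, w') -> d != x.
    case=> [[h _]|[-> _]] // _; by apply: contraNneq dN => ->.
  rewrite insertE // (negbTE de) (negbTE (dx _ _ _ cu de)) insertE //.
  by rewrite (negbTE de') (negbTE (dx _ _ _ cv de')) (pm_fix pm).
- move=> d hd; apply/setP => d'; rewrite porbit_fconnect nd2_connect inE.
  set R := joinr _ e xu.
  have syR : connect_sym R by do 2 apply: joinr_sym; apply: perm_fconnect_sym.
  have ndR a b : fconnect nd a b -> connect R a b.
    by apply: connect_sub => x y h; apply: connect1; move: h; rewrite /R /joinr /= => ->.
  have cisd w w' x : (w, w') = e \/ (w, w') = e' -> corner w w' x -> isd E' x && (x.1 == w).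
    move=> hw; rewrite isd_add; case=> [[-> ->]|[-> _]]; rewrite ?eqxx //=.
    by case: hw => ->; rewrite eqxx ?orbT.
  apply/idP/idP.
    pose A := [pred d' | isd E' d' && (d'.1 == d.1)].
    have cl : closed R A.
      apply: intro_closed => // x y /orP[/orP[/eqP<-|h]|h]; rewrite !inE.
      + case/andP=> hx /eqP ex; have [xE|xN] := boolP (isd E x); last by rewrite (pm_fix pm) // hx ex /=.
        have : nd x \in porbit nd x by apply: (mem_porbit nd 1).
        by rewrite (pm_rot pm) // inE isd_add => /andP[-> /eqP->]; rewrite ex /=.
      + have /andP[k1 /eqP k2] := cisd v u xv (or_intror erefl) cv.
        have k3 : isd E' e' by rewrite isd_add eqxx !orbT.
        by case/orP: h => /andP[/eqP-> /eqP->] /=; rewrite ?k1 ?k3 ?k2 /=.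
      + have /andP[k1 /eqP k2] := cisd u v xu (or_introl erefl) cu.
        have k3 : isd E' e by rewrite isd_add eqxx !orbT.
        by case/orP: h => /andP[/eqP-> /eqP->] /=; rewrite ?k1 ?k3 ?k2 /=.
    by move=> c; have := closed_connect cl c; rewrite inE hd eqxx inE => <-.
  case/andP=> hd' /eqP ed.
  have rotE a b : isd E a -> isd E b -> b.1 = a.1 -> connect R a b.
    move=> ha hb eab; apply: ndR; rewrite -porbit_fconnect (pm_rot pm) // inE hb eab eqxx.
    by [].
  have tou a : isd E' a -> a.1 = u -> connect R a xu.
    rewrite isd_add => /or3P[ha|/eqP->|/eqP->] ea.
    + case: cu => [[h1 h2]|[_ h2]]; first by apply: rotE; rewrite // h2 ea.
      by have := h2 _ ha; rewrite ea eqxx.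
    + by apply: connect1; rewrite /R /joinr /= /upair !eqxx !orbT.
    + by move: uv; rewrite -ea eqxx.
  have tov a : isd E' a -> a.1 = v -> connect R a xv.
    rewrite isd_add => /or3P[ha|/eqP->|/eqP->] ea.
    + case: cv => [[h1 h2]|[_ h2]]; first by apply: rotE; rewrite // h2 ea.
      by have := h2 _ ha; rewrite ea eqxx.
    + by move: uv; rewrite -ea eqxx.
    + by apply: connect1; rewrite /R /joinr /= /upair !eqxx !orbT.
  have [eu|nu] := eqVneq d.1 u.
    apply: (connect_trans (tou _ hd eu)); rewrite syR; apply: tou => //.
    by rewrite ed.
  have [ev|nv] := eqVneq d.1 v.
    apply: (connect_trans (tov _ hd ev)); rewrite syR; apply: tov => //.
    by rewrite ed.
  apply: rotE => //.
    move: hd; rewrite isd_add => /or3P[//|/eqP ede|/eqP ede].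
      by move: nu; rewrite ede /e /= eqxx.
    by move: nv; rewrite ede /e' /= eqxx.
  move: hd'; rewrite isd_add => /or3P[//|/eqP ede|/eqP ede].
    by move: nu; rewrite -ed ede /e /= eqxx.
  by move: nv; rewrite -ed ede /e' /= eqxx.
- have N1 := card_porbits_insert xv nde'; have N2 := card_porbits_insert xu nd1e.
  have F1 := card_porbits_insert xv phie'; have F2 := card_porbits_insert xu phi1e.
  have F3 := porbits_mul_tperm phi2 e e'.
  have C1 := n_comp_joinr e' xv sy0; have C2 := n_comp_joinr e xu sy1.
  have C3 := n_comp_joinr e e' sy2.
  rewrite (lnk_isolated _ pm) // in C1; rewrite R1_isol in C2; rewrite /= split_iff ee' in F3.
  have F : #|porbits (flp E' * nd2)%g| = #|porbits (tperm e e' * phi2)%g|.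
    rewrite flp_add.
    have -> : (tperm e e' * flp E)%g = (flp E * tperm e e')%g.
      apply/permP => d; rewrite insertE // permM flpe'.
      have [->|de] := eqVneq d e; first by rewrite flpe tpermL.
      have [->|de'] := eqVneq d e'; first by rewrite flpe' tpermR.
      by rewrite tpermD //; [apply: contraNneq de|apply: contraNneq de'] => ed;
        rewrite -[d](flpK E) -ed ?flpe ?flpe'.
    by rewrite -(mulgA (flp E)) (porbits_mulC (flp E)) /phi2 /phi1 /phi /nd2 /nd1 !mulgA.
  have Eu := pm_euler pm; rewrite porbits_mulC -/phi in Eu.
  rewrite F (eq_n_comp lnk_add) cardsU1 uvE.
  move: N1 N2 F1 F2 F3 C1 C2 C3 Eu; rewrite -/nd1 -/nd2 -/phi1 -/phi2 -/R1 -/R2 -/R3.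
  move: (#|porbits nd|) (#|porbits nd1|) (#|porbits nd2|) (#|porbits phi|) (#|porbits phi1|)
    (#|porbits phi2|) (#|porbits (tperm e e' * phi2)%g|) (n_comp (lnk E nd) predT)
    (n_comp R1 predT) (n_comp R2 predT) (n_comp R3 predT) (#|E|).
  move: (e' == xv) (e == xu) (connect R2 e e') => b1 b2 b3.
  by clear; case: b1; case: b2; case: b3 => /=; lia.
Qed.
End AddEdge.

(** * Connectedness and Euler's formula for maximal planar maps *)

Section Maximal.
Variables (V : finType) (E : {set {set V}}) (nd : {perm V * V}).
Hypotheses (simple : simple_graph E) (pm : pmap E nd) (V3 : 3 <= #|V|).
Hypothesis max : forall u v, u != v -> [set u; v] \notin E ->
  forall nd', ~ pmap ([set u; v] |: E) nd'.

Lemma isd_neq d : isd E d -> d.1 != d.2.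
Proof.
move=> /simple; rewrite cards2; by case: eqP.
Qed.

Lemma isd_sym u v : isd E (u, v) = isd E (v, u).
Proof. by rewrite /isd /= setUC. Qed.

(** An isolated vertex could be joined to any other vertex, whether or not that one is isolated
    too. *)
Lemma no_isolated u : exists d, isd E d /\ d.1 = u.
Proof.
have [/existsP[d /andP[h /eqP e]]|/existsPn no] := boolP [exists d, isd E d && (d.1 == u)].
  by exists d.
exfalso; have [v vu] : exists v, v != u.
  have /card_gt0P[v] : 0 < #|predC1 u| by have := cardC1 u; lia.
  by rewrite inE => h; exists v.
have nou d : isd E d -> d.1 != u by move=> h; have := no d; rewrite h.
have uvE : [set u; v] \notin E by apply/negP => h; have := nou (u, v) h; rewrite eqxx.
have uv : u != v by rewrite eq_sym.
have cu : corner E u v (u, v) by right.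
have [xv [cv ne]] : exists xv, corner E v u xv /\ xv != (u, v).
  have [/existsP[d /andP[h /eqP e]]|/existsPn nov] := boolP [exists d, isd E d && (d.1 == v)].
    by exists d; split; [left|apply: contraNneq uvE => ed; move: h; rewrite ed].
  exists (v, u); split; last by rewrite xpair_eqE negb_and vu.
  by right; split=> // d h; have := nov d; rewrite h.
apply: (max uv uvE (add_edge pm uv uvE cu cv _)); right.
by rewrite lnk_isolated // eq_sym.
Qed.

Lemma nd_isd d : isd E d -> isd E (nd d) /\ (nd d).1 = d.1.
Proof.
move=> h; have : nd d \in porbit nd d by apply: (mem_porbit nd 1).
by rewrite (pm_rot pm) // inE => /andP[-> /eqP].
Qed.

Lemma nd_trans d d' : isd E d -> isd E d' -> d.1 = d'.1 -> d' \in porbit nd d.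
Proof. by move=> h h' e; rewrite (pm_rot pm) // inE h' e eqxx. Qed.

(** Otherwise an edge could be drawn between two components; its ends are distinct and not adjacent,
    since the rotation and the flip would connect the darts. *)
Lemma darts_connected d d' : isd E d -> isd E d' -> connect (lnk E nd) d d'.
Proof.
move=> hd hd'; apply: contraT => nc; exfalso.
have ndc a b : b \in porbit nd a -> connect (lnk E nd) a b.
  rewrite porbit_fconnect; apply: connect_sub => x y h; apply: connect1.
  by move: h; rewrite /lnk /= => ->.
have uv : d.1 != d'.1 by apply: contraNneq nc => e; apply/ndc/nd_trans.
have uvE : [set d.1; d'.1] \notin E.
  apply: contraNN nc => h.
  have h' : isd E (d'.1, d.1) by rewrite isd_sym.
  apply: (@connect_trans _ _ (d.1, d'.1)); first exact/ndc/nd_trans.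
  apply: (@connect_trans _ _ (d'.1, d.1)); last exact/ndc/nd_trans.
  by apply: connect1; rewrite /lnk /= flpE ifT //= eqxx orbT.
apply: (max uv uvE (add_edge (xu := d) (xv := d') pm uv uvE _ _ _)); [by left|by left|by right].
Qed.

Let f := (flp E * nd)%g.

Lemma face_isd d : isd E d -> isd E (f d) /\ (f d).1 = d.2.
Proof.
move=> h; rewrite permM; have hf : isd E (flp E d) by rewrite isd_flp.
have [h1 h2] := nd_isd hf; split=> //; by rewrite h2 flpE h.
Qed.

Lemma face_fix d : ~~ isd E d -> f d = d.
Proof. by move=> h; rewrite permM flpE (negbTE h) (pm_fix pm). Qed.

(* Otherwise the edge could be drawn inside the face. *)
Lemma same_face_adj y y' : isd E y -> isd E y' -> y' \in porbit f y -> y.2 != y'.2 ->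
  [set y.2; y'.2] \in E.
Proof.
move=> hy hy' po ne; apply: contraT => nE; exfalso.
(* [flp E] conjugates [f] into [nd * flp E], so a common face becomes a common orbit of the
   latter. *)
have H : flp E y \in porbit (nd * flp E)%g (flp E y').
  move: po; rewrite porbit_sym => /porbitP[i ->]; apply/porbitP; exists i.
  elim: i => [|i IH]; first by rewrite !expg0 !perm1.
  rewrite [in RHS]expgSr [RHS]permM -IH expgSr [in LHS]permM.
  by rewrite /f !permM.
apply: (max ne nE (add_edge (xu := flp E y) (xv := flp E y') pm ne nE _ _ _)).
- by left; rewrite isd_flp flpE hy.
- by left; rewrite isd_flp flpE hy'.
- by left.
Qed.

Definition face_set := [set porbit f d | d in isd E].

Lemma card_porbits_darts (s : {perm V * V}) : (forall d, ~~ isd E d -> s d = d) ->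
  (forall d, isd E d -> isd E (s d)) ->
  #|porbits s| = #|[set porbit s d | d in isd E]| + #|[predC isd E]|.
Proof.
move=> fx cl; have orb1 d : ~~ isd E d -> porbit s d = [set d].
  move=> h; apply/setP => d'; rewrite inE; apply/porbitP/eqP => [[i ->]|->]; last by exists 0; rewrite perm1.
  by elim: i => [|i IH]; rewrite ?perm1 // expgSr permM IH fx.
have -> : porbits s = [set porbit s d | d in isd E] :|: [set [set d] | d in [predC isd E]].
  apply/setP => A; rewrite inE; apply/imsetP/orP => [[d _ ->]|[]/imsetP[d hd ->]].
  - have [h|h] := boolP (isd E d); [left|right]; apply/imsetP; exists d => //; exact: orb1.
  - by exists d.
  - by exists d; rewrite ?orb1.
rewrite cardsU (_ : _ :&: _ = set0) ?cards0 ?subn0.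
  by rewrite [X in _ + X]card_imset //; apply: set1_inj.
apply/setP => A; rewrite !inE; apply/negP => /andP[/imsetP[d hd ->] /imsetP[d' hd' e]].
have : d \in porbit s d by apply: porbit_id.
rewrite e inE => /eqP ed; move: hd'; rewrite !inE -ed.
by move/negP; apply; exact: hd.
Qed.

(** The non-darts cancel from [pm_euler]. Without isolated vertices the rotation cycles of darts
    correspond to the vertices, and connectedness leaves one component. *)
Lemma euler_darts : #|V| + #|face_set| = #|E| + 2.
Proof.
have /card_gt0P[u0 _] : 0 < #|V| by lia.
have [d0 [hd0 _]] := no_isolated u0.
have e1 := card_porbits_darts (pm_fix pm) (fun d h => proj1 (nd_isd h)).
have e2 := card_porbits_darts face_fix (fun d h => proj1 (face_isd h)).
have e3 : #|[set porbit nd d | d in isd E]| = #|V|.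
  have -> : [set porbit nd d | d in isd E] = [set [set d' | isd E d' && (d'.1 == u)] | u in V].
    apply/setP => A; apply/imsetP/imsetP => [[d hd ->]|[u _ ->]].
      by exists d.1 => //; rewrite (pm_rot pm).
    by have [d [hd <-]] := no_isolated u; exists d; rewrite // (pm_rot pm).
  rewrite card_imset // => u w /setP e; have [d [hd ed]] := no_isolated u.
  by have := e d; rewrite !inE hd ed eqxx /= => /esym/eqP.
have e4 : n_comp (lnk E nd) predT = 1 + #|[predC isd E]|.
  rewrite (n_compC (isd E)); congr (_ + _).
    rewrite -(n_comp_connect (lnk_sym E nd) d0); apply: eq_n_comp_r => d.
    have [h|h] := boolP (isd E d); first by rewrite -[RHS]/(connect _ _ _) darts_connected.
    apply: (@etrans _ _ false); first exact: negbTE h.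
    apply/esym; rewrite -[LHS]/(connect _ _ _) lnk_sym lnk_isolated //; apply/negbTE.
    by apply: contraTneq hd0 => <-.
  apply: eq_card => d; rewrite !inE; case h: (~~ (d \in isd E)); rewrite ?andbF // andbT.
  have := connect_root (lnk E nd) d; rewrite (lnk_isolated _ pm h).
  by rewrite /roots eq_sym.
have := pm_euler pm; rewrite e1 e3 -/f e2 -/face_set e4; lia.
Qed.

End Maximal.

(** * Cycles and face boundaries over the field with two elements *)

Section Jordan.
Import GRing.Theory.
Local Open Scope ring_scope.
Variables (V : finType) (E : {set {set V}}) (nd : {perm V * V}).
Hypotheses (simple : simple_graph E) (pm : pmap E nd).
Hypothesis iso : forall u, exists d, isd E d /\ d.1 = u.
Hypothesis conn : forall d d', isd E d -> isd E d' -> connect (lnk E nd) d d'.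
Let f := (flp E * nd)%g.
Let FS := face_set E nd.
Variable u0 : V.
Hypothesis euler : (#|V| + #|FS| = #|E| + 2)%N.

Let k : fieldType := 'F_2.

Lemma F2_add (b b' : bool) : ((b (+) b')%:R : k) = b%:R + b'%:R.
Proof. by case: b; case: b' => //=; rewrite ?add0r ?addr0 //; apply/val_inj. Qed.

Lemma F2_double (x : k) : x + x = 0.
Proof. by rewrite -mulr2n -mulr_natr (_ : 2%:R = 0) ?mulr0 //; apply/val_inj. Qed.

Lemma F2_eq (x y : k) : x + y = 0 -> x = y.
Proof. by move=> h; rewrite -[x]addr0 -(F2_double y) addrA h add0r. Qed.

Lemma F2_bool (x : k) : x = (x == 1)%:R.
Proof. by case: x => [[|[|//]] h]; apply/val_inj. Qed.

Lemma F2_inj (b b' : bool) : (b%:R : k) = b'%:R -> b = b'.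
Proof. by case: b; case: b' => // /eqP; rewrite ?oner_eq0 // eq_sym oner_eq0. Qed.

Definition ends (d : V * V) := [set d.1; d.2].
Let fc (i : 'I_#|FS|) : {set V * V} := enum_val i.
Let eg (j : 'I_#|E|) : {set V} := enum_val j.
Let vx (x : 'I_#|V|) : V := enum_val x.
(** With [edge_vertex], the boundary maps of the cellular chain complex acting on row vectors. The
    sum runs over darts, so an edge that meets the same face from both sides cancels. *)
Let face_edge : 'M[k]_(#|FS|, #|E|) :=
  \matrix_(i, j) \sum_(d in fc i) (ends d == eg j)%:R.
Let edge_vertex : 'M[k]_(#|E|, #|V|) := \matrix_(j, x) (vx x \in eg j)%:R.

Lemma sum_edges (F : {set V} -> k) A : A \in E ->
  \sum_j (A == eg j)%:R * F (eg j) = F A.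
Proof.
move=> h; rewrite -(big_enum_val (fun B => (A == B)%:R * F B)) (bigD1 A) //= eqxx mul1r.
by rewrite big1 ?addr0 // => B /andP[_]; rewrite eq_sym => /negbTE->; rewrite mul0r.
Qed.

Lemma fcP i d : d \in fc i -> isd E d /\ f d \in fc i.
Proof.
have /imsetP[d0 h0 e] := enum_valP i; rewrite /fc e; move/porbitP => [m ->].
split; last by apply/porbitP; exists m.+1; rewrite [in RHS]expgSr [RHS]permM.
elim: m => [|m IH]; first by rewrite perm1; exact: h0.
by rewrite expgSr permM; case: (face_isd pm IH).
Qed.

Lemma fc_closed i d : (f d \in fc i) = (d \in fc i).
Proof.
have /imsetP[d0 h0 e] := enum_valP i; rewrite /fc e.
have pe : porbit f (f d) = porbit f d by have := porbit_perm f 1 d; rewrite expg1.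
have := pe; rewrite /f => pe'.
by rewrite -!eq_porbit_mem [porbit _ (f d)]pe'.
Qed.

(** Along a face the end of each dart is the origin of the next one, so every vertex is counted an
    even number of times. *)
Lemma face_edge_vertex : face_edge *m edge_vertex = 0.
Proof.
apply/matrixP => i x; rewrite !mxE; set v := vx x.
have -> : \sum_j face_edge i j * edge_vertex j x
  = \sum_(d in fc i) \sum_j (ends d == eg j)%:R * (v \in eg j)%:R.
  rewrite exchange_big; apply: eq_bigr => j _; rewrite !mxE mulr_suml.
  by [].
have -> : \sum_(d in fc i) \sum_j (ends d == eg j)%:R * (v \in eg j)%:R
  = \sum_(d in fc i) ((d.1 == v)%:R + (d.2 == v)%:R) :> k.
  apply: eq_bigr => d hd; have [h _] := fcP hd.
  rewrite (sum_edges (fun B => (v \in B)%:R)) // /ends !inE -F2_add ![v == _]eq_sym.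
  have := isd_neq simple h; case: (eqVneq d.1 v) => [->|_] //.
  by case: (eqVneq d.2 v).
rewrite big_split /=.
have -> : \sum_(d in fc i) (d.2 == v)%:R = \sum_(d in fc i) (d.1 == v)%:R :> k.
  rewrite [RHS](reindex_inj (@perm_inj _ f)) /=.
  apply: eq_big => d; first by rewrite fc_closed.
  by move=> hd; have [h _] := fcP hd; have [_ ->] := face_isd pm h.
exact: F2_double.
Qed.

Let colour (c : 'rV[k]_#|FS|) d := \sum_i c 0 i * (d \in fc i)%:R.

Lemma colour_face c d : colour c (f d) = colour c d.
Proof. by apply: eq_bigr => i _; rewrite fc_closed. Qed.

Lemma sum_ends (F : V * V -> k) d : isd E d ->
  \sum_d' (ends d' == ends d)%:R * F d' = F d + F (flp E d).
Proof.
move=> h; rewrite flpE h (bigD1 d) //= eqxx mul1r; congr (_ + _).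
have ne := isd_neq simple h.
rewrite (bigD1 (d.2, d.1)) /=; last first.
  by apply: contraNneq ne => e; have /= -> := congr1 fst e.
rewrite /ends /= setUC eqxx mul1r big1 ?addr0 // => -[a b] /andP[n1 n2].
case: eqP => [/set2_eq[] [/= e1 e2]|_]; last by rewrite mul0r.
  by move: n1; rewrite e1 e2 -surjective_pairing eqxx.
by move: n2; rewrite e1 e2 eqxx.
Qed.

Lemma colour_edge c j d : ends d = eg j -> (c *m face_edge) 0 j = colour c d + colour c (flp E d).
Proof.
move=> ed; have h : isd E d by rewrite /isd -/(ends d) ed enum_valP.
rewrite -(sum_ends _ h) mxE.
rewrite (eq_bigr (fun i => \sum_d' (ends d' == ends d)%:R * (c 0 i * (d' \in fc i)%:R))).
  rewrite exchange_big; apply: eq_bigr => d' _; rewrite /colour mulr_sumr.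
  by [].
move=> i _; rewrite mxE ed big_mkcond mulr_sumr; apply: eq_bigr => d' _.
by case: (d' \in _); rewrite ?mulr1 ?mulr0 // mulrC.
Qed.

Lemma connected_const (F : V * V -> k) : (forall d, isd E d -> F (flp E d) = F d) ->
  (forall d, isd E d -> F (nd d) = F d) -> forall d d', isd E d -> isd E d' -> F d = F d'.
Proof.
move=> h1 h2 d d' hd hd'; have /connectP[p pth ->] := conn hd hd'.
elim: p d hd pth => //= t p IH d hd /andP[dt pth].
have [ht et] : isd E t /\ F t = F d.
  case/orP: dt => /eqP <-; first by split; [case: (nd_isd pm hd)|apply: h2].
  by rewrite isd_flp; split; [|apply: h1].
by rewrite -et; apply: IH.
Qed.

Lemma colour_at c j d : d \in fc j -> colour c d = c 0 j.
Proof.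
have orb i : d \in fc i -> fc i = porbit f d.
  have /imsetP[d1 _ e] := enum_valP i; rewrite /fc e => h.
  by apply/eqP; rewrite eq_sym eq_porbit_mem.
move=> hj; rewrite /colour (bigD1 j) //= hj mulr1 big1 ?addr0 // => i ne.
have [hi|_] := boolP (d \in fc i); last by rewrite mulr0.
have e : fc i = fc j by rewrite (orb _ hi) (orb _ hj).
by move: ne; rewrite (enum_val_inj e) eqxx.
Qed.

Lemma rank_le1 m (A : 'M[k]_m) : (A <= (const_mx 1 : 'rV[k]_m))%MS -> (\rank A <= 1)%N.
Proof. by move/mxrankS => h; apply: leq_trans h (rank_leq_row _). Qed.

(** A kernel vector is a colouring of the faces that does not change across any edge; it is constant
    by connectedness. *)
Lemma rank_face_edge : (#|FS| <= (\rank face_edge).+1)%N.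
Proof.
have ker : (kermx face_edge <= (const_mx 1 : 'rV[k]_#|FS|))%MS.
  apply/row_subP => i; set c := row i _.
  have c0 : c *m face_edge = 0 by apply/sub_kermxP; apply: row_sub.
  have [d0 [hd0 _]] := iso u0.
  have cst d : isd E d -> colour c d = colour c d0.
    move=> hd; have fl d' : isd E d' -> colour c (flp E d') = colour c d'.
      move=> h'; have h2 : ends d' \in E := h'.
      have := colour_edge c (esym (enum_rankK_in h2 h2)).
      by rewrite c0 mxE => /esym/F2_eq.
    apply: (connected_const fl) => // d' h'.
    have := colour_face c (flp E d'); rewrite /f permM flpK => ->; exact: fl.
  suff -> : c = colour c d0 *: const_mx 1 by apply: scalemx_sub.
  apply/rowP => j; rewrite [RHS]mxE [X in _ * X]mxE mulr1.
  have [d hd] : exists d, d \in fc j.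
    by have /imsetP[d _ e] := enum_valP j; exists d; rewrite /fc e porbit_id.
  by rewrite -(colour_at _ hd) cst //; case: (fcP hd).
by have := rank_le1 ker; rewrite mxrank_ker leq_subLR addn1.
Qed.

Lemma edge_vertex_ker (c : 'rV[k]_#|V|) d : isd E d -> c *m edge_vertex^T = 0 ->
  c 0 (enum_rank d.1) + c 0 (enum_rank d.2) = 0.
Proof.
move=> h; have h2 : ends d \in E := h.
move/(congr1 (fun M : 'rV[k]_#|E| => M 0 (enum_rank_in h2 (ends d)))).
rewrite /= [RHS]mxE mxE => <-; have ne := isd_neq simple h.
have ne' : enum_rank d.2 != enum_rank d.1 by rewrite (inj_eq enum_rank_inj) eq_sym.
have ev x : edge_vertex^T x (enum_rank_in h2 (ends d)) = (vx x \in ends d)%:R.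
  by rewrite mxE mxE /eg enum_rankK_in.
rewrite (bigD1 (enum_rank d.1)) //= [X in _ = _ + X](bigD1 (enum_rank d.2)) //=.
rewrite big1 ?addr0 => [|x /andP[n1 n2]].
  by rewrite !ev /vx !enum_rankK set21 set22 !mulr1.
rewrite ev /vx /ends !inE; case: eqP => [e|_]; first by move: n1; rewrite -e enum_valK eqxx.
case: eqP => [e|_]; first by move: n2; rewrite -e enum_valK eqxx.
by rewrite mulr0.
Qed.

(** A kernel vector of the transpose is a function on the vertices with equal values at the ends of
    each edge, hence constant. *)
Lemma rank_edge_vertex : (#|V| <= (\rank edge_vertex).+1)%N.
Proof.
have ker : (kermx edge_vertex^T <= (const_mx 1 : 'rV[k]_#|V|))%MS.
  apply/row_subP => i.
  have : row i (kermx edge_vertex^T) *m edge_vertex^T = 0 by apply/sub_kermxP; apply: row_sub.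
  move: (row i _) => c c0.
  pose F (d : V * V) := c 0 (enum_rank d.1).
  have [d0 [hd0 _]] := iso u0.
  have cst : forall d, isd E d -> F d = F d0.
    move=> d hd; apply: connected_const => // d' h'; last first.
      by rewrite /F; have [_ ->] := nd_isd pm h'.
    by apply: F2_eq; rewrite flpE h' /F /= addrC edge_vertex_ker.
  suff -> : c = F d0 *: const_mx 1 by apply: scalemx_sub.
  apply/rowP => x; rewrite [RHS]mxE [X in _ * X]mxE mulr1.
  have [d [hd ed]] := iso (enum_val x).
  by rewrite -(cst _ hd) /F ed enum_valK.
by have := rank_le1 ker; rewrite mxrank_ker mxrank_tr leq_subLR addn1.
Qed.

Lemma sum_pairs (A : {set V}) v : #|A| = 2 -> \sum_y ([set v; y] == A)%:R = (v \in A)%:R :> k.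
Proof.
move/eqP/cards2P => [a [b [nab ->]]].
have [|h] := boolP (v \in [set a; b]); last first.
  by rewrite big1 // => y _; case: eqP => // e; move: h; rewrite -e set21.
case/set2P=> ->.
  rewrite (bigD1 b) //= eqxx big1 ?addr0 // => y /negbTE ny.
  by case: eqP => // /set2_eq[] [e1 e2]; [move: ny; rewrite e2 eqxx|move: nab; rewrite e1 eqxx].
rewrite (bigD1 a) //= (setUC [set b] [set a]) eqxx big1 ?addr0 // => y /negbTE ny.
case: eqP => // /set2_eq[] [e1 e2]; first by move: nab; rewrite e1 eqxx.
by move: ny; rewrite e2 eqxx.
Qed.

(* The face boundaries span the cycle space over F_2, by counting dimensions. *)
Lemma planar_jordan (Z : V -> V -> bool) : (forall x y, Z x y = Z y x) ->
  (forall x y, Z x y -> isd E (x, y)) -> (forall x, \big[addb/false]_y Z x y = false) ->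
  exists c : V * V -> bool, forall d, isd E d ->
    c (f d) = c d /\ Z d.1 d.2 = c d (+) c (flp E d).
Proof.
move=> Zs Za Ze.
have sub : (face_edge <= kermx edge_vertex)%MS.
  by apply/sub_kermxP; apply: face_edge_vertex.
have sub2 : (kermx edge_vertex <= face_edge)%MS.
  rewrite -(mxrank_leqif_sup sub) mxrank_ker.
  have h1 := mxrankS sub; rewrite mxrank_ker in h1.
  have h2 := rank_face_edge; have h3 := rank_edge_vertex.
  rewrite eqn_leq h1 /=.
  have ar (e v p r1 r2 : nat) : (p <= r1.+1)%N -> (v <= r2.+1)%N -> (v + p = e + 2)%N ->
    (e - r2 <= r1)%N by lia.
  exact: (ar _ _ _ _ _ h2 h3 euler).
pose z : 'rV[k]_#|E| := \row_j [exists d, (ends d == eg j) && Z d.1 d.2]%:R.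
have zE d j : ends d = eg j -> z 0 j = (Z d.1 d.2)%:R.
  move=> ed; rewrite mxE; congr (_%:R); congr nat_of_bool; apply/existsP/idP => [[d' /andP[/eqP e]]|h].
    by move: e; rewrite -ed => /set2_eq[] [-> ->] //; rewrite Zs.
  by exists d; rewrite ed eqxx.
have zker : (z <= kermx edge_vertex)%MS.
  apply/sub_kermxP/rowP => x; rewrite [RHS]mxE mxE; set v := vx x.
  have -> : \sum_j z 0 j * edge_vertex j x = \sum_y (Z v y)%:R :> k.
    have yE y : (Z v y)%:R = \sum_j (ends (v, y) == eg j)%:R * z 0 j :> k.
      rewrite (eq_bigr (fun j => (ends (v, y) == eg j)%:R * (Z v y)%:R)); last first.
        by move=> j _; case: eqP => [/zE ->|_] //; rewrite !mul0r.
      have [h|h] := boolP (isd E (v, y)); first by rewrite (sum_edges (fun=> (Z v y)%:R)).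
      have -> : Z v y = false by apply: contraNF h; apply: Za.
      by rewrite big1 // => j _; rewrite mulr0.
    rewrite (eq_bigr _ (fun y _ => yE y)) exchange_big; apply: eq_bigr => j _.
    rewrite -mulr_suml mulrC; congr (_ * _); rewrite mxE -/v.
    by rewrite -(sum_pairs v (simple (enum_valP j))).
  rewrite -[RHS]/((false%:R : k)) -(Ze v); elim: (index_enum V) => [|y r IH].
    by rewrite !big_nil.
  by rewrite !big_cons F2_add IH.
have /submxP[c ce] := submx_trans zker sub2.
exists (fun d => colour c d == 1) => d hd; split; first by rewrite colour_face.
have h2 : ends d \in E := hd.
have ej : ends d = eg (enum_rank_in h2 (ends d)) by rewrite /eg enum_rankK_in.
have := zE _ _ ej; rewrite ce (colour_edge c ej) => e.
by apply: F2_inj; rewrite -e F2_add -!F2_bool.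
Qed.
End Jordan.

(** * The faces of a maximal planar map are triangles *)

Section Triangulated.
Variables (V : finType) (E : {set {set V}}) (nd : {perm V * V}).
Hypotheses (simple : simple_graph E) (pm : pmap E nd) (V3 : 3 <= #|V|).
Hypothesis max : forall u v, u != v -> [set u; v] \notin E ->
  forall nd', ~ pmap ([set u; v] |: E) nd'.
Let f := (flp E * nd)%g.

Let iso := no_isolated pm V3 max.
Let conn := darts_connected pm max.

Lemma jordan (Z : V -> V -> bool) : (forall x y, Z x y = Z y x) ->
  (forall x y, Z x y -> isd E (x, y)) -> (forall x, \big[addb/false]_y Z x y = false) ->
  exists c : V * V -> bool, forall d, isd E d ->
    c (f d) = c d /\ Z d.1 d.2 = c d (+) c (flp E d).
Proof.
have /card_gt0P[u0 _] : 0 < #|V| by lia.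
exact: (planar_jordan simple pm iso conn u0 (euler_darts pm V3 max)).
Qed.

Lemma triangle_colouring a b d : isd E (a, b) -> isd E (b, d) -> isd E (d, a) ->
  exists c : V * V -> bool, forall e, isd E e ->
    [/\ c (f e) = c e, triangle a b d e.1 e.2 = c e (+) c (flp E e) &
        c (nd e) = c e (+) triangle a b d e.1 e.2].
Proof.
move=> ab bd da.
have sy : symmetric (fun x y => isd E (x, y)) by move=> x y; rewrite isd_sym.
have Za x y : triangle a b d x y -> isd E (x, y) := @triangle_sub _ _ _ _ _ x y sy ab bd da.
have Ze x : \big[addb/false]_y triangle a b d x y = false.
  exact: triangle_sum_addb (isd_neq simple ab) (isd_neq simple bd) (isd_neq simple da).
have [c hc] := jordan (triangleC a b d) Za Ze.
exists c => e he; have h' : isd E (flp E e) by rewrite isd_flp.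
have [e1 _] := hc _ h'; have [e0 e2] := hc _ he; split=> //.
have fe : f (flp E e) = nd e by rewrite /f permM flpK.
by rewrite -fe e1 e2; case: (c e) (c (flp E e)) => [] [].
Qed.

Lemma around (A : pred (V * V)) d : isd E d -> A d ->
  (forall e, isd E e -> e.1 = d.1 -> A e -> A (nd e)) ->
  forall d', isd E d' -> d'.1 = d.1 -> A d'.
Proof.
move=> hd Ad cl d' hd' ed.
have /porbitP[i ->] := nd_trans pm hd hd' (esym ed).
suff [] : [/\ isd E ((nd ^+ i)%g d), ((nd ^+ i)%g d).1 = d.1 & A ((nd ^+ i)%g d)] by [].
elim: i => [|i [h1 h2 h3]]; first by rewrite expg0 perm1.
rewrite expgSr permM; have [k1 k2] := nd_isd pm h1.
by split=> //; [rewrite k2|apply: cl].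
Qed.

(* The triangle [u x y] separates the two corners of the face. *)
Lemma corner_differ u x y : isd E (u, x) -> isd E (u, y) -> isd E (x, y) ->
  (u, y) \notin porbit f (u, x).
Proof.
move=> ux uy xy; have nxy := isd_neq simple xy; rewrite /= in nxy.
have yu : isd E (y, u) by rewrite isd_sym.
have [c hc] := triangle_colouring ux xy yu.
have cn e : isd E e -> c (nd e) = c e (+) triangle u x y e.1 e.2 by case/hc.
apply/negP => po.
have cf e : e \in porbit f (u, x) -> isd E e /\ c e = c (u, x).
  case/porbitP=> i ->; elim: i => [|i [h1 h2]]; first by rewrite expg0 perm1.
  rewrite expgSr permM; have [k1 _] := face_isd pm h1; split=> //.
  by have [-> _ _] := hc _ h1.
have [_ cuy] := cf _ po.
have nux := isd_neq simple ux; have nuy := isd_neq simple uy; rewrite /= in nux nuy.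
have Zx : triangle u x y u x by rewrite /triangle !inE !eqxx ?orbT nux.
(* After [(u, x)] the colour is reversed, and around [u] only [(u, y)] could restore it. But
   [(u, y)] has the colour of [(u, x)], so it is never met with the reversed colour, and the
   rotation would return to [(u, x)] with the wrong one. *)
pose A := [pred e | c e == ~~ c (u, x)].
have Ax : A (nd (u, x)) by rewrite /A /= cn //= Zx addbT.
have [n1 n2] := nd_isd pm ux.
have := @around A (nd (u, x)) n1 Ax _ (u, x) ux (esym n2).
rewrite /A /= => H; suff : c (u, x) == ~~ c (u, x) by case: (c (u, x)).
apply: H => -[u' z] he /= eu /eqP ce; rewrite n2 /= in eu; subst u'.
rewrite cn //= ce; suff -> : triangle u x y u z = false by rewrite addbF.
apply/negP; rewrite /triangle !inE => /and3P[nuz _ /or3P[]/eqP ez].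
- by move: nuz; rewrite ez eqxx.
- by move: ce; rewrite ez; case: (c (u, x)).
- by move: ce; rewrite ez cuy; case: (c (u, x)).
Qed.

(** Two darts of one face with the same origin would have adjacent ends by [same_face_adj], against
    [corner_differ]. *)
Lemma face_simple d d' : isd E d -> isd E d' -> d' \in porbit f d -> d.1 = d'.1 -> d = d'.
Proof.
case: d d' => [u x] [u' y] /= hd hd' po eu; subst u'.
have [->//|nxy] := eqVneq x y.
have xy : isd E (x, y) := same_face_adj pm max hd hd' po nxy.
by have := corner_differ hd hd' xy; rewrite po.
Qed.

Lemma face_orbit2 d : f (f d) \in porbit f d.
Proof. by have := mem_porbit f 2 d; rewrite expgS permM expg1. Qed.

Lemma face_orbit3 d : f (f (f d)) \in porbit f d.
Proof. by have := mem_porbit f 3 d; rewrite !expgS !permM expg0 perm1. Qed.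

Lemma face_pair u v : isd E (u, v) -> exists w, f (u, v) = (v, w) /\ isd E (v, w).
Proof.
move=> h; have [h1 h2] := face_isd pm h; exists (f (u, v)).2.
have e : f (u, v) = (v, (f (u, v)).2) by rewrite [LHS]surjective_pairing h2.
by rewrite -e.
Qed.

Lemma vertex_connected (A : pred V) x : A x -> (forall u v, isd E (u, v) -> A u -> A v) -> forall y, A y.
Proof.
move=> Ax cl y; have [d [hd ed]] := iso x; have [d' [hd' ed']] := iso y.
have /connectP[p pth e] := conn hd hd'; rewrite -ed'.
have : A d.1 by rewrite ed.
elim: p d hd pth e {ed} => [|t p IH] d hd /=; first by move=> _ ->.
case/andP=> dt pth e Ad; apply: (IH t) => //.
- case/orP: dt => /eqP <-; first by case: (nd_isd pm hd).
  by rewrite isd_flp.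
- case/orP: dt => /eqP <-; first by case: (nd_isd pm hd) => _ ->.
  rewrite flpE hd /=; apply: cl Ad; by rewrite -surjective_pairing.
Qed.

Lemma face_step d : isd E d -> (f d).1 = d.2.
Proof. by move=> h; case: (face_isd pm h). Qed.

(** By [face_simple] a face turning back at once consists of a dart and its reverse. Both are then
    fixed by the rotation, so the connected graph is a single edge, which contradicts [V3]. *)
Lemma face_no_return d : isd E d -> (f d).2 != d.1.
Proof.
move=> h; apply/eqP => e.
have [h1 s1] := face_isd pm h; rewrite -/f in h1 s1.
have e1 : f d = (d.2, d.1) by rewrite [LHS]surjective_pairing s1 e.
have [h2 s2] := face_isd pm h1; rewrite -/f in h2 s2.
have e2 : d = f (f d).
  apply: face_simple => //; first exact: face_orbit2.
  by rewrite s2 e1.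
have fl : flp E d = (d.2, d.1) by rewrite flpE h.
have n1 : nd (d.2, d.1) = (d.2, d.1) by rewrite -{1}fl -[RHS]e1 /f permM.
have n2 : nd d = d.
  by rewrite [RHS]e2 /f permM e1 -fl flpK.
have cl u v : isd E (u, v) -> u \in [set d.1; d.2] -> v \in [set d.1; d.2].
  move=> uv /set2P[] eu.
    have /eqP e' : (u, v) == d.
      apply: (@around (pred1 d) d h) => //=.
      by move=> e' _ _ /eqP ->; rewrite n2.
    by rewrite -[v]/(u, v).2 e' set22.
  have h' : isd E (d.2, d.1) by rewrite -fl isd_flp.
  have /eqP e' : (u, v) == (d.2, d.1).
    apply: (@around (pred1 (d.2, d.1)) (d.2, d.1) h') => //=.
    by move=> e' _ _ /eqP ->; rewrite n1.
  by rewrite -[v]/(u, v).2 e' set21.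
have all := vertex_connected (A := fun v => v \in [set d.1; d.2]) (set21 _ _) cl.
have : #|V| <= 2.
  rewrite -cardsT; apply: leq_trans (_ : #|[set d.1; d.2]| <= _); last by rewrite cards2; case: (_ != _).
  by apply: subset_leq_card; apply/subsetP => v _; apply: all.
by rewrite leqNgt V3.
Qed.

(* A longer face would have four distinct consecutive vertices, and its two
   diagonals, drawn outside the face, would cross. *)
Lemma face_triangle d : isd E d -> f (f (f d)) = d.
Proof.
case: d => u0 u1 h0.
have [u2 [e1 h1]] := face_pair h0; have [u3 [e2 h2]] := face_pair h1.
have [u4 [e3 h3]] := face_pair h2.
have n02 := face_no_return h0; rewrite e1 /= in n02.
have n13 := face_no_return h1; rewrite e2 /= in n13.
apply/esym/face_simple => //; [by rewrite e1 e2 e3|exact: face_orbit3|].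
rewrite e1 e2 e3 /=; apply/eqP/negPn/negP => n03.
have o1 : (u1, u2) \in porbit f (u0, u1) by rewrite -e1; apply: (mem_porbit f 1).
have o2 : (u2, u3) \in porbit f (u0, u1) by rewrite -e2 -e1; apply: face_orbit2.
have o3 : (u3, u4) \in porbit f (u0, u1) by rewrite -e3 -e2 -e1; apply: face_orbit3.
have pe d e : e \in porbit f d -> porbit f e = porbit f d.
  by move=> h; apply/eqP; rewrite eq_porbit_mem.
have [u5 e5] : exists u5, (u5, u0) \in porbit f (u0, u1) /\ isd E (u5, u0).
  have : (f^-1)%g (u0, u1) \in porbit f (u0, u1).
    by rewrite porbit_sym -{1}[(u0, u1)](permKV f); apply: (mem_porbit f 1).
  set e := (f^-1)%g _ => oe; have fe : f e = (u0, u1) by rewrite permKV.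
  have he : isd E e.
    apply: contraT => h; have := fe; rewrite /f (face_fix pm h) => ee.
    by move: h; rewrite ee h0.
  have := face_step he; rewrite fe /= => e2'; exists e.1.
  have ee : e = (e.1, u0) by rewrite e2' -surjective_pairing.
  by rewrite -ee.
have a20 : isd E (u2, u0).
  have [o5 h5] := e5.
  have o15 : (u5, u0) \in porbit f (u1, u2) by rewrite (pe _ _ o1).
  exact: (same_face_adj pm max h1 h5 o15 n02).
have a13 : isd E (u1, u3).
  by apply: (same_face_adj pm max h0 h2 o2); rewrite /= eq_sym.
have [c hc] := triangle_colouring h0 h1 a20.
pose Z := triangle u0 u1 u2.
have cn e : isd E e -> c (nd e) = c e (+) Z e.1 e.2 by case/hc.
have n01 := isd_neq simple h0; have n12 := isd_neq simple h1.
have n23 := isd_neq simple h2; rewrite /= in n01 n12 n23.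
have [k c0] : exists k, c (u0, u1) = k by eexists.
have c1 : c (u1, u2) = k by have [e _ _] := hc _ h0; rewrite e1 c0 in e.
have c2 : c (u2, u3) = k by have [e _ _] := hc _ h1; rewrite e2 c1 in e.
have c3 : c (u3, u4) = k by have [e _ _] := hc _ h2; rewrite e3 c2 in e.
have Z01 : Z u0 u1 by rewrite /Z /triangle !inE !eqxx n01 !orbT.
have Z12 : Z u1 u2 by rewrite /Z /triangle !inE !eqxx n12 !orbT.
have h10 : isd E (u1, u0) by rewrite isd_sym.
have c10 : c (u1, u0) = ~~ k.
  have [_ + _] := hc _ h0; rewrite /= -/Z Z01 flpE h0 /= c0.
  by case: (k) (c (u1, u0)) => [] [].
have nd10 : nd (u1, u0) = (u1, u2) by rewrite -e1 /f permM flpE h0.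
(* Between [(u1, u2)] and [(u1, u0)] in the rotation at [u1] all darts lie on the other side of the
   triangle; [(u1, u3)] is one of them. *)
pose A := [pred e | (e == (u1, u2)) || (c e == ~~ k)].
have A12 : A (u1, u2) by rewrite /A /= eqxx.
have HA := @around A (u1, u2) h1 A12 _ (u1, u3) a13 erefl.
have c13 : c (u1, u3) = ~~ k.
  have : A (u1, u3).
    apply: HA => -[u' z] he /= eu; subst u'.
    case/orP=> [/eqP[->]|/eqP ce]; first by rewrite cn //= Z12 c1 addbT eqxx orbT.
    have [ez|nz0] := eqVneq z u0; first by rewrite ez nd10 eqxx.
    have [ez|nz2] := eqVneq z u2; first by move: ce; rewrite ez c1; case: (k).
    rewrite cn //= ce; suff -> : Z u1 z = false by rewrite addbF eqxx orbT.
    rewrite /Z /triangle !inE (negbTE nz0) (negbTE nz2) orbF /=.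
    by rewrite [z == u1]eq_sym; case: (u1 == z); rewrite ?andbF.
  by rewrite /A /= xpair_eqE eqxx /= eq_sym (negbTE n23) => /eqP.
have Z3 y : Z u3 y = false.
  rewrite /Z /triangle !inE eq_sym [u3 == u0]eq_sym [u3 == u1]eq_sym [u3 == u2]eq_sym.
  have -> : u0 == u3 = false by rewrite eq_sym; apply/negbTE; rewrite eq_sym.
  have -> : u1 == u3 = false by rewrite eq_sym; apply/negbTE.
  by rewrite (negbTE n23) /= andbF.
have h31 : isd E (u3, u1) by rewrite isd_sym.
have c31 : c (u3, u1) = ~~ k.
  by have [_ + _] := hc _ h31; rewrite /= -/Z Z3 flpE h31 /= c13; case: (k) (c (u3, u1)) => [] [].
(* [u3] is off the triangle, so all darts leaving it share the colour [k] of the face. *)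
have : c (u3, u1) = k.
  apply/eqP; apply: (@around [pred e | c e == k] (u3, u4) h3 _ _ (u3, u1)) => //=.
    by rewrite c3.
  by move=> -[u' z] he /= eu /eqP ce; subst u'; rewrite cn //= Z3 ce addbF.
by rewrite c31; case: (k).
Qed.

Definition third x y := (f (x, y)).2.

Lemma faceE x y : isd E (x, y) -> f (x, y) = (y, third x y) /\ isd E (y, third x y).
Proof. by move=> h; have [w [e h']] := face_pair h; rewrite /third e. Qed.

Lemma third_rot x y : isd E (x, y) -> third y (third x y) = x.
Proof.
move=> h; have [e1 h1] := faceE h; have [e2 h2] := faceE h1.
by have := face_triangle h; rewrite e1 e2; have [-> _] := faceE h2 => -[].
Qed.

Lemma sum_isd : \sum_x \sum_y (isd E (x, y) : nat) = 2 * #|E|.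
Proof.
rewrite pair_big /=.
have -> : \sum_(d : V * V) (isd E (d.1, d.2) : nat) = \sum_(A in E) \sum_(d : V * V) ([set d.1; d.2] == A : nat).
  rewrite exchange_big; apply: eq_bigr => d _; rewrite /isd /=.
  have [h|h] := boolP ([set d.1; d.2] \in E).
    rewrite (bigD1 [set d.1; d.2]) //= eqxx big1 ?addn0 // => A /andP[_].
    by rewrite eq_sym => /negbTE->.
  by rewrite big1 // => A hA; case: eqP => // e; move: h; rewrite e hA.
rewrite mulnC -sum_nat_const; apply: eq_bigr => A hA.
have /eqP/cards2P[a [b [nab ->]]] := simple hA.
rewrite (bigD1 (a, b)) //= eqxx (bigD1 (b, a)) /=; last by rewrite xpair_eqE negb_and eq_sym nab.
rewrite setUC eqxx big1 // => -[x y] /andP[n1 n2] /=.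
case: eqP => // /set2_eq[] [ex ey]; first by move: n1; rewrite ex ey eqxx.
by move: n2; rewrite ex ey eqxx.
Qed.

Lemma card_faces : 3 * #|face_set E nd| = 2 * #|E|.
Proof.
rewrite -sum_isd pair_big /=.
have part d : isd E d -> #|porbit f d| = 3.
  move=> h; have e3 := face_triangle h.
  have n02 := face_no_return h; have s1 := face_step h.
  have -> : porbit f d = [set d; f d; f (f d)].
    apply/setP => e; rewrite porbit_fconnect !inE; apply/idP/idP.
      case/connectP=> p pth ->.
      have gen q : forall z, z \in [:: d; f d; f (f d)] -> path (frel f) z q ->
          last z q \in [:: d; f d; f (f d)].
        elim: q => //= t q IH z hz /andP[/eqP <-]; apply: IH.
        by move: hz; rewrite !inE => /or3P[]/eqP->; rewrite ?e3 ?eqxx ?orbT.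
      by have := gen p d (mem_head _ _) pth; rewrite !inE orbA.
    rewrite -!porbit_fconnect; case/orP=> [/orP[]|] /eqP->.
    - exact: porbit_id.
    - exact: (mem_porbit f 1).
    - exact: face_orbit2.
  rewrite -setUA cardsU1 cards2 !inE negb_or.
  have d1 : d != f d by apply: contraTneq (isd_neq simple h) => e; rewrite negbK -s1 -e.
  have d2 : d != f (f d).
    have [h1 _] := face_isd pm h; have := face_step h1; rewrite -/f => s2.
    by apply: contraNneq n02 => e; rewrite -s2 -e.
  have d12 : f d != f (f d) by rewrite (inj_eq perm_inj).
  by rewrite d1 d2 d12.
have pt : partition (face_set E nd) [set d | isd E d].
  apply/and3P; split.
  - rewrite /cover; apply/eqP/setP => d; rewrite inE; apply/bigcupP/idP.
      case=> A /imsetP[d0 h0 ->] /porbitP[i ->].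
      elim: i => [|i IH]; first by rewrite expg0 perm1; exact: h0.
      by rewrite expgSr permM; case: (face_isd pm IH).
    by move=> h; exists (porbit f d); [apply: imset_f|apply: porbit_id].
  - apply/trivIsetP => A B /imsetP[d0 h0 ->] /imsetP[d1 h1 ->] ne.
    rewrite -setI_eq0; apply/set0Pn => -[e]; rewrite inE -!eq_porbit_mem => /andP[/eqP e0 /eqP e1].
    by move: ne; rewrite -e0 -e1 eqxx.
  - by apply/imsetP => -[d _ e]; have := porbit_id f d; rewrite -e inE.
have -> : \sum_(p : V * V) (isd E (p.1, p.2) : nat) = #|[set d | isd E d]|.
  rewrite -sum1_card [RHS]big_mkcond; apply: eq_bigr => d _.
  by rewrite inE -surjective_pairing; case: (isd E d).
rewrite (@card_uniform_partition _ 3 _ _ _ pt) => [|A /imsetP[d h ->]]; last exact: part.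
exact: mulnC.
Qed.

Lemma card_edges : #|E| + 6 = 3 * #|V|.
Proof. by have := euler_darts pm V3 max; have := card_faces; rewrite -/(face_set E nd); lia. Qed.

(** Four vertices are needed for [tri_two]: if both faces at an edge had the same apex, their three
    vertices would have no other neighbours. *)
Lemma triangulation_tri : 4 <= #|V| -> tri [set: V] (fun x y => isd E (x, y)) third.
Proof.
move=> V4.
have irr x : isd E (x, x) = false by apply/negP => /(isd_neq simple); rewrite eqxx.
have rotl x y : isd E (x, y) -> third (third x y) x = y.
  by move=> h; have [_ h1] := faceE h; have := third_rot h1; rewrite (third_rot h).
have nd_third x y : isd E (x, y) -> nd (x, third x y) = (x, y).
  move=> h; have [_ h1] := faceE h; have [_ h2] := faceE h1; rewrite third_rot // in h2.
  have h3 : isd E (x, third x y) by rewrite isd_sym.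
  have [e _] := faceE h2; rewrite rotl // in e.
  by rewrite -e /f permM flpE h2.
split.
- by move=> x y; rewrite isd_sym.
- exact: irr.
- move=> x; rewrite inE; apply/esym/existsP.
  by have [[a b] [h /= ex]] := iso x; exists b; rewrite -ex.
- by move=> x y h; case: (faceE h).
- exact: third_rot.
- have nbr2 x y : isd E (x, y) -> third x y = third y x ->
      forall w, isd E (x, w) -> w \in [set y; third x y].
    move=> h e w hw; have h' : isd E (y, x) by rewrite isd_sym.
    have h1 : isd E (x, third x y).
      by rewrite isd_sym; have [_ a] := faceE h; have [_] := faceE a; rewrite third_rot.
    have n1 := nd_third _ _ h.
    have n2 : nd (x, y) = (x, third x y).
      by rewrite -[y in nd (x, y)](third_rot h') -e (nd_third _ _ h1).
    have := @around [pred d | d.2 \in [set y; third x y]] (x, y) h (set21 _ _) _ (x, w) hw erefl.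
    by apply=> -[a b] /= hab ea /set2P[] eb; subst a; rewrite eb ?n1 ?n2 ?set21 ?set22.
  move=> x y h; apply/eqP => e; have h' : isd E (y, x) by rewrite isd_sym.
  have [_ yz] := faceE h; have [_ zx] := faceE yz; rewrite third_rot // in zx.
  set z := third x y in e yz zx.
  have tzy : third y z = x := third_rot h.
  have ez1 : third z x = y by have := third_rot yz; rewrite tzy.
  have ez2 : third x z = y by rewrite e; exact: third_rot h'.
  have Nx := nbr2 _ _ h e; have Ny := nbr2 _ _ h' (esym e).
  have Nz := nbr2 _ _ zx (etrans ez1 (esym ez2)); rewrite -/z -e ez1 in Nx Ny Nz.
  have all := vertex_connected (A := fun v => v \in [set x; y; z]).
  have : #|V| <= 3.
    rewrite -cardsT; apply: (@leq_trans #|[set x; y; z]|); last first.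
      by rewrite -setUA cardsU1 cards2; case: (_ \notin _); case: (_ != _).
    apply: subset_leq_card; apply/subsetP => v _.
    apply: (all x); first by rewrite !inE eqxx.
    move=> u w uw; rewrite !inE => /orP[/orP[]|] /eqP eu; subst u.
    + by have := Nx _ uw; rewrite !inE => /orP[]->; rewrite ?orbT.
    + by have := Ny _ uw; rewrite !inE => /orP[]->; rewrite ?orbT.
    + by have := Nz _ uw; rewrite !inE => /orP[]->; rewrite ?orbT.
  by rewrite leqNgt V4.
- move=> A x y h Ay cl z hz.
  (* [third x] runs through the neighbours of [x] against the rotation [nd]. *)
  have : (x, z) \in porbit nd^-1 (x, y) by rewrite porbitV; apply: (nd_trans pm h hz).
  case/porbitP => i; suff : exists u, [/\ (nd^-1 ^+ i)%g (x, y) = (x, u), isd E (x, u) & A u].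
    by case=> u [-> _ Au] [->].
  elim: i => [|i [u [eu hu Au]]]; first by exists y; rewrite expg0 perm1.
  exists (third x u); rewrite expgSr permM eu; split; last exact: cl.
    by apply: (@perm_inj _ nd); rewrite permKV nd_third.
  by rewrite isd_sym; have [_ a] := faceE hu; have [_] := faceE a; rewrite third_rot.
- by move=> A x _ Ax cl y _; apply: (vertex_connected (A := A) Ax).
- move=> Z Zs Za Ze; have [c hc] := jordan Zs Za Ze.
  exists (fun x y => c (x, y)) => x y h; have [e1 e2] := hc _ h.
  have [fe _] := faceE h; rewrite fe in e1; rewrite flpE h in e2.
  by split.
- by rewrite sum_isd cardsT; have := card_edges; lia.
Qed.
End Triangulated.

(** * Generic placements *)

Section Polyfun.
Import GRing.Theory Num.Theory.
Local Open Scope ring_scope.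
Variable R : realType.

Definition polyfun (f : R -> R) := exists p : {poly R}, forall s, f s = p.[s].
Definition polyvec (u : R -> 'cV[R]_4) := forall i, polyfun (fun s => u s i 0).

Lemma pf_const a : polyfun (fun=> a).
Proof. by exists a%:P => s; rewrite hornerC. Qed.
Lemma pf_id : polyfun (fun s => s).
Proof. by exists 'X => s; rewrite hornerX. Qed.
Lemma pf_add f g : polyfun f -> polyfun g -> polyfun (fun s => f s + g s).
Proof. by move=> [p hp] [r hr]; exists (p + r) => s; rewrite hornerD hp hr. Qed.
Lemma pf_mul f g : polyfun f -> polyfun g -> polyfun (fun s => f s * g s).
Proof. by move=> [p hp] [r hr]; exists (p * r) => s; rewrite hornerM hp hr. Qed.
Lemma pf_opp f : polyfun f -> polyfun (fun s => - f s).
Proof. by move=> [p hp]; exists (- p) => s; rewrite hornerN hp. Qed.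
Lemma pf_sum (I : finType) (f : I -> R -> R) :
  (forall i, polyfun (f i)) -> polyfun (fun s => \sum_i f i s).
Proof.
move=> h; elim: (index_enum I) => [|i r [p hp]].
  by exists 0 => s; rewrite big_nil horner0.
by have [p' hp'] := h i; exists (p' + p) => s; rewrite big_cons hornerD hp hp'.
Qed.
Lemma pf_ext f g : f =1 g -> polyfun f -> polyfun g.
Proof. by move=> e [p hp]; exists p => s; rewrite -e. Qed.

Lemma pv_const u : polyvec (fun=> u).
Proof. by move=> i; apply: pf_const. Qed.
Lemma pv_add u w : polyvec u -> polyvec w -> polyvec (fun s => u s + w s).
Proof.
move=> hu hw i; apply: pf_ext (pf_add (hu i) (hw i)) => s; by rewrite mxE.
Qed.
Lemma pv_opp u : polyvec u -> polyvec (fun s => - u s).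
Proof. move=> hu i; apply: pf_ext (pf_opp (hu i)) => s; by rewrite mxE. Qed.
Lemma pv_scale f u : polyfun f -> polyvec u -> polyvec (fun s => f s *: u s).
Proof. move=> hf hu i; apply: pf_ext (pf_mul hf (hu i)) => s; by rewrite mxE. Qed.
Lemma pf_dot u w : polyvec u -> polyvec w -> polyfun (fun s => dot (u s) (w s)).
Proof. by move=> hu hw; rewrite /dot; apply: pf_sum => i; apply: pf_mul. Qed.

Lemma poly_nonroot (p : {poly R}) : p != 0 -> exists s, p.[s] != 0.
Proof.
move=> p0; pose rs := [seq (i%:R : R) | i <- iota 0 (size p)].
have [/allP h|/allPn[s _ hs]] := boolP (all (root p) rs); last by exists s.
have u : uniq rs.
  by rewrite map_inj_uniq ?iota_uniq // => i j /eqP; rewrite eqr_nat => /eqP.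
have := max_poly_roots p0 (introT allP h) u.
by rewrite size_map size_iota ltnn.
Qed.

(* A left inverse of the system at [s0] turns full rank into the nonvanishing
   of a determinant, which is polynomial in [s]. *)
Lemma injective_generic (W : vectType R) (I : finType) (L : I -> R -> W -> R) s0 :
  (forall i s a x y, L i s (a *: x + y) = a * L i s x + L i s y) ->
  (forall i x, polyfun (fun s => L i s x)) ->
  (forall x, (forall i, L i s0 x = 0) -> x = 0) ->
  exists f : {poly R}, f.[s0] != 0 /\
    forall s, f.[s] != 0 -> forall x, (forall i, L i s x = 0) -> x = 0.
Proof.
move=> lin pol inj.
pose N := \dim (fullv : {vspace W}); pose e := vbasis (fullv : {vspace W}).
have L0 i s : L i s 0 = 0.
  by have := lin i s (-1) 0 0; rewrite scaler0 addr0 mulN1r addNr.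
have Ls i s (J : finType) (c : J -> R) (x : J -> W) :
    L i s (\sum_j c j *: x j) = \sum_j c j * L i s (x j).
  elim: (index_enum J) => [|j r IH]; first by rewrite !big_nil L0.
  by rewrite !big_cons lin IH.
pose M s := \matrix_(j < N, i < #|I|) L (enum_val i) s e`_j.
have decomp (x : W) : x = \sum_j coord e j x *: e`_j.
  by apply: coord_vbasis; rewrite memvf.
have ker s (r : 'rV_N) : r *m M s = 0 -> forall i, L i s (\sum_j r 0 j *: e`_j) = 0.
  move=> h i; rewrite Ls; apply: (@etrans _ _ ((r *m M s) 0 (enum_rank i))); last by rewrite h mxE.
  by rewrite mxE; apply: eq_bigr => j _; rewrite mxE enum_rankK.
have fr : row_free (M s0).
  apply: inj_row_free => r h; have z := inj _ (ker _ _ h).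
  apply/rowP => j; rewrite mxE.
  by have := coord_sum_free (r 0) j (basis_free (vbasisP fullv)); rewrite -/e z linear0.
have /row_freeP[B hB] := fr.
have [P hP] : exists P : 'M[{poly R}]_(N, #|I|), forall s j i, M s j i = (P j i).[s].
  have ex (ji : 'I_N * 'I_#|I|) : exists p : {poly R}, forall s, M s ji.1 ji.2 = p.[s].
    by have [p hp] := pol (enum_val ji.2) e`_ji.1; exists p => s; rewrite mxE.
  have [F hF] := choice ex.
  by exists (\matrix_(j, i) F (j, i)) => s j i; rewrite mxE -hF.
pose f := \det (P *m map_mx polyC B).
have fE s : f.[s] = \det (M s *m B).
  rewrite /f -[LHS]/(horner_eval s (\det _)) -det_map_mx map_mxM; congr (\det (_ *m _)).
    by apply/matrixP => j i; rewrite [LHS]mxE hP.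
  by apply/matrixP => j i; rewrite 2!mxE; exact: hornerC.
exists f; split=> [|s fs x hx]; first by rewrite fE hB det1 oner_eq0.
have Mz : (\row_j coord e j x) *m M s = 0.
  apply/matrixP => z i; rewrite [RHS]mxE -[RHS](hx (enum_val i)) [in RHS](decomp x) Ls.
  by rewrite mxE; apply: eq_bigr => j _; rewrite !mxE.
have Bu : M s *m B \in unitmx by rewrite unitmxE unitfE -fE.
have : \row_j coord e j x = 0.
  by rewrite -[LHS](mulmxK Bu) mulmxA Mz !mul0mx.
move/rowP => z; rewrite (decomp x) big1 // => j _.
by have := z j; rewrite !mxE => ->; rewrite scale0r.
Qed.
End Polyfun.

Ltac pf := repeat first
  [ assumption | apply: pf_const | apply: pf_id | apply: pv_const
  | apply: pf_dot | apply: pv_add | apply: pv_opp | apply: pv_scale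
  | apply: pf_add | apply: pf_opp | apply: pf_mul ].

(** * Horizontal part and height of a vector *)

Section Vec.
Import GRing.Theory Num.Theory.
Local Open Scope ring_scope.
Variable R : realType.
Implicit Types x y z : 'cV[R]_4.

Lemma dotC n (x y : 'cV[R]_n) : dot x y = dot y x.
Proof. by apply: eq_bigr => i _; rewrite mulrC. Qed.
Lemma dotDl n (x y z : 'cV[R]_n) : dot (x + y) z = dot x z + dot y z.
Proof. by rewrite -big_split; apply: eq_bigr => i _; rewrite mxE mulrDl. Qed.
Lemma dotZl n a (x y : 'cV[R]_n) : dot (a *: x) y = a * dot x y.
Proof. by rewrite /dot mulr_sumr; apply: eq_bigr => i _; rewrite mxE mulrA. Qed.
Lemma dotNl n (x y : 'cV[R]_n) : dot (- x) y = - dot x y.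
Proof. by rewrite -scaleN1r dotZl mulN1r. Qed.
Lemma dotDr n (x y z : 'cV[R]_n) : dot x (y + z) = dot x y + dot x z.
Proof. by rewrite !(dotC x) dotDl. Qed.
Lemma dotZr n a (x y : 'cV[R]_n) : dot x (a *: y) = a * dot x y.
Proof. by rewrite !(dotC x) dotZl. Qed.
Lemma dotNr n (x y : 'cV[R]_n) : dot x (- y) = - dot x y.
Proof. by rewrite !(dotC x) dotNl. Qed.
Lemma dot0l n (x : 'cV[R]_n) : dot 0 x = 0.
Proof. by rewrite -(scale0r x) dotZl mul0r. Qed.
Lemma dot0r n (x : 'cV[R]_n) : dot x 0 = 0.
Proof. by rewrite dotC dot0l. Qed.
Lemma dot_eq0 n (x : 'cV[R]_n) : dot x x = 0 -> x = 0.
Proof.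
move=> /eqP; rewrite psumr_eq0 => [/allP h|i _]; last by rewrite -expr2 sqr_ge0.
apply/colP => i; rewrite mxE; have := h i; rewrite mem_index_enum => /(_ isT).
by rewrite /= mulf_eq0 orbb => /eqP.
Qed.

Definition dotE := (dotDl, dotDr, dotNl, dotNr, dotZl, dotZr, dot0l, dot0r).

(** The role of [proj], but kept in dimension 4: it is a self-adjoint projection, so it can be moved
    across [dot]. *)
Definition hat x : 'cV[R]_4 := \col_i (if i == ord_max then 0 else x i 0).
Definition axis : 'cV[R]_4 := \col_i (i == ord_max)%:R.
Definition height x := x ord_max 0.

Lemma hatD x y : hat (x + y) = hat x + hat y.
Proof. by apply/colP => i; rewrite !mxE; case: eqP; rewrite ?addr0. Qed.
Lemma hatZ a x : hat (a *: x) = a *: hat x.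
Proof. by apply/colP => i; rewrite !mxE; case: eqP; rewrite ?mulr0. Qed.
Lemma hatN x : hat (- x) = - hat x.
Proof. by rewrite -scaleN1r hatZ scaleN1r. Qed.
Lemma hatK x : hat (hat x) = hat x.
Proof. by apply/colP => i; rewrite !mxE; case: eqP. Qed.
Lemma hat_axis : hat axis = 0.
Proof. by apply/colP => i; rewrite !mxE; case: eqP. Qed.
Lemma hatE x : x = hat x + height x *: axis.
Proof.
apply/colP => i; rewrite !mxE; case: eqP => [->|_].
  by rewrite add0r mulr1.
by rewrite mulr0 addr0.
Qed.
Lemma dot_delta n i (x : 'cV[R]_n) : dot (delta_mx i 0) x = x i 0.
Proof.
rewrite /dot (bigD1 i) //= mxE !eqxx mul1r big1 ?addr0 // => j /negbTE h.
by rewrite mxE h mul0r.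
Qed.

Lemma hat_delta i : i != ord_max -> hat (delta_mx i 0) = delta_mx i 0.
Proof.
move=> h; apply/colP => j; rewrite !mxE; case: eqP => // ->.
by rewrite eq_sym (negbTE h).
Qed.

Lemma pv_hat (u : R -> 'cV[R]_4) : polyvec u -> polyvec (fun s => hat (u s)).
Proof.
move=> hu j; have [->|jm] := eqVneq j ord_max.
  by apply: (@pf_ext _ (fun=> 0)) => [s|]; [rewrite !mxE eqxx|apply: pf_const].
by apply: pf_ext (hu j) => s; rewrite [RHS]mxE (negbTE jm).
Qed.
Definition hatl := (hatD, hatZ, hatN, hatK, hat_axis).

Lemma dot_axis x : dot axis x = height x.
Proof.
rewrite /dot (bigD1 ord_max) //= mxE eqxx mul1r big1 ?addr0 // => i /negbTE h.
by rewrite mxE h mul0r.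
Qed.
Lemma dot_axisr x : dot x axis = height x.
Proof. by rewrite dotC dot_axis. Qed.
Lemma height_hat x : height (hat x) = 0.
Proof. by rewrite /height mxE eqxx. Qed.
Lemma dot_hat x y : dot (hat x) (hat y) = dot (hat x) y.
Proof. by rewrite [in RHS](hatE y) dotDr dotZr dot_axisr height_hat mulr0 addr0. Qed.
Lemma dot_hatC x y : dot (hat x) y = dot x (hat y).
Proof. by rewrite -dot_hat dotC dot_hat dotC. Qed.
Lemma dot_split x y : dot x y = dot (hat x) y + height x * height y.
Proof. by rewrite {1}(hatE x) dotDl dotZl dot_axis. Qed.
Lemma dot_proj x y : dot (proj x) (proj y) = dot (hat x) y.
Proof.
rewrite /dot [RHS](@big_split_ord R _ _ 3 1) /= [X in _ + X]big1 ?addr0.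
  apply: eq_bigr => i _; rewrite !mxE ifF //.
  by apply/negbTE/eqP => /(congr1 val) /= e; have := ltn_ord i; rewrite e.
move=> i _; rewrite mxE ifT ?mul0r //.
by apply/eqP/val_inj; rewrite /= (ord1 i).
Qed.
Lemma heightD x y : height (x + y) = height x + height y.
Proof. by rewrite /height mxE. Qed.
Lemma heightZ a x : height (a *: x) = a * height x.
Proof. by rewrite /height mxE. Qed.
Lemma heightN x : height (- x) = - height x.
Proof. by rewrite /height mxE. Qed.
Lemma height_axis : height axis = 1.
Proof. by rewrite /height mxE eqxx. Qed.
End Vec.

(** * Generic properties along rational curves of placements *)

Section Generic.
Import GRing.Theory Num.Theory.
Local Open Scope ring_scope.
Variables (R : realType) (V : finType).
Implicit Types (q m : V -> 'cV[R]_4) (g : rel V) (T : {set V}).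

Lemma placementE q : placement q <-> forall v, dot (hat (q v)) (q v) = 1.
Proof. by rewrite /placement /hypercylinder; split=> h v; have := h v; rewrite dot_proj. Qed.

Record ratcurve (c : R -> V -> 'cV[R]_4) : Prop := RatCurve {
  rc_placement : forall s, placement (c s);
  rc_den : exists mu : V -> R -> R, [/\ forall v, polyfun (mu v),
     forall v s, mu v s != 0 & forall v, polyvec (fun s => mu v s *: c s v)] }.

(* Any two placements are joined by such a curve, which makes openness along these
   curves a substitute for Zariski openness in an irreducible variety. *)
Definition zopen (P : (V -> 'cV[R]_4) -> Prop) := forall c, ratcurve c ->
  forall s0, P (c s0) -> exists f : {poly R}, f.[s0] != 0 /\ forall s, f.[s] != 0 -> P (c s).

Definition generic P := zopen P /\ exists q, placement q /\ P q.

(** Reflecting [p0] in the hyperplane orthogonal to [n s] stays on the sphere and is rational in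
    [s]. At 0 the normal is orthogonal to [p0], which stays fixed; for distinct points the normal at
    1 is [p0 - p1], whose reflection exchanges them. *)
Lemma sphere_join (p0 p1 : 'cV[R]_4) : height p0 = 0 -> height p1 = 0 ->
  dot p0 p0 = 1 -> dot p1 p1 = 1 -> exists n : R -> 'cV[R]_4,
  [/\ polyvec n, (forall s, height (n s) = 0), (forall s, dot (n s) (n s) != 0),
      dot (n 0) p0 = 0 & p0 - (2 * dot (n 1) p0 / dot (n 1) (n 1)) *: n 1 = p1].
Proof.
move=> h0 h1 u0 u1.
have [n0 [hn0 zn0 nn0]] : exists n0 : 'cV[R]_4, [/\ height n0 = 0, dot n0 p0 = 0 & n0 != 0].
  pose i0 : 'I_4 := ord0; pose i1 : 'I_4 := Ordinal (isT : (1 < 4)%N).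
  have i01 : i1 == i0 = false by [].
  have dotd i (x : 'cV[R]_4) : dot (delta_mx i 0) x = x i 0.
    rewrite /dot (bigD1 i) //= mxE !eqxx mul1r big1 ?addr0 // => j /negbTE h.
    by rewrite mxE h mul0r.
  have hd (i : 'I_4) : i != ord_max -> height (delta_mx i 0 : 'cV[R]_4) = 0.
    by move=> h; rewrite /height mxE eq_sym (negbTE h).
  have [e|ne] := eqVneq (p0 i0 0) 0.
    exists (delta_mx i0 0); rewrite dotd; split=> //; first exact: hd.
    by apply/eqP => /colP/(_ i0); rewrite !mxE !eqxx => /eqP; rewrite oner_eq0.
  exists (p0 i1 0 *: delta_mx i0 0 - p0 i0 0 *: delta_mx i1 0); split.
  - by rewrite heightD heightN !heightZ !hd // !mulr0 subr0.
  - by rewrite !dotE !dotd mulrC subrr.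
  - apply/eqP => /colP/(_ i1); rewrite !mxE eqxx /= mulr0 mulr1 add0r => /eqP.
    by rewrite oppr_eq0 (negbTE ne).
have [e|ne] := eqVneq p0 p1.
  exists (fun=> n0); split=> //.
  - by move=> i; apply: pf_const.
  - by move=> _; apply: contraNneq nn0 => /dot_eq0 ->.
  - by rewrite zn0 mulr0 mul0r scale0r subr0.
have [n1 n1E] : exists n1, n1 = p0 - p1 by eexists.
have n11 : dot n1 n1 = 2 - 2 * dot p0 p1.
  by rewrite n1E !dotE u0 u1 [dot p1 p0]dotC; ring.
have n1p : dot n1 p0 = 1 - dot p0 p1.
  by rewrite n1E !dotE u0 [dot p1 p0]dotC.
have n1z : dot n1 n1 != 0.
  by apply: contraNneq ne => /dot_eq0 /eqP; rewrite n1E subr_eq0.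
exists (fun s => (1 - s) *: n0 + s *: n1); split.
- by pf.
- by move=> s; rewrite !(heightD, heightZ, heightN) n1E !(heightD, heightN) hn0 h0 h1; ring.
(* Pairing with [p0] leaves [s * (1 - dot p0 p1)], so the normal could vanish only at [s = 0], where
   it is [n0]. *)
- move=> s; apply/eqP => /dot_eq0 e.
  have := congr1 (fun x => dot x p0) e; rewrite /= !dotE zn0 n1p mulr0 add0r => /eqP.
  rewrite mulf_eq0 => /orP[/eqP s0|/eqP z].
    by move/eqP: e; rewrite s0 subr0 scale1r scale0r addr0 (negbTE nn0).
  by move/eqP: n1z; apply; rewrite n11; lra.
- by rewrite subr0 scale1r scale0r addr0.
- rewrite subrr scale0r add0r scale1r n1p.
  have -> : 2 * (1 - dot p0 p1) / dot n1 n1 = 1.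
    by rewrite (_ : 2 * _ = dot n1 n1) ?divff // n11; ring.
  by rewrite scale1r n1E opprB addrC subrK.
Qed.

Lemma ratcurve_join q0 q1 : placement q0 -> placement q1 ->
  exists c, [/\ ratcurve c, c 0 = q0 & c 1 = q1].
Proof.
move=> /placementE P0 /placementE P1.
have ex v : exists n : R -> 'cV[R]_4,
  [/\ polyvec n, (forall s, height (n s) = 0), (forall s, dot (n s) (n s) != 0),
      dot (n 0) (hat (q0 v)) = 0 &
      hat (q0 v) - (2 * dot (n 1) (hat (q0 v)) / dot (n 1) (n 1)) *: n 1 = hat (q1 v)].
  by apply: sphere_join; rewrite ?height_hat ?dot_hat.
have [n hn] := choice ex.
pose N v s := dot (n v s) (n v s).
pose c s v : 'cV[R]_4 := hat (q0 v) - (2 * dot (n v s) (hat (q0 v)) / N v s) *: n v s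
   + ((1 - s) * height (q0 v) + s * height (q1 v)) *: axis R.
have nz v s : N v s != 0 by case: (hn v) => _ _ h _ _; apply: h.
exists c; split.
- split.
    move=> s; apply/placementE => v; have [_ hh _ _ _] := hn v.
    have nh : hat (n v s) = n v s by rewrite [RHS]hatE hh scale0r addr0.
    rewrite -dot_hat /c !hatl nh scaler0 addr0 !dotE [dot (n v s) (hat _)]dotC.
    rewrite dot_hat P0 -/(N v s); set t := dot _ _; move: (nz v s).
    by set M := N v s => Mz; field.
  exists N; split=> // v; first by have [h _ _ _ _] := hn v; rewrite /N; pf.
  have [h _ _ _ _] := hn v.
  have e s : N v s *: c s v = N v s *: hat (q0 v) - (2 * dot (n v s) (hat (q0 v))) *: n v s
     + (N v s * ((1 - s) * height (q0 v) + s * height (q1 v))) *: axis R.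
    rewrite /c !scalerDr scalerN !scalerA; congr (_ - _ *: _ + _).
    by rewrite mulrCA divff ?mulr1.
  move=> i; apply: (@pf_ext _ (fun s => (N v s *: hat (q0 v) - (2 * dot (n v s) (hat (q0 v))) *: n v s
     + (N v s * ((1 - s) * height (q0 v) + s * height (q1 v))) *: axis R) i 0)).
    by move=> s; rewrite e.
  by move: i; rewrite /N; pf.
- apply/funext => v; have [_ _ _ z _] := hn v; rewrite /c z.
  by rewrite mulr0 mul0r scale0r !subr0 mul1r mul0r addr0 -hatE.
- apply/funext => v; have [_ _ _ _ z] := hn v; rewrite /c z.
  by rewrite subrr mul0r mul1r add0r -hatE.
Qed.

(** On a curve from a witness of [P] to a witness of [Q] both exceptional polynomials are nonzero,
    hence so is their product, and a point off its roots satisfies both. *)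
Lemma generic_and P Q : generic P -> generic Q -> generic (fun q => P q /\ Q q).
Proof.
move=> [oP [q0 [p0 P0]]] [oQ [q1 [p1 Q1]]]; split.
  move=> c rc s0 [hP hQ].
  have [f [f0 hf]] := oP c rc s0 hP; have [h [h0 hh]] := oQ c rc s0 hQ.
  exists (f * h); rewrite hornerM mulf_neq0 //; split=> // s.
  by rewrite hornerM mulf_eq0 negb_or => /andP[a b]; split; [apply: hf|apply: hh].
have [c [rc e0 e1]] := ratcurve_join p0 p1.
have [f [f0 hf]] : exists f : {poly R}, f.[0] != 0 /\ forall s, f.[s] != 0 -> P (c s).
  by apply: oP => //; rewrite e0.
have [h [h0 hh]] : exists f : {poly R}, f.[1] != 0 /\ forall s, f.[s] != 0 -> Q (c s).
  by apply: oQ => //; rewrite e1.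
have : f * h != 0.
  rewrite mulf_neq0 //; first by apply: contraNneq f0 => ->; rewrite horner0.
  by apply: contraNneq h0 => ->; rewrite horner0.
case/poly_nonroot => s; rewrite hornerM mulf_eq0 negb_or => /andP[a b].
by exists (c s); split; [apply: rc_placement rc s|split; [apply: hf|apply: hh]].
Qed.

Lemma generic_true q : placement q -> generic (fun=> True).
Proof.
move=> h; split; last by exists q.
by move=> c _ s0 _; exists 1; rewrite hornerC oner_eq0.
Qed.

Lemma generic_forall (I : finType) (P : I -> (V -> 'cV[R]_4) -> Prop) q : placement q ->
  (forall i, generic (P i)) -> generic (fun q => forall i, P i q).
Proof.
move=> hq h.
have : generic (fun q => forall i, i \in enum I -> P i q).
  elim: (enum I) => [|i r IH].
    by have [a [q' [b _]]] := generic_true hq; split=> [c _ s0 _|]; [exists 1; rewrite hornerC oner_eq0|exists q'].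
  have [oz [q' [a [b c]]]] := generic_and (h i) IH.
  split; last first.
    by exists q'; split=> // j; rewrite inE => /orP[/eqP->|] //; apply: c.
  move=> cc rc s0 hs; have [|f [f0 hf]] := oz cc rc s0.
    by split=> [|j jr]; apply: hs; rewrite inE ?eqxx ?jr ?orbT.
  exists f; split=> // s /hf [x1 x2] j; rewrite inE => /orP[/eqP->|] //; exact: x2.
case=> o [q' [a b]]; split.
  move=> c rc s0 hs; have [|f [f0 hf]] := o c rc s0; first by move=> j _; apply: hs.
  by exists f; split=> // s /hf h' j; apply: h'; rewrite mem_enum.
by exists q'; split=> // i; apply: b; rewrite mem_enum.
Qed.

Lemma generic_imp (b : bool) P q : placement q ->
  (b -> generic P) -> generic (fun q => b -> P q).
Proof.
move=> hq h; case: b h => h.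
  have [o [q' [a c]]] := h isT; split; last by exists q'.
  by move=> cc rc s0 hs; have [f [f0 hf]] := o cc rc s0 (hs isT); exists f; split=> // s /hf.
split; last by exists q.
by move=> c _ s0 _; exists 1; rewrite hornerC oner_eq0.
Qed.

(** The factor [d] clears the denominators of the curve; as it never vanishes, the solutions are the
    same. *)
Lemma zopen_injective (W : vectType R) (I : finType) (L : (V -> 'cV[R]_4) -> I -> W -> R) :
  (forall q i a x y, L q i (a *: x + y) = a * L q i x + L q i y) ->
  (forall c, ratcurve c -> forall i, exists d : R -> R, (forall s, d s != 0) /\
     forall x, polyfun (fun s => d s * L (c s) i x)) ->
  zopen (fun q => forall x, (forall i, L q i x = 0) -> x = 0).
Proof.
move=> lin pol c rc s0 inj.
have [d hd] := choice (pol c rc).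
have [|||f [f0 hf]] := @injective_generic R W I (fun i s x => d i s * L (c s) i x) s0.
- by move=> i s a x y; rewrite lin; ring.
- by move=> i x; case: (hd i) => _; apply.
- move=> x hx; apply: inj => i; apply/eqP.
  by have /eqP := hx i; rewrite mulf_eq0; case: (hd i) => /(_ s0)/negbTE-> _.
exists f; split=> // s fs x hx; apply: (hf s fs) => i; by rewrite hx mulr0.
Qed.

Definition flexS g T q m :=
  [/\ forall x y, g x y -> dot (m x - m y) (q x - q y) = 0,
      forall x, dot (hat (q x)) (m x) = 0 &
      forall x, x \in T -> m x = 0].

(* The space of flexes of [(g, q)] vanishing on [T] has dimension at most [k]. *)
Definition flexdim_le g T k q := exists a : 'I_k -> V -> 'cV[R]_4,
  forall m, flexS g T q m -> (forall i, \sum_x dot (a i x) (m x) = 0) -> forall x, m x = 0.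

Lemma flexS_sub g g' T T' q m : (forall x y, g' x y -> g x y \/ g y x) ->
  T' \subset T -> flexS g T q m -> flexS g' T' q m.
Proof.
move=> h /subsetP s [h1 h2 h3]; split=> // [x y /h [/h1 //|/h1 e]|x /s /h3 //].
by rewrite -(opprB (m y)) -(opprB (q y)) dotNl dotNr opprK.
Qed.

Lemma flexdim_sub g g' T T' k q : (forall x y, g' x y -> g x y \/ g y x) ->
  T' \subset T -> flexdim_le g' T' k q -> flexdim_le g T k q.
Proof. by move=> h s [a ha]; exists a => m /(flexS_sub h s) hm; apply: ha. Qed.

(** The forms [a] found at [s0] are kept along the curve: together with the flex equations they make
    up a linear system whose injectivity is open. *)
Lemma flexdim_le_zopen g T k : zopen (flexdim_le g T k).
Proof.
move=> c rc s0 [a ha].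
pose I := ((V * V) + (V + (V * 'I_4 + 'I_k)))%type.
pose L q (i : I) (m : {ffun V -> 'cV[R]_4}) : R := match i with
  | inl xy => (g xy.1 xy.2)%:R * dot (m xy.1 - m xy.2) (q xy.1 - q xy.2)
  | inr (inl x) => dot (hat (q x)) (m x)
  | inr (inr (inl xi)) => (xi.1 \in T)%:R * m xi.1 xi.2 0
  | inr (inr (inr i)) => \sum_x dot (a i x) (m x)
  end.
have L0 q (m : {ffun V -> 'cV[R]_4}) : (forall i, L q i m = 0) -> flexS g T q m /\ forall i, \sum_x dot (a i x) (m x) = 0.
  move=> h; split; last by move=> i; have := h (inr (inr (inr i))).
  split=> [x y gxy|x|x xT].
  - by have := h (inl (x, y)); rewrite /= gxy mul1r.
  - by have := h (inr (inl x)).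
  - by apply/colP => i; rewrite mxE; have := h (inr (inr (inl (x, i)))); rewrite /= xT mul1r.
have z : zopen (fun q => forall x, (forall i, L q i x = 0) -> x = 0).
  apply: zopen_injective => [q [[x y]|[x|[[x j]|i]]] b u w|c' [_ [mu [m1 m2 m3]]] [[x y]|[x|[[x j]|i]]]].
  - by rewrite /= !ffunE !dotE; ring.
  - by rewrite /= !ffunE !dotE.
  - by rewrite /= !ffunE !mxE; ring.
  - rewrite /= mulr_sumr -big_split; apply: eq_bigr => x _.
    by rewrite !ffunE !dotE.
  - exists (fun s => mu x s * mu y s); split=> [s|m]; first by rewrite mulf_neq0.
    apply: (@pf_ext _ (fun s => (g x y)%:R * dot (m x - m y)
       (mu y s *: (mu x s *: c' s x) - mu x s *: (mu y s *: c' s y)))).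
      by move=> s; rewrite /= !dotE; ring.
    by have := m3 x; have := m3 y; have := m1 x; have := m1 y => ? ? ? ?; pf.
  - exists (mu x); split=> // m.
    apply: (@pf_ext _ (fun s => dot (mu x s *: c' s x) (hat (m x)))).
      by move=> s; rewrite /= !dotE dot_hatC.
    by have ? := m3 x; pf.
  - by exists (fun=> 1); split=> [s|m]; [rewrite oner_eq0|pf].
  - by exists (fun=> 1); split=> [s|m]; [rewrite oner_eq0|pf].
have inj0 (x : {ffun V -> 'cV[R]_4}) : (forall i, L (c s0) i x = 0) -> x = 0.
  move=> /L0 [h1 h2]; apply/ffunP => v; rewrite [RHS]ffunE; exact: ha h1 h2 v.
have [f [f0 hf]] := z c rc s0 inj0.
exists f; split=> // s fs; exists a => m [h1 h2 h3] h4 v.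
have : [ffun v => m v] = 0 :> {ffun V -> 'cV[R]_4}.
  apply: (hf s fs) => [[[x y]|[x|[[x j]|i]]]] /=; rewrite ?ffunE.
  - by have [/h1 ->|] := boolP (g x y); rewrite ?mulr0 ?mul0r.
  - exact: h2.
  - by have [/h3 ->|] := boolP (x \in T); rewrite ?mxE ?mulr0 ?mul0r.
  - by rewrite -[RHS](h4 i); apply: eq_bigr => x _; rewrite ffunE.
by move/ffunP/(_ v); rewrite !ffunE.
Qed.
End Generic.

(** * Vertex splitting *)

Section Split.
Import Order.TTheory GRing.Theory Num.Theory.
Local Open Scope ring_scope.
Variables (R : realType) (V : finType).
Implicit Types (q m : V -> 'cV[R]_4) (g : rel V) (T : {set V}).

(** The edges inherited from [v] are listed only in the direction leaving [w]; [flexS_sub] accepts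
    either direction. *)
Definition contract g v w : rel V := fun x y =>
  [&& x != v, y != v & g x y] || [&& x == w, y != v, y != w & g v y].

(* [v] leaves [w] with velocity [2 d], and a flex of the split framework at time
   [s] is written with [m v = m w + s *: e]; the hypothesis is the system satisfied
   by [m] and [e] at [s = 0]. *)
Lemma limit_flex g T q v w (d : 'cV[R]_4) k (a : 'I_k -> V -> 'cV[R]_4) :
  placement q -> v != w -> v \notin T -> (forall x, g x x = false) ->
  dot (hat (q w)) d = 0 ->
  (forall m (e : 'cV[R]_4), flexS (contract g v w) (v |: T) q m ->
     (forall y, g v y -> g w y -> 2 * dot d (m w - m y) + dot (q w - q y) e = 0) ->
     (g v w -> dot d e = 0) ->
     2 * dot (hat d) (m w) + dot (hat (q w)) e = 0 ->
     (forall i, \sum_x dot (a i x) (m x) = 0) -> (forall x, m x = 0) /\ e = 0) ->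
  exists q', placement q' /\ flexdim_le g T k q'.
Proof.
move=> /placementE pq vw vT girr dw inj.
(* [Q s] below follows the rational parametrization, with denominator [nu s], of the circle through
   [hat (q w)] in the direction [hat d], while its height moves linearly; [de s] is the difference
   quotient multiplied by [nu s]. *)
pose ka := dot (hat d) (hat d).
have ka0 : 0 <= ka by rewrite /ka /dot sumr_ge0 // => i _; rewrite -expr2 sqr_ge0.
pose nu s := 1 + s * s * ka.
have nu0 s : nu s != 0.
  rewrite gt_eqF // /nu ltr_pwDl // mulr_ge0 // -expr2 sqr_ge0 //.
pose de s : 'cV[R]_4 := 2 *: (hat d - (s * ka) *: hat (q w)) + (2 * nu s * height d) *: axis R.
pose U y s : 'cV[R]_4 := nu s *: (q w - q y) + s *: de s.
pose Q s : 'cV[R]_4 := q w + (s / nu s) *: de s.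
have QU y s : nu s *: (Q s - q y) = U y s.
  rewrite /Q /U addrAC scalerDr scalerA; congr (_ + _ *: _).
  by rewrite mulrCA divff ?mulr1.
pose N s : 'cV[R]_4 := nu s *: hat (q w) + s *: hat (de s).
have QN s : nu s *: hat (Q s) = N s.
  rewrite /Q /N !hatl scalerDr scalerA; congr (_ + _ *: _).
  by rewrite mulrCA divff ?mulr1.
pose c s x := if x == v then Q s else q x.
have cv s : c s v = Q s by rewrite /c eqxx.
have cx s x : x != v -> c s x = q x by rewrite /c => /negbTE->.
have pc s : placement (c s).
  apply/placementE => x; have [->|xv] := eqVneq x v; last by rewrite cx.
  rewrite cv -dot_hat.
  have -> : hat (Q s) = hat (q w) + (2 * s / nu s) *: (hat d - (s * ka) *: hat (q w)).
    rewrite /Q /de !hatl scaler0 addr0 scalerA; congr (_ + _ *: _).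
    by rewrite mulrC mulrA.
  have wd : dot (hat d) (hat (q w)) = 0 by rewrite dotC dot_hat.
  rewrite !dotE dot_hat pq wd dotC wd -/ka.
  by have := nu0 s; rewrite /nu => z; field.
have de_poly : polyvec de by rewrite /de /nu; pf.
pose W := {ffun V -> 'cV[R]_4}.
pose I := ((V * V) + (V + (V + (unit + (V + (unit + (V * 'I_4 + 'I_k)))))))%type.
(* The flex equations written so that they make sense at [s = 0]; the value of [M] at [v] is the
   unknown [e]. For a common neighbour the equation at [w] is subtracted from the one at [v] and the
   result divided by [s]; the same is done for tangency, and the edge [v w] is divided by [s]
   twice. *)
pose L (i : I) (s : R) (M : W) : R := match i with
  | inl xy => [&& xy.1 != v, xy.2 != v & g xy.1 xy.2]%:R
                * dot (M xy.1 - M xy.2) (q xy.1 - q xy.2)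
  | inr (inl y) => [&& y != v, y != w & g v y]%:R * dot (M w + s *: M v - M y) (U y s)
  | inr (inr (inl y)) => (g v y && g w y)%:R * (dot (de s) (M w - M y) + dot (U y s) (M v))
  | inr (inr (inr (inl _))) => (g v w)%:R * dot (de s) (M v)
  | inr (inr (inr (inr (inl x)))) => (x != v)%:R * dot (hat (q x)) (M x)
  | inr (inr (inr (inr (inr (inl _))))) => dot (hat (de s)) (M w) + dot (N s) (M v)
  | inr (inr (inr (inr (inr (inr (inl xi)))))) => (xi.1 \in T)%:R * M xi.1 xi.2 0
  | inr (inr (inr (inr (inr (inr (inr i)))))) => \sum_x (x != v)%:R * dot (a i x) (M x)
  end.
have wv : w == v = false by rewrite eq_sym (negbTE vw).
have [|||f [f0 hf]] := @injective_generic R W I L 0.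
- move=> [[x y]|[y|[y|[[]|[x|[[]|[[x j]|i]]]]]]] s b X Y; rewrite /L /=;
    try rewrite !ffunE; try move: (U y s) => u; try move: (N s) => nn; try move: (de s) => e'.
  + by rewrite !dotE; ring.
  + by rewrite !dotE; ring.
  + by rewrite !dotE; ring.
  + by rewrite !dotE; ring.
  + by rewrite !dotE; ring.
  + by rewrite !dotE; ring.
  + by rewrite !mxE; ring.
  + rewrite mulr_sumr -big_split /=; apply: eq_bigr => x _.
    by rewrite !ffunE !dotE; ring.
- have hde : polyvec (fun s => hat (de s)) by apply: pv_hat.
  have hU y : polyvec (U y) by rewrite /U /nu; pf.
  have hN : polyvec N by rewrite /N /nu; pf.
  move=> [[x y]|[y|[y|[[]|[x|[[]|[[x j]|i]]]]]]] X; rewrite /L /=; pf.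
- move=> M hM.
  pose m x := if x == v then 0 else M x.
  have mv : m v = 0 by rewrite /m eqxx.
  have mx x : x != v -> m x = M x by rewrite /m => /negbTE->.
  have mw : m w = M w by rewrite mx // wv.
  have de0 : de 0 = 2 *: d.
    rewrite /de /nu !mul0r scale0r subr0 addr0 mulr1 [in RHS](hatE d) scalerDr scalerA.
    by [].
  have U0 y : U y 0 = q w - q y by rewrite /U /nu !mul0r scale0r !addr0 scale1r.
  have N0 : N 0 = hat (q w) by rewrite /N /nu !mul0r scale0r !addr0 scale1r.
  have [|||||mz ez] := inj m (M v).
  + split=> [x y|x|x].
    * case/orP=> [/and3P[xv yv gxy]|/and4P[/eqP-> yv yw gvy]].
        by have := hM (inl (x, y)); rewrite /L /= xv yv gxy mul1r !mx.
      have := hM (inr (inl y)); rewrite /L /= yv yw gvy mul1r U0 scale0r addr0.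
      by rewrite mw mx.
    * have [->|xv] := eqVneq x v; first by rewrite mv dot0r.
      by have := hM (inr (inr (inr (inr (inl x))))); rewrite /L /= xv mul1r mx.
    * rewrite !inE => /orP[/eqP->//|xT].
      have xv : x != v by apply: contraTneq xT => ->.
      apply/colP => j; rewrite mxE mx //.
      by have := hM (inr (inr (inr (inr (inr (inr (inl (x, j)))))))); rewrite /L /= xT mul1r.
  + move=> y gvy gwy; have yv : y != v by apply: contraTneq gvy => ->; rewrite girr.
    have := hM (inr (inr (inl y))); rewrite /L /= gvy gwy mul1r U0 de0 dotZl.
    by rewrite mw mx.
  + move=> gvw; have := hM (inr (inr (inr (inl tt)))); rewrite /L /= gvw mul1r de0 dotZl.
    by move=> /eqP; rewrite mulf_eq0 pnatr_eq0 /= => /eqP.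
  + have := hM (inr (inr (inr (inr (inr (inl tt)))))); rewrite /L /= de0 N0 hatZ dotZl.
    by rewrite mw.
  + move=> i; have := hM (inr (inr (inr (inr (inr (inr (inr i))))))); rewrite /L /= => e0; rewrite -[RHS]e0.
    apply: eq_bigr => x _; rewrite /m; case: eqP => _; last by rewrite mul1r.
    by rewrite mul0r dot0r.
  + apply/ffunP => x; rewrite [RHS]ffunE; have [->//|xv] := eqVneq x v.
    by rewrite -mx.
have f0' : f != 0 by apply: contraNneq f0 => ->; rewrite horner0.
(* The factor ['X] excludes [s = 0]: the unknown [e] is recovered from a flex as
   [(m v - m w) / s]. *)
have : f * 'X != 0 by rewrite mulf_neq0 // polyX_eq0.
case/poly_nonroot => s; rewrite hornerM hornerX mulf_eq0 negb_or => /andP[fs s0].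
exists (c s); split=> //.
exists (fun i x => if x == v then 0 else a i x) => m [h1 h2 h3] h4.
pose M : W := [ffun x => if x == v then s^-1 *: (m v - m w) else m x].
have Mv : M v = s^-1 *: (m v - m w) by rewrite ffunE eqxx.
have Mx x : x != v -> M x = m x by move=> /negbTE h; rewrite ffunE h.
have Mw : M w = m w by rewrite Mx // wv.
have sMv : s *: M v = m v - m w by rewrite Mv scalerA divff // scale1r.
have mvE : m v = m w + s *: M v by rewrite sMv addrC subrK.
have gy y : g v y -> dot (m v - m y) (U y s) = 0.
  move=> gvy; have yv : y != v by apply: contraTneq gvy => ->; rewrite girr.
  by have := h1 v y gvy; rewrite cv cx // -QU dotZr => ->; rewrite mulr0.
have Nv : dot (N s) (m v) = 0 by have := h2 v; rewrite cv -QN dotZl => ->; rewrite mulr0.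
have M0 : M = 0.
  apply: (hf s fs) => [[[x y]|[y|[y|[[]|[x|[[]|[[x j]|i]]]]]]]]; rewrite /L /=.
  - have [/and3P[xv yv gxy]|] := boolP [&& _, _ & _]; rewrite ?mul0r // mul1r !Mx //.
    by have := h1 x y gxy; rewrite !cx.
  - have [/and3P[yv yw gvy]|] := boolP [&& _, _ & _]; rewrite ?mul0r // mul1r.
    by rewrite Mw -mvE Mx // gy.
  - have [/andP[gvy gwy]|] := boolP (_ && _); rewrite ?mul0r // mul1r.
    have yv : y != v by apply: contraTneq gvy => ->; rewrite girr.
    have := gy y gvy; have := h1 w y gwy; rewrite !cx ?wv // mvE => e1 e2.
    have sp : dot (m w + s *: M v - m y) (U y s)
        = dot (m w - m y) (U y s) + s * dot (U y s) (M v).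
      by rewrite [X in dot X _ = _]addrAC (dotDl (m w - m y)) dotZl [dot (M v) _]dotC.
    have e3 : dot (m w - m y) (U y s) = s * dot (de s) (m w - m y).
      by rewrite /U [LHS]dotDr [X in X + _ = _]dotZr [X in _ + X = _]dotZr e1 mulr0 add0r dotC.
    move: e2; rewrite sp e3 -mulrDr => /eqP; rewrite mulf_eq0 (negbTE s0) /= => /eqP.
    by rewrite Mw (Mx y).
  - have [gvw|] := boolP (g v w); rewrite ?mul0r // mul1r.
    have := gy w gvw; rewrite /U subrr scaler0 add0r mvE addrAC subrr add0r.
    rewrite dotZl dotZr mulrA => /eqP; rewrite mulf_eq0 mulf_eq0 (negbTE s0) /= => /eqP e.
    by rewrite dotC.
  - by have [xv|] := boolP (x != v); rewrite ?mul0r // mul1r Mx //; have := h2 x; rewrite cx.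
  - have := Nv; have := h2 w; rewrite cx ?wv // mvE => e1 e2; rewrite Mw.
    apply/eqP; have := mulf_eq0 s (dot (hat (de s)) (m w) + dot (N s) (M v)).
    rewrite (negbTE s0) /= => <-; apply/eqP; rewrite -[RHS]e2 dotDr dotZr mulrDr.
    by congr (_ + _); rewrite /N !dotE e1 mulr0 add0r.
  - have [xT|] := boolP (x \in T); rewrite ?mul0r // mul1r.
    have xv : x != v by apply: contraTneq xT => ->.
    by rewrite Mx // h3 // mxE.
  - rewrite -[RHS](h4 i); apply: eq_bigr => x _; have [->|xv] := eqVneq x v.
      by rewrite mul0r dot0l.
    by rewrite mul1r Mx.
have mz x : x != v -> m x = 0 by move=> xv; rewrite -Mx // M0 ffunE.
move=> x; have [->|xv] := eqVneq x v; last exact: mz.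
by rewrite mvE M0 ffunE scaler0 addr0 mz // wv.
Qed.
End Split.

Section SplitLemmas.
Import Order.TTheory GRing.Theory Num.Theory.
Local Open Scope ring_scope.
Variables (R : realType) (V : finType).
Implicit Types (q m : V -> 'cV[R]_4) (g : rel V) (T : {set V}).

Definition indep4 q w a b z := forall e, dot (q w - q a) e = 0 ->
  dot (q w - q b) e = 0 -> dot (q w - q z) e = 0 -> dot (hat (q w)) e = 0 -> e = 0.

Definition indep3 q w x y := forall e, dot (hat (q w)) e = 0 -> dot (hat (q x)) e = 0 ->
  dot (hat (q y)) e = 0 -> height e = 0 -> e = 0.

(* [v] is pulled out of [w] in the direction of its old position, made tangent to
   the hypercylinder. *)
Lemma split_free g T q v w a b k : placement q -> v != w -> v \notin T ->
  (forall x, g x x = false) -> g v w -> g v a -> g w a -> g v b -> g w b ->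
  indep4 q w a b v -> flexdim_le (contract g v w) (v |: T) k q ->
  exists q', placement q' /\ flexdim_le g T k q'.
Proof.
move=> pq vw vT girr gvw va wa vb wb ind [f hf].
have /placementE pq' := pq.
pose c := dot (hat (q w)) (q w - q v).
have hw : dot (hat (q w)) (hat (q w)) = 1 by rewrite dot_hat.
apply: (@limit_flex _ _ g T q v w (q w - q v - c *: hat (q w)) k f) => //.
  by rewrite dotDr dotNr dotZr hw mulr1 subrr.
(* Once [m] vanishes, [e] is orthogonal to [q w - q a], [q w - q b] and [hat (q w)]; since [d]
   differs from [q w - q v] by a multiple of the last one, [indep4] applies. *)
move=> m e fl com /(_ gvw) de nw fz; have m0 := hf m fl fz.
split=> //; move: (com a va wa) (com b vb wb) nw.
rewrite !m0 subrr !dot0r !mulr0 !add0r => ea eb ew.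
apply: ind => //; move: de; rewrite dotDl dotNl dotZl ew mulr0 subr0 //.
Qed.

(* For [y = x] the limit system forces the spherical distance of [w] and [x] to be
   stationary. *)
Lemma split_collapse g T q v w a b z x k : placement q -> v != w -> v \notin T ->
  (forall x, g x x = false) -> g v w -> g v a -> g w a -> g v b -> g w b ->
  g v z -> g w z -> g v x -> g w x -> indep4 q w a b z ->
  dot (hat (q w)) (q x) != 1 ->
  (exists f : 'I_k -> V -> 'cV[R]_4, forall m, flexS (contract g v w) (v |: T) q m ->
     dot (hat (q w)) (m x) + dot (hat (q x)) (m w) = 0 ->
     (forall i, \sum_u dot (f i u) (m u) = 0) -> forall u, m u = 0) ->
  exists q', placement q' /\ flexdim_le g T k q'.
Proof.
move=> pq vw vT girr gvw va wa vb wb vz wz vx wx ind nx [f hf].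
have /placementE pq' := pq.
pose c := dot (hat (q w)) (q w - q x).
have hw : dot (hat (q w)) (hat (q w)) = 1 by rewrite dot_hat.
have cE : c = 1 - dot (hat (q w)) (q x) by rewrite /c dotDr dotNr pq'.
have c0 : c != 0 by rewrite cE subr_eq0 eq_sym.
apply: (@limit_flex _ _ g T q v w (q w - q x - c *: hat (q w)) k f) => //.
  by rewrite dotDr dotNr dotZr hw mulr1 subrr.
move=> m e fl com /(_ gvw) de nw fz.
have ex := com x vx wx.
have [fl1 fl2 fl3] := fl.
have xv : x != v by apply: contraTneq vx => ->; rewrite girr.
have xw : x != w by apply: contraTneq wx => ->; rewrite girr.
have ewx : dot (m w - m x) (q w - q x) = 0.
  by apply: fl1; rewrite /contract eqxx xv xw vx orbT.
(* Elimination of [e]: modulo [hat (q w)] the vector [d] is [q w - q x], which is orthogonal to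
   [m w - m x], so every term of the equation at [x] carries the factor [c]; [nw] then expresses the
   product of [hat (q w)] and [e] through [m w]. *)
have kx : dot (hat (q w)) (m x) + dot (hat (q x)) (m w) = 0.
  have n1 := fl2 w; have n2 := fl2 x.
  move: de; rewrite dotDl dotNl dotZl => de.
  move: nw; rewrite !hatl !dotDl !dotNl dotZl n1 mulr0 subr0 sub0r => nw.
  move: ex; rewrite dotDl dotNl dotZl [dot (q w - q x) (m w - m x)]dotC ewx.
  rewrite [dot (hat (q w)) (_ - _)]dotDr dotNr n1 sub0r => ex.
  have : c * (dot (hat (q w)) (m x) + dot (hat (q x)) (m w)) = 0.
    have te : dot (hat (q w)) e = 2 * dot (hat (q x)) (m w).
      by move: nw; move: (dot (hat (q w)) e) => t; lra.
    have key (s A B c' : R) : 2 * - (c' * (0 - A)) + s = 0 -> s - c' * (2 * B) = 0 ->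
      c' * (A + B) = 0 by move=> e1 e2; lra.
    by apply: key ex _; rewrite -te.
  by move/eqP; rewrite mulf_eq0 (negbTE c0) => /eqP.
have m0 := hf m fl kx fz.
split=> //; move: (com a va wa) (com b vb wb) (com z vz wz) nw.
rewrite !m0 subrr !dot0r !mulr0 !add0r => ea eb ez ew.
exact: ind.
Qed.

Definition at_vertex (w : V) (c : 'cV[R]_4) (u : V) := if u == w then c else 0.

Lemma sum_at_vertex w c m : \sum_u dot (at_vertex w c u) (m u) = dot c (m w).
Proof.
rewrite (bigD1 w) //= /at_vertex eqxx big1 ?addr0 // => u /negbTE->.
by rewrite dot0l.
Qed.

Lemma flexS_comb g T q m m' c : flexS g T q m -> flexS g T q m' ->
  flexS g T q (fun x => m x - c *: m' x).
Proof.
move=> [a1 a2 a3] [b1 b2 b3]; split=> [x y gxy|x|x xT].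
- have := a1 x y gxy; have := b1 x y gxy; rewrite !dotE.
  set s1 := dot _ _; set s2 := dot _ _; set s3 := dot _ _; set s4 := dot _ _.
  set s5 := dot _ _; set s6 := dot _ _; set s7 := dot _ _; set s8 := dot _ _.
  by move=> e1 e2; have := congr1 (fun t => c * t) e1; rewrite mulr0; lra.
- by rewrite dotDr dotNr dotZr a2 b2 mulr0 subr0.
- by rewrite a3 // b3 // scaler0 subr0.
Qed.

(* A linear form [ka] which does not vanish identically on the flexes cuts the
   dimension by one. *)
Lemma flexdim_cut g T q k (ka : (V -> 'cV[R]_4) -> R) m0 :
  (forall m m' c, ka (fun x => m x - c *: m' x) = ka m - c * ka m') ->
  flexdim_le g T k.+1 q -> flexS g T q m0 -> ka m0 != 0 ->
  exists f : 'I_k -> V -> 'cV[R]_4, forall m, flexS g T q m -> ka m = 0 ->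
     (forall i, \sum_u dot (f i u) (m u) = 0) -> forall u, m u = 0.
Proof.
move=> lin [f hf] fl0 k0.
pose F i m := \sum_u dot (f i u) (m u).
have FD i m m' c : F i (fun x => m x - c *: m' x) = F i m - c * F i m'.
  rewrite /F mulr_sumr -sumrB; apply: eq_bigr => u _.
  by rewrite dotDr dotNr dotZr.
(* Form [j] serves as a pivot: the other [k] forms are corrected by multiples of it so as to vanish
   on [m0]. *)
have [j hj] : exists j, F j m0 != 0.
  apply/existsP; rewrite -[X in is_true X]negbK negb_exists; apply/negP => /forallP h.
  have z : forall u, m0 u = 0 by apply: hf => // i; have := h i; rewrite negbK => /eqP.
  have := lin m0 m0 1.
  have -> : (fun x => m0 x - 1 *: m0 x) = m0 by apply/funext => x; rewrite z scaler0 subr0.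
  by rewrite mul1r subrr => /eqP; rewrite (negbTE k0).
exists (fun i u => f (lift j i) u - (F (lift j i) m0 / F j m0) *: f j u) => m fl km hm.
pose l := F j m / F j m0.
have z : forall u, m u - l *: m0 u = 0.
  apply: hf => [|i]; first exact: flexS_comb.
  rewrite -/(F i _) FD; have [i' ->|->] := unliftP j i; last by rewrite /l divfK // subrr.
  have := hm i'.
  have -> : \sum_u dot (f (lift j i') u - (F (lift j i') m0 / F j m0) *: f j u) (m u)
     = F (lift j i') m - F (lift j i') m0 / F j m0 * F j m.
    rewrite /F mulr_sumr -sumrB; apply: eq_bigr => u _.
    by rewrite dotDl dotNl dotZl.
  by move=> <-; rewrite /l; field.
have mE : m = (fun x => 0 *: m x - (- l) *: m0 x).
  apply/funext => x; rewrite scale0r sub0r scaleNr opprK; apply/eqP.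
  by rewrite -subr_eq0 z.
have l0 : l = 0.
  have : (fun x => m x - l *: m0 x) = (fun x => m0 x - 1 *: m0 x).
    by apply/funext => x; rewrite z scale1r subrr.
  move/(congr1 ka); rewrite !lin km mul1r subrr sub0r => /eqP.
  by rewrite oppr_eq0 mulf_eq0 (negbTE k0) orbF => /eqP.
by move=> u; have := z u; rewrite l0 scale0r subr0.
Qed.

(** With [w] at rest, an edge at [w] whose ends differ in height turns a vanishing product with
    [hat (q w)] into a vanishing height. Four independent conditions then hold at [x], and once [x]
    is at rest also at [y]. *)
Lemma triangle_pinned g T q w x y m : flexS g T q m -> g w x -> g w y -> g x y ->
  indep3 q w x y -> height (q w) != height (q x) -> height (q w) != height (q y) ->
  m w = 0 -> dot (hat (q w)) (m x) = 0 -> dot (hat (q w)) (m y) = 0 ->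
  dot (hat (q y)) (m x) = 0 -> m x = 0 /\ m y = 0.
Proof.
move=> [h1 h2 h3] wx wy xy ind hx hy mw kx ky f.
have hz u : g w u -> height (q w) != height (q u) -> dot (hat (q w)) (m u) = 0 ->
    height (m u) = 0.
  move=> wu hu ku; have := h1 w u wu; rewrite mw sub0r dotNl dotC dotDl dotNl.
  rewrite [dot (q w) _]dot_split [dot (q u) _]dot_split ku h2 !add0r -mulrBl => /eqP.
  by rewrite oppr_eq0 mulf_eq0 subr_eq0 (negbTE hu) /= => /eqP.
have tx := hz _ wx hx kx; have ty := hz _ wy hy ky.
have mx : m x = 0 by apply: ind.
split=> //; apply: ind => //.
have := h1 x y xy; rewrite mx sub0r dotNl dotC dotDl dotNl.
rewrite [dot (q x) _]dot_split [dot (q y) _]dot_split h2 ty !mulr0 !addr0 subr0 => /eqP.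
by rewrite oppr_eq0 => /eqP.
Qed.

(** Three vertices have 12 coordinates, minus three tangencies and three edges: six forms bring the
    triangle to rest, three at [w], two at [x] and one at [y]. *)
Lemma triangle_flexdim g T q w x y : g w x -> g w y -> g x y ->
  indep3 q w x y -> height (q w) != height (q x) -> height (q w) != height (q y) ->
  flexdim_le g ([set w; x; y] :|: T) 0 q -> flexdim_le g T 6 q.
Proof.
move=> wx wy xy ind hx hy [f0 hf0].
exists (fun i => match val i with
  | 0 => at_vertex w (axis R) | 1 => at_vertex w (hat (q x)) | 2 => at_vertex w (hat (q y))
  | 3 => at_vertex x (axis R) | 4 => at_vertex x (hat (q y)) | _ => at_vertex y (axis R) end)%N.
move=> m fl h; have [h1 h2 h3] := fl.
have e0 := h (inord 0); have e1 := h (inord 1); have e2 := h (inord 2).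
have e3 := h (inord 3); have e4 := h (inord 4); have e5 := h (inord 5).
rewrite /= inordK // sum_at_vertex ?dot_axis in e0.
rewrite /= inordK // sum_at_vertex ?dot_axis in e1.
rewrite /= inordK // sum_at_vertex ?dot_axis in e2.
rewrite /= inordK // sum_at_vertex ?dot_axis in e3.
rewrite /= inordK // sum_at_vertex ?dot_axis in e4.
rewrite /= inordK // sum_at_vertex ?dot_axis in e5.
have mw : m w = 0 by apply: ind.
have kw u : g w u -> height (m u) = 0 -> dot (hat (q w)) (m u) = 0.
  move=> wu hu; have := h1 w u wu; rewrite mw sub0r dotNl dotC dotDl dotNl.
  rewrite [dot (q w) _]dot_split [dot (q u) _]dot_split hu !mulr0 !addr0 h2 subr0 => /eqP.
  by rewrite oppr_eq0 => /eqP.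
have [mx my] := triangle_pinned fl wx wy xy ind hx hy mw (kw x wx e3) (kw y wy e5) e4.
apply: hf0 => [|[]//]; split=> // u; rewrite !inE => /orP[|/h3 //].
by case/orP => [/orP[]|] /eqP->.
Qed.

(** [ka u] is the derivative of the inner product of the horizontal parts of [w] and [u]. If it is
    not identically zero on the flexes for [u = x] or [u = y], it cuts their dimension by one.
    Otherwise both vanish on all flexes, and four forms, three at [w] and one at [x], bring the face
    to rest and with it everything; hence [4 <= k]. *)
Lemma split_collapse_triangle g T q v w a b z x y k : placement q -> v != w ->
  v \notin T -> (forall x, g x x = false) -> g v w ->
  g v a -> g w a -> g v b -> g w b -> g v z -> g w z ->
  g v x -> g w x -> g v y -> g w y -> contract g v w x y ->
  indep4 q w a b z -> indep3 q w x y ->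
  dot (hat (q w)) (q x) != 1 -> dot (hat (q w)) (q y) != 1 ->
  height (q w) != height (q x) -> height (q w) != height (q y) ->
  (4 <= k)%N -> flexdim_le (contract g v w) (v |: T) k.+1 q ->
  flexdim_le (contract g v w) ([set w; x; y] :|: (v |: T)) 0 q ->
  exists q', placement q' /\ flexdim_le g T k q'.
Proof.
move=> pq vw vT girr gvw va wa vb wb vz wz vx wx vy wy xy i4 i3 nx ny hx hy k4 dk d0.
pose ka u m := dot (hat (q w)) (m u) + dot (hat (q u)) (m w).
have kal u m m' c : ka u (fun x => m x - c *: m' x) = ka u m - c * ka u m'.
  by rewrite /ka !dotDr !dotNr !dotZr; ring.
have cw u : g v u -> g w u -> contract g v w w u.
  move=> gv gw; rewrite /contract eqxx gv andbT /= orbC.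
  have -> : u != v by apply: contraTneq gv => ->; rewrite girr.
  by have -> : u != w by apply: contraTneq gw => ->; rewrite girr.
have [[m0 [fl0 k0]]|nox] := pselect (exists m0, flexS (contract g v w) (v |: T) q m0 /\ ka x m0 != 0).
  apply: (@split_collapse g T q v w a b z x k) => //.
  exact: (flexdim_cut (kal x) dk fl0 k0).
have [[m0 [fl0 k0]]|noy] := pselect (exists m0, flexS (contract g v w) (v |: T) q m0 /\ ka y m0 != 0).
  apply: (@split_collapse g T q v w a b z y k) => //.
  exact: (flexdim_cut (kal y) dk fl0 k0).
apply: (@split_collapse g T q v w a b z x k) => //.
exists (fun i => match val i with
  | 0 => at_vertex w (axis R) | 1 => at_vertex w (hat (q x)) | 2 => at_vertex w (hat (q y))
  | _ => at_vertex x (hat (q y)) end)%N.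
move=> m fl _ h; have [h1 h2 h3] := fl; have [f0 hf0] := d0.
have ord i : (i < 4)%N -> exists j : 'I_k, val j = i.
  by move=> i4'; exists (Ordinal (leq_trans i4' k4)).
have [j0 v0] := ord 0%N isT; have [j1 v1] := ord 1%N isT.
have [j2 v2] := ord 2%N isT; have [j3 v3] := ord 3%N isT.
have := h j0; rewrite v0 sum_at_vertex dot_axis => e0.
have := h j1; rewrite v1 sum_at_vertex => e1.
have := h j2; rewrite v2 sum_at_vertex => e2.
have := h j3; rewrite v3 sum_at_vertex => e3.
have mw : m w = 0 by apply: i3.
have kx : dot (hat (q w)) (m x) = 0.
  apply: contrapT => ne; apply: nox; exists m; split=> //.
  by rewrite /ka mw dot0r addr0; apply/eqP.
have ky : dot (hat (q w)) (m y) = 0.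
  apply: contrapT => ne; apply: noy; exists m; split=> //.
  by rewrite /ka mw dot0r addr0; apply/eqP.
have [mx my] := triangle_pinned fl (cw x vx wx) (cw y vy wy) xy i3 hx hy mw kx ky e3.
apply: hf0 => [|[]//]; split=> // u; rewrite inE => /orP[|/h3 //].
by rewrite !inE => /orP[/orP[]|] /eqP->.
Qed.

(** The first two conditions make local systems of four equations regular. Distinct heights serve
    [triangle_pinned]; the last condition separates horizontal parts and makes the constant [c] of
    [split_collapse] nonzero. *)
Definition general_position q := [/\
  forall w a b z, uniq [:: w; a; b; z] -> indep4 q w a b z,
  forall w x y, uniq [:: w; x; y] -> indep3 q w x y,
  forall w x, w != x -> height (q w) != height (q x) &
  forall w x, w != x -> dot (hat (q w)) (q x) != 1].

Lemma general_position_generic : generic general_position.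
Proof.
pose i0 : 'I_4 := ord0; pose i1 : 'I_4 := Ordinal (isT : (1 < 4)%N).
pose i2 : 'I_4 := Ordinal (isT : (2 < 4)%N).
pose E i : 'cV[R]_4 := delta_mx i 0.
have dE i (x : 'cV[R]_4) : dot (E i) x = x i 0 := dot_delta i x.
have hE i : i != ord_max -> hat (E i) = E i := @hat_delta R i.
have coord (e : 'cV[R]_4) : dot (E i0) e = 0 -> dot (E i1) e = 0 -> dot (E i2) e = 0 ->
    height e = 0 -> e = 0.
  rewrite !dE /height => e0 e1 e2 e3; apply/colP => i; rewrite mxE.
  case: i => [[|[|[|[|//]]]] hi].
  - by rewrite -e0; congr (e _ 0); apply: val_inj.
  - by rewrite -e1; congr (e _ 0); apply: val_inj.
  - by rewrite -e2; congr (e _ 0); apply: val_inj.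
  - by rewrite -e3; congr (e _ 0); apply: val_inj.
(* Witnesses with horizontal parts along the coordinate axes; the vertices in [Z] are lifted by 1
   above the default position. *)
pose pl (A B Z : pred V) (u : V) : 'cV[R]_4 :=
  if A u then E i1 else if B u then E i2 else if Z u then E i0 + axis R else E i0.
have plp A B Z : placement (pl A B Z).
  apply/placementE => u; rewrite -dot_hat /pl.
  by do ! case: ifP => _; rewrite ?hatl ?addr0 ?hE // dE mxE !eqxx.
have q0 := plp pred0 pred0 pred0.
have z1 (I : finType) (W : vectType R) (L : (V -> 'cV[R]_4) -> I -> W -> R) P :
    (forall q, P q <-> forall x, (forall i, L q i x = 0) -> x = 0) ->
    zopen (fun q => forall x, (forall i, L q i x = 0) -> x = 0) -> zopen P.
  move=> e zz c rc s0 /e h; have [f [f0 hf]] := zz c rc s0 h.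
  by exists f; split=> // s fs; apply/e; apply: hf.
have lin4 (e : 'cV[R]_4) (b : R) (u w : 'cV[R]_4) : dot e (b *: u + w) = b * dot e u + dot e w.
  by rewrite dotDr dotZr.
have pfd (mu : V -> R -> R) (c : R -> V -> 'cV[R]_4) w a (e : 'cV[R]_4) :
    polyfun (mu w) -> polyfun (mu a) -> polyvec (fun s => mu w s *: c s w) ->
    polyvec (fun s => mu a s *: c s a) -> polyfun (fun s => mu w s * mu a s * dot (c s w - c s a) e).
  move=> ? ? ? ?; apply: (@pf_ext _ (fun s => dot (mu a s *: (mu w s *: c s w)
     - mu w s *: (mu a s *: c s a)) e)); last by pf.
  by move=> s; rewrite !dotE; ring.
have pfh (mu : V -> R -> R) (c : R -> V -> 'cV[R]_4) w (e : 'cV[R]_4) :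
    polyvec (fun s => mu w s *: c s w) -> polyfun (fun s => mu w s * dot (hat (c s w)) e).
  move=> ?; apply: (@pf_ext _ (fun s => dot (mu w s *: c s w) (hat e))); last by pf.
  by move=> s; rewrite dotZl dot_hatC.
have g4 w a b z : uniq [:: w; a; b; z] -> generic (fun q => indep4 q w a b z).
  rewrite /= !inE !negb_or andbT => /and3P[/and3P[wa wb wz] /andP[ab az] bz]; split.
    apply: (@z1 'I_4 _ (fun q i e => match val i with 0%N => dot (q w - q a) e
      | 1%N => dot (q w - q b) e | 2%N => dot (q w - q z) e | _ => dot (hat (q w)) e end)).
      move=> q; split=> [h x hx|h x x1 x2 x3 x4].
        apply: h; [exact: (hx i0)|exact: (hx i1)|exact: (hx i2)|exact: (hx ord_max)].
      by apply: h => -[[|[|[|i]]] hi].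
    apply: zopen_injective => [q [[|[|[|i]]] hi] t u u' //=|c [_ [mu [m1 m2 m3]]] [[|[|[|i]]] hi] /=].
    - by exists (fun s => mu w s * mu a s); split=> [s|x]; [rewrite mulf_neq0|apply: pfd].
    - by exists (fun s => mu w s * mu b s); split=> [s|x]; [rewrite mulf_neq0|apply: pfd].
    - by exists (fun s => mu w s * mu z s); split=> [s|x]; [rewrite mulf_neq0|apply: pfd].
    - by exists (mu w); split=> [s|x]; [|apply: pfh].
  exists (pl (pred1 a) (pred1 b) (pred1 z)); split=> // e.
  rewrite /pl /= !eqxx [b == a]eq_sym ![z == _]eq_sym.
  rewrite (negbTE wa) (negbTE wb) (negbTE wz) (negbTE ab) (negbTE az) (negbTE bz).
  rewrite opprD addrA subrr sub0r hE // !dotDl !dotNl dot_axis => h1 h2 h3 h4.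
  rewrite h4 in h1 h2; apply: coord => //.
  - by move/eqP: h1; rewrite sub0r oppr_eq0 => /eqP.
  - by move/eqP: h2; rewrite sub0r oppr_eq0 => /eqP.
  - by move/eqP: h3; rewrite oppr_eq0 => /eqP.
have g3 w x y : uniq [:: w; x; y] -> generic (fun q => indep3 q w x y).
  rewrite /= !inE !negb_or andbT => /andP[/andP[wx wy] xy]; split.
    apply: (@z1 'I_4 _ (fun q i e => match val i with 0%N => dot (hat (q w)) e
      | 1%N => dot (hat (q x)) e | 2%N => dot (hat (q y)) e | _ => dot (axis R) e end)).
      move=> q; split=> [h e hx|h e x1 x2 x3 x4].
        apply: h; [exact: (hx i0)|exact: (hx i1)|exact: (hx i2)|rewrite -dot_axis; exact: (hx ord_max)].
      by apply: h => -[[|[|[|i]]] hi] //=; rewrite dot_axis.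
    apply: zopen_injective => [q [[|[|[|i]]] hi] t u u' //=|c [_ [mu [m1 m2 m3]]] [[|[|[|i]]] hi] /=].
    - by exists (mu w); split=> [s|e]; [|apply: pfh].
    - by exists (mu x); split=> [s|e]; [|apply: pfh].
    - by exists (mu y); split=> [s|e]; [|apply: pfh].
    - by exists (fun=> 1); split=> [s|e]; [rewrite oner_eq0|pf].
  exists (pl (pred1 x) (pred1 y) pred0); split=> // e.
  rewrite /pl /= !eqxx [y == x]eq_sym (negbTE wx) (negbTE wy) (negbTE xy).
  by rewrite !hE // => h1 h2 h3 h4; apply: coord.
have gh w x : w != x -> generic (fun q => height (q w) != height (q x)).
  move=> wx; split.
    (* A number is nonzero when multiplication by it is injective; this brings the condition into
       the form of [zopen_injective]. *)
    apply: (@z1 unit R^o (fun q _ t => dot (q w - q x) (axis R) * t)).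
      move=> q; rewrite dotDl dotNl !dot_axisr -subr_eq0; split=> [h t /(_ tt)/eqP|h].
        by rewrite mulf_eq0 (negbTE h) => /eqP.
      apply/eqP => h0; have := h 1; rewrite h0 => /(_ (fun=> mul0r _)) /eqP.
      by rewrite oner_eq0.
    apply: zopen_injective => [q _ t u u'|c [_ [mu [m1 m2 m3]]] _].
      by rewrite mulrDr; congr (_ + _); rewrite /GRing.scale /=; ring.
    exists (fun s => mu w s * mu x s); split=> [s|t]; first by rewrite mulf_neq0.
    apply: (@pf_ext _ (fun s => (mu w s * mu x s * dot (c s w - c s x) (axis R)) * t)).
      by move=> s; rewrite mulrA.
    by apply: pf_mul; [apply: pfd|apply: pf_const].
  exists (pl pred0 pred0 (pred1 x)); split=> //; rewrite /pl /= eqxx (negbTE wx).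
  by rewrite heightD height_axis addrC -subr_eq0 opprD addrCA subrr addr0 oppr_eq0 oner_eq0.
have gn w x : w != x -> generic (fun q => dot (hat (q w)) (q x) != 1).
  move=> wx; split.
    apply: (@z1 unit R^o (fun q _ t => (1 - dot (hat (q w)) (q x)) * t)).
      move=> q; rewrite eq_sym -subr_eq0; split=> [h t /(_ tt)/eqP|h].
        by rewrite mulf_eq0 (negbTE h) => /eqP.
      apply/eqP => h0; have := h 1; rewrite h0 => /(_ (fun=> mul0r _)) /eqP.
      by rewrite oner_eq0.
    apply: zopen_injective => [q _ t u u'|c [_ [mu [m1 m2 m3]]] _].
      by rewrite mulrDr; congr (_ + _); rewrite /GRing.scale /=; ring.
    exists (fun s => mu w s * mu x s); split=> [s|t]; first by rewrite mulf_neq0.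
    have hw := m3 w; have hx := m3 x; have mw := m1 w; have mx := m1 x.
    have hhw := pv_hat hw.
    apply: (@pf_ext _ (fun s => (mu w s * mu x s
       - dot (hat (mu w s *: c s w)) (mu x s *: c s x)) * t)); last by pf.
    by move=> s; rewrite hatZ !dotE; ring.
  exists (pl (pred1 x) pred0 pred0); split=> //; rewrite /pl /= eqxx (negbTE wx).
  by rewrite hE // dE mxE /= eq_sym oner_eq0.
have G4 : generic (fun q => forall t : V * V * V * V, uniq [:: t.1.1.1; t.1.1.2; t.1.2; t.2] ->
    indep4 q t.1.1.1 t.1.1.2 t.1.2 t.2).
  by apply: (generic_forall q0) => t; apply: (generic_imp q0); apply: g4.
have G3 : generic (fun q => forall t : V * V * V, uniq [:: t.1.1; t.1.2; t.2] ->
    indep3 q t.1.1 t.1.2 t.2).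
  by apply: (generic_forall q0) => t; apply: (generic_imp q0); apply: g3.
have GH : generic (fun q => forall t : V * V, t.1 != t.2 -> height (q t.1) != height (q t.2)).
  by apply: (generic_forall q0) => t; apply: (generic_imp q0); apply: gh.
have GN : generic (fun q => forall t : V * V, t.1 != t.2 -> dot (hat (q t.1)) (q t.2) != 1).
  by apply: (generic_forall q0) => t; apply: (generic_imp q0); apply: gn.
have := generic_and (generic_and G4 G3) (generic_and GH GN).
case=> o [q [pq [[h4 h3] [hh hn]]]]; split; last first.
  exists q; split=> //; split=> [w a b z|w x y|w x|w x].
  - exact: (h4 (w, a, b, z)).
  - exact: (h3 (w, x, y)).
  - exact: (hh (w, x)).
  - exact: (hn (w, x)).
move=> c rc s0 [k4 k3 kh kn]; have [|f [f0 hf]] := o c rc s0.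
  by split; split=> *; [apply: k4|apply: k3|apply: kh|apply: kn].
exists f; split=> // s /hf[[l4 l3] [lh ln]]; split=> [w a b z|w x y|w x|w x].
- exact: (l4 (w, a, b, z)).
- exact: (l3 (w, x, y)).
- exact: (lh (w, x)).
- exact: (ln (w, x)).
Qed.
End SplitLemmas.

(** * The two inductions on triangulations *)

Section Main.
Import GRing.Theory.
Variables (R : realType) (V : finType).
Implicit Types (S : {set V}) (adj : rel V) (n : V -> V -> V) (B : {set {set V}}).

Definition grel adj B : rel V := fun x y => adj x y || ([set x; y] \in B).

Lemma generic_flexdim g T k :
  (exists q : V -> 'cV[R]_4, placement q /\ flexdim_le g T k q) -> generic (flexdim_le (R := R) g T k).
Proof. by split=> //; apply: flexdim_le_zopen. Qed.

Lemma new_adj_contract S adj n B v w a b zs n' : tri S adj n ->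
  contraction S adj n B v w a b zs n' -> forall (g : rel V),
  (forall x y, adj x y -> g x y) -> forall x y, new_adj adj v w zs x y ->
  contract g v w x y \/ contract g v w y x.
Proof.
move=> T ct g sub x y; rewrite /new_adj /contract => /or3P[].
- by case/and3P=> axy -> ->; left; rewrite sub.
- case/andP=> -> /(ct_z ct)[vz _ zw _ _]; left.
  by rewrite zw (sub _ _ vz) [y == v]eq_sym (tri_neq T vz) orbT.
- case/andP=> -> /(ct_z ct)[vz _ zw _ _]; right.
  by rewrite zw (sub _ _ vz) [x == v]eq_sym (tri_neq T vz) orbT.
Qed.

(* Induction on [S]: a vertex of degree at most 5 off the face is contracted. *)
Lemma pinned_face S adj n x y : tri S adj n -> 4 <= #|S| -> adj x y ->
  generic (flexdim_le (R := R) adj ([set x; y; n x y] :|: ~: S) 0).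
Proof.
move: {2}#|S| (leqnn #|S|) => N; elim: N S adj n x y => [|N IH] S adj n x y.
  by rewrite leqn0 => /eqP-> _ //.
move=> SN T S4 xy; set z := n x y.
have yz : adj y z := tri_adj T xy; have zx : adj z x := tri_adj' T xy.
have [xS yS zS] := And3 (tri_inS T xy) (tri_inS T yz) (tri_inS T zx).
have nxy := tri_neq T xy; have nyz := tri_neq T yz; have nzx := tri_neq T zx.
have girr : forall u, adj u u = false := tri_irr T.
have [oGP [q0 [pq0 GP0]]] := @general_position_generic R V.
have [S4'|S5] := leqP #|S| 4.
  have [v vS vT] : exists2 v, v \in S & v \notin [set x; y; z].
    apply/subsetPn/negP => /subset_leq_card; apply/negP; rewrite -ltnNge.
    apply: leq_trans S4; rewrite setUC !cardsU1 cards1; lia.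
  (* Base case: the fourth vertex is joined to three vertices at rest, which with tangency gives the
     four equations of [indep4]. *)
  apply: generic_flexdim; exists q0; split=> //; exists (fun _ _ => 0%R) => m [h1 h2 h3] _ u.
  have p u' : u' \in [set x; y; z] -> m u' = 0%R by move=> h; apply: h3; rewrite inE h.
  have [uS|uS] := boolP (u \in S); last by apply: h3; rewrite !inE uS orbT.
  have [uT|uT] := boolP (u \in [set x; y; z]); first exact: p.
  have ua u' : u' \in [set x; y; z] -> adj u u'.
    move=> h; apply: (neighbours_lt T uS S4').
      by move: h; rewrite !inE => /orP[/orP[]|] /eqP->.
    by apply: contraNneq uT => <-.
  have e u' : u' \in [set x; y; z] -> dot (q0 u - q0 u')%R (m u) = 0%R.
    by move=> h; have := h1 u u' (ua u' h); rewrite (p u' h) subr0 dotC.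
  have [g4 _ _ _] := GP0.
  apply: (g4 u x y z); rewrite ?e ?h2 ?inE ?eqxx ?orbT //.
  move: uT; rewrite /= !inE !negb_or andbT => /andP[/andP[-> ->] ->].
  by rewrite nxy nyz eq_sym nzx.
have U3 : #|[set x; y; z]| <= 4 by rewrite setUC !cardsU1 cards1; lia.
have [[v [vS vU d5]]|[c4 _]] := exists_low T U3.
- have [|w [a [b [zs [n' ct]]]]] := contract_low (B := set0) T vS S5 d5; first by rewrite cards0.
  move: vU; rewrite !inE !negb_or => /andP[/andP[vx vy] vz].
  have xy' : new_adj adj v w zs x y.
    by rewrite /new_adj xy ![_ == v]eq_sym vx vy.
  have cS : #|S| = #|S :\ v|.+1 by rewrite (cardsD1 v) vS.
  have SN' : #|S :\ v| <= N by rewrite -ltnS -cS.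
  have S4' : 4 <= #|S :\ v| by rewrite -ltnS -cS.
  have nz : n' x y = z by apply: (ct_old ct); rewrite // eq_sym.
  have [_ [q [pq [gp dq]]]] := generic_and (@general_position_generic R V)
    (IH _ _ _ _ _ SN' (ct_tri ct) S4' xy').
  apply: generic_flexdim; have [wa wb] := (ct_a ct, ct_b ct).
  have [g4 _ _ _] := gp.
  apply: (@split_free _ _ _ _ q v w a b) => //.
  + exact: (tri_neq T (ct_w ct)).
  + by rewrite !inE negb_or negbK vS (negbTE vx) (negbTE vy) (negbTE vz).
  + exact: (ct_w ct).
  + by case: wa.
  + by case: wa.
  + by case: wb.
  + by case: wb.
  + apply: g4; rewrite /= !inE !negb_or andbT.
    rewrite (tri_neq T (proj2 wa)) (tri_neq T (proj2 wb)) (ct_ab ct).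
    by rewrite ![_ == v]eq_sym (tri_neq T (ct_w ct)) (tri_neq T (proj1 wa)) (tri_neq T (proj1 wb)).
  + apply: flexdim_sub dq; first exact: new_adj_contract T ct adj (fun _ _ h => h).
    apply/subsetP => u; rewrite nz !inE negb_and negbK.
    by case/orP=> [->|/orP[->|->]]; rewrite ?orbT.
- by move: c4; rewrite setUC !cardsU1 cards1; lia.
Qed.

Lemma card_cover2 B : (forall e, e \in B -> #|e| = 2) -> #|cover B| <= 2 * #|B|.
Proof.
move=> h; rewrite mulnC -sum_nat_const; apply: leq_trans (leq_card_cover B) _.
by apply: leq_sum => e /h ->.
Qed.

(* If every vertex of degree at most 5 is covered, there are two disjoint braces
   between vertices of degree 3, and one end of the first is contracted. *)
Lemma braced_flexdim S adj n B : tri S adj n -> 4 <= #|S| ->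
  (forall e, e \in B -> #|e| = 2 /\ e \subset S) ->
  (forall x y, adj x y -> [set x; y] \notin B) -> #|B| <= 2 ->
  generic (flexdim_le (R := R) (grel adj B) (~: S) (6 - #|B|)).
Proof.
move: {2}#|S| (leqnn #|S|) => N; elim: N S adj n B => [|N IH] S adj n B.
  by rewrite leqn0 => /eqP-> _ //.
move=> SN T S4 BS aB B2.
have nn (x : V) : [set x; x] \notin B.
  by apply/negP => /BS[]; rewrite setUid cards1.
have girr x : grel adj B x x = false by rewrite /grel (tri_irr T) (negbTE (nn x)).
have gs x y : adj x y -> grel adj B x y by rewrite /grel => ->.
have [oGP [q0 [pq0 GP0]]] := @general_position_generic R V.
have gGP : generic (@general_position R V) by apply: general_position_generic.
have cS v : v \in S -> #|S| = #|S :\ v|.+1 by move=> vS; rewrite (cardsD1 v) vS.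
(* Without braces, six forms bring one face to rest and [pinned_face] does the same to all other
   vertices. *)
have [B0|[e0 e0B]] := set_0Vmem B.
  have [x xS] : exists x, x \in S by apply/set0Pn; rewrite -card_gt0; lia.
  have /existsP[y xy] : [exists y, adj x y] by rewrite -(tri_dom T).
  have [_ [q [pq [gp dq]]]] := generic_and gGP (pinned_face T S4 xy).
  apply: generic_flexdim; exists q; split=> //.
  have yz := tri_adj T xy; have zx := tri_adj' T xy.
  have [_ g3 gh _] := gp.
  have -> : 6 - #|B| = 6 by rewrite B0 cards0.
  apply: (@triangle_flexdim _ _ _ _ q x y (n x y)).
  - exact: gs.
  - by apply: gs; rewrite (tri_sym T).
  - exact: gs.
  - apply: g3; rewrite /= !inE negb_or andbT (tri_neq T xy) (tri_neq T yz) eq_sym.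
    by rewrite (tri_neq T zx).
  - by apply: gh; exact: (tri_neq T xy).
  - by apply: gh; rewrite eq_sym (tri_neq T zx).
  - by apply: flexdim_sub dq => // u v uv; left; apply: gs.
have B1 : 0 < #|B| by rewrite card_gt0; apply/set0Pn; exists e0.
(* On four vertices a triangulation is complete and admits no brace. *)
have S5 : 4 < #|S|.
  rewrite ltnNge; apply/negP => S4'.
  have [/eqP/cards2P[x [y [nxy ee]]] sub] := BS _ e0B.
  have xS : x \in S by apply: (subsetP sub); rewrite ee set21.
  have yS : y \in S by apply: (subsetP sub); rewrite ee set22.
  have xy : adj x y by apply: (neighbours_lt T xS S4' yS); rewrite eq_sym.
  by have := aB _ _ xy; rewrite -ee e0B.
have cov4 : #|cover B| <= 4.
  apply: leq_trans (card_cover2 _) (_ : 2 * #|B| <= 2 * 2); last by rewrite leq_mul2l.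
  by move=> e /BS[].
have step v w a b zs n' B' : v \in S -> contraction S adj n B v w a b zs n' ->
    (forall x y, [set x; y] \in B' -> contract (grel adj B) v w x y \/ contract (grel adj B) v w y x) ->
    forall x y, grel (new_adj adj v w zs) B' x y ->
      contract (grel adj B) v w x y \/ contract (grel adj B) v w y x.
  move=> vS ct hB x y /orP[|/hB //]; apply: (new_adj_contract T ct); exact: gs.
have pins v (T' : {set V}) : T' :|: ~: (S :\ v) \subset T' :|: (v |: ~: S).
  by apply: setUS; apply/subsetP => u; rewrite !inE negb_and negbK.
have pins0 v : ~: (S :\ v) \subset v |: ~: S.
  by apply/subsetP => u; rewrite !inE negb_and negbK.
have ih v w a b zs n' B' : v \in S -> contraction S adj n B v w a b zs n' ->
    (forall e, e \in B' -> #|e| = 2 /\ e \subset S :\ v) ->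
    (forall x y, new_adj adj v w zs x y -> [set x; y] \notin B') -> #|B'| <= 2 ->
    generic (flexdim_le (R := R) (grel (new_adj adj v w zs) B') (~: (S :\ v)) (6 - #|B'|)).
  move=> vS ct h1 h2 h3; apply: IH h1 h2 h3; last by rewrite -ltnS -cS.
    by rewrite -ltnS -cS.
  exact: (ct_tri ct).
(* The case in which the contraction keeps the number of braces. *)
have free v w a b zs n' B' : v \in S -> contraction S adj n B v w a b zs n' ->
    (forall e, e \in B' -> #|e| = 2 /\ e \subset S :\ v) ->
    (forall x y, new_adj adj v w zs x y -> [set x; y] \notin B') -> #|B'| = #|B| ->
    (forall x y, [set x; y] \in B' -> contract (grel adj B) v w x y \/ contract (grel adj B) v w y x) ->
    generic (flexdim_le (R := R) (grel adj B) (~: S) (6 - #|B|)).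
  move=> vS ct h1 h2 h3 hB.
  have B'2 : #|B'| <= 2 by rewrite h3.
  have [_ [q [pq [gp dq]]]] := generic_and gGP (ih _ _ _ _ _ _ _ vS ct h1 h2 B'2).
  have [wa wb] := (ct_a ct, ct_b ct); have [g4 _ _ _] := gp.
  apply: generic_flexdim; apply: (@split_free _ _ _ _ q v w a b) => //.
  - exact: (tri_neq T (ct_w ct)).
  - by rewrite inE negbK.
  - by apply: gs; exact: (ct_w ct).
  - by apply: gs; case: wa.
  - by apply: gs; case: wa.
  - by apply: gs; case: wb.
  - by apply: gs; case: wb.
  - apply: g4; rewrite /= !inE !negb_or andbT.
    rewrite (tri_neq T (proj2 wa)) (tri_neq T (proj2 wb)) (ct_ab ct).
    by rewrite ![_ == v]eq_sym (tri_neq T (ct_w ct)) (tri_neq T (proj1 wa)) (tri_neq T (proj1 wb)).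
  - by rewrite -h3; apply: flexdim_sub dq => //; apply: step ct hB.
(* The case in which the brace [e] is lost. Both [v] and [w] are joined to [z], once by an edge and
   once by [e]. The vertices [x] and [y] are common neighbours that form a face of the contraction
   with [w], so [pinned_face] applies to it. *)
have collapse v w a b z x y zs n' e : v \in S -> contraction S adj n B v w a b zs n' ->
    e \in B -> (forall e', e' \in B -> e' != e -> e' \subset S :\ v) ->
    (forall x y, new_adj adj v w zs x y -> [set x; y] \notin B :\ e) ->
    z \notin [:: w; a; b] -> grel adj B v z -> grel adj B w z ->
    x \in [:: a; b; z] -> y \in [:: a; b; z] -> adj x y ->
    new_adj adj v w zs w x -> n' w x = y ->
    generic (flexdim_le (R := R) (grel adj B) (~: S) (6 - #|B|)).
  move=> vS ct eB he hn zw vz wz xm ym xy wx nwy.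
  have cB : #|B| = #|B :\ e|.+1 by rewrite (cardsD1 e) eB.
  have h1 e' : e' \in B :\ e -> #|e'| = 2 /\ e' \subset S :\ v.
    by rewrite !inE => /andP[ne eB']; split; [case: (BS _ eB')|apply: he].
  have B'2 : #|B :\ e| <= 2 by rewrite -ltnS -cB (leq_trans B2).
  have S4' : 4 <= #|S :\ v| by rewrite -ltnS -cS.
  have pf := pinned_face (ct_tri ct) S4' wx; rewrite nwy in pf.
  have [_ [q [pq [gp [dq d0]]]]] :=
    generic_and gGP (generic_and (ih _ _ _ _ _ _ _ vS ct h1 hn B'2) pf).
  have [[va wa] [vb wb]] := (ct_a ct, ct_b ct); have [g4 g3 gh gn] := gp.
  have hB x' y' : [set x'; y'] \in B :\ e ->
      contract (grel adj B) v w x' y' \/ contract (grel adj B) v w y' x'.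
    move=> h; have [_ /subsetP sub] := h1 _ h; left; rewrite /contract.
    have := sub _ (set21 x' y'); have := sub _ (set22 x' y'); rewrite !inE => /andP[-> _] /andP[-> _].
    by move: h; rewrite /grel !inE => /andP[_ ->]; rewrite orbT.
  have gvw u : u \in [:: a; b; z] -> grel adj B v u /\ grel adj B w u.
    by rewrite !inE => /or3P[]/eqP->; split=> //; apply: gs.
  have gneq s t : grel adj B s t -> s != t.
    by apply: contraTneq => ->; rewrite girr.
  have [vx wx'] := gvw _ xm; have [vy wy'] := gvw _ ym.
  apply: generic_flexdim; apply: (@split_collapse_triangle _ _ _ _ q v w a b z x y) => //.
  - exact: (tri_neq T (ct_w ct)).
  - by rewrite inE negbK.
  - by apply: gs; exact: (ct_w ct).
  - exact: gs.
  - exact: gs.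
  - exact: gs.
  - exact: gs.
  - rewrite /contract gs // ![_ == v]eq_sym (gneq _ _ vx) (gneq _ _ vy) //.
  - apply: g4; move: zw; rewrite /= !inE !negb_or andbT => /and3P[h2 h3 h4].
    rewrite (tri_neq T wa) (tri_neq T wb) (ct_ab ct) eq_sym h2 eq_sym h3.
    by rewrite eq_sym h4.
  - apply: g3; rewrite /= !inE !negb_or andbT (gneq _ _ wx') (gneq _ _ wy').
    by rewrite (tri_neq T xy).
  - by apply: gn; exact: (gneq _ _ wx').
  - by apply: gn; exact: (gneq _ _ wy').
  - by apply: gh; exact: (gneq _ _ wx').
  - by apply: gh; exact: (gneq _ _ wy').
  - exact: (leq_sub2l 6 B2).
  - have -> : (6 - #|B|).+1 = 6 - #|B :\ e|.
      by rewrite [in LHS]cB subnSK // (leq_ltn_trans B'2).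
    by apply: flexdim_sub dq => //; apply: step ct hB.
  - apply: flexdim_sub d0 => //; apply: (new_adj_contract T ct); exact: gs.
have [[v [vS vU d5]]|[c4 lowU]] := exists_low T cov4.
  have [w [a [b [zs [n' ct]]]]] := contract_low T vS S5 d5 B2.
  have vB e : e \in B -> e \subset S :\ v.
    move=> eB; rewrite subsetD1; have [_ ->] := BS _ eB.
    by apply: contra vU => ve; apply/bigcupP; exists e.
  have [[va wa] [vb wb]] := (ct_a ct, ct_b ct).
  (* A brace from [w] to a vertex of [zs] becomes an edge of the contraction; by [ct_B] there is at
     most one. *)
  have [/hasP[z zz wzB]|/hasPn nz] := boolP (has (fun z => [set w; z] \in B) zs).
    have [vz nwz zw za zb] := ct_z ct zz.
    have new_old x y : new_adj adj v w zs x y -> x != w -> y != w -> adj x y.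
      rewrite /new_adj => /or3P[/and3P[//]|/andP[-> //]|/andP[-> //]].
    have nB x y : new_adj adj v w zs x y -> [set x; y] \notin B :\ [set w; z].
      rewrite !inE negb_and negbK => /or3P[/and3P[h _ _]|/andP[/eqP-> h]|/andP[/eqP-> h]].
      - by rewrite aB ?orbT.
      - have [yB|] := boolP ([set w; y] \in B); last by rewrite orbT.
        by rewrite (ct_B ct h zz yB wzB) eqxx.
      - rewrite setUC; have [yB|] := boolP ([set w; x] \in B); last by rewrite orbT.
        by rewrite (ct_B ct h zz yB wzB) eqxx.
    have zn : z \notin [:: w; a; b] by rewrite !inE !negb_or zw za zb.
    have wz : grel adj B w z by rewrite /grel wzB orbT.
    have sub e' : e' \in B -> e' != [set w; z] -> e' \subset S :\ v by move=> h _; apply: vB.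
    have wv : w != v by rewrite eq_sym (tri_neq T (ct_w ct)).
    have av : a != v by rewrite eq_sym (tri_neq T va).
    have aw : a != w by rewrite eq_sym (tri_neq T wa).
    have bw : b != w by rewrite eq_sym (tri_neq T wb).
    have [e|e] := ct_face ct zz.
      have wa' : new_adj adj v w zs w a by rewrite /new_adj wa wv av.
      apply: (collapse v w a b z a z zs n' [set w; z]) => //; rewrite ?inE ?eqxx ?orbT //.
      + exact: gs.
      + by apply: new_old => //; have := tri_adj (ct_tri ct) wa'; rewrite e.
    have wz' : new_adj adj v w zs w z by rewrite /new_adj eqxx zz orbT.
    apply: (collapse v w a b z z b zs n' [set w; z]) => //; rewrite ?inE ?eqxx ?orbT //.
    + exact: gs.
    + by apply: new_old => //; have := tri_adj (ct_tri ct) wz'; rewrite e.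
  apply: (free v w a b zs n' B) => //.
  - by move=> e eB; split; [case: (BS _ eB)|apply: vB].
  - move=> x y /or3P[/and3P[h _ _]|/andP[/eqP-> h]|/andP[/eqP-> h]]; first exact: aB.
      exact: nz.
    by rewrite setUC; apply: nz.
  - move=> x y xyB; left; rewrite /contract; have /subsetP sub := vB _ xyB.
    have := sub _ (set21 x y); have := sub _ (set22 x y); rewrite !inE => /andP[-> _] /andP[-> _].
    by rewrite /grel xyB orbT.
(* From here on every vertex of degree at most 5 is an end of a brace. The end [v] of [e0] is
   contracted, which moves the brace [v z] to [w z]. *)
have [/eqP/cards2P[v [z [nvz ee]]] sub0] := BS _ e0B.
have vU : v \in cover B by apply/bigcupP; exists e0; rewrite // ee set21.
have [vS d3] := lowU _ vU.
have zS : z \in S by apply: (subsetP sub0); rewrite ee set22.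
(* The braces cover four vertices, so two of them are disjoint. *)
have others e' : e' \in B -> e' != e0 -> v \notin e' /\ z \notin e'.
  move=> eB' ne.
  have BE : B = [set e0; e'].
    apply/esym/eqP; rewrite eqEcard subUset !sub1set e0B eB' /= cards2 eq_sym ne //.
  have c4' : #|e0 :|: e'| = 4 by rewrite -c4 BE /cover big_setU1 ?inE 1?eq_sym //= big_set1.
  have [k1 _] := BS _ e0B; have [k2 _] := BS _ eB'.
  have dis : e0 :&: e' = set0.
    by apply/eqP; rewrite -cards_eq0; have := cardsUI e0 e'; rewrite c4' k1 k2; lia.
  split; apply/negP => h.
    have : v \in e0 :&: e' by rewrite inE h ee set21.
    by rewrite dis inE.
  have : z \in e0 :&: e' by rewrite inE h ee set22.
  by rewrite dis inE.
have d5 : deg adj v <= 5 by rewrite d3.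
have [w [a [b [zs [n' ct]]]]] := contract_low T vS S5 d5 B2.
have zs0 := ct_deg ct d3; subst zs.
have [[va wa] [vb wb]] := (ct_a ct, ct_b ct).
have nvz' : ~~ adj v z by apply/negP => /aB; rewrite -ee e0B.
have zn u : adj v u -> z != u by move=> h; apply: contraNneq nvz' => ->.
have vw := ct_w ct.
have wv : w != v by rewrite eq_sym (tri_neq T vw).
have av : a != v by rewrite eq_sym (tri_neq T va).
have zv : z != v by rewrite eq_sym.
have gvz : grel adj B v z by rewrite /grel -ee e0B orbT.
have subS e' : e' \in B -> e' != e0 -> e' \subset S :\ v.
  by move=> eB' ne; rewrite subsetD1; have [_ ->] := BS _ eB'; case: (others _ eB' ne) => ->.
have na x y : new_adj adj v w [::] x y -> adj x y.
  by rewrite /new_adj !in_nil !andbF !orbF => /and3P[].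
(* The moved brace either falls on an edge and is lost, or replaces [e0]. *)
have [wz|wz] := boolP (adj w z).
  have wa' : new_adj adj v w [::] w a by rewrite /new_adj wa wv av.
  have nwa := ct_face0 ct erefl.
  apply: (collapse v w a b z a b [::] n' e0) => //; rewrite ?inE ?eqxx ?orbT ?negb_or ?zn //.
  - by move=> x y /na/aB; rewrite !inE negb_and => ->; rewrite orbT.
  - exact: gs.
  - by apply: na; have := tri_adj (ct_tri ct) wa'; rewrite nwa.
have wzB : [set w; z] \notin B.
  apply/negP => h; have [e|ne] := eqVneq [set w; z] e0.
    have : v \in [set w; z] by rewrite e ee set21.
    by rewrite !inE eq_sym (negbTE wv) eq_sym (negbTE zv).
  by have [_] := others _ h ne; rewrite set22.
apply: (free v w a b [::] n' ([set w; z] |: (B :\ e0))) => //.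
- move=> e'; rewrite !inE => /orP[/eqP->|/andP[ne eB']].
    rewrite cards2 eq_sym zn //; split=> //; apply/subsetP => u.
    by rewrite !inE => /orP[]/eqP->; rewrite ?wv ?zv ?zS // (tri_inS T (y := v)) // (tri_sym T).
  by split; [case: (BS _ eB')|apply: subS].
- move=> x y /na h; rewrite !inE !negb_or negb_and aB // orbT andbT.
  by apply/eqP => /set2_eq[] [ex ey]; move: wz; rewrite -?ex -?ey ?h // (tri_sym T) h.
- by rewrite cardsU1 !inE (negbTE wzB) andbF /= (cardsD1 e0 B) e0B.
- move=> x y; rewrite !inE => /orP[/eqP|/andP[ne h]].
    case/set2_eq=> [] [-> ->]; [left|right];
    by rewrite /contract eqxx zv zn ?gvz ?orbT.
  left; rewrite /contract; have /subsetP sub := subS _ h ne.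
  have := sub _ (set21 x y); have := sub _ (set22 x y); rewrite !inE => /andP[-> _] /andP[-> _].
  by rewrite /grel h orbT.
Qed.
End Main.

(** * The rigidity matrix *)

Section RigidityMatrix.
Import GRing.Theory Num.Theory.
Local Open Scope ring_scope.
Variables (R : realType) (V : finType).
Implicit Types (q m r : V -> 'cV[R]_4) (E : {set {set V}}).

Lemma flatten_row_dot r m :
  (flatten_row r *m (flatten_row m)^T) 0 0 = \sum_v dot (r v) (m v).
Proof.
rewrite mxE (reindex _ (curry_mxvec_bij _ _)) /=.
transitivity (\sum_(i < #|V|) dot (r (enum_val i)) (m (enum_val i))).
  rewrite pair_bigA; apply: eq_bigr => -[i j] _ /=.
  by rewrite [X in _ * X]mxE !mxvecE !mxE.
symmetry; exact: (big_enum_val (fun v => dot (r v) (m v))).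
Qed.

Lemma flatten_row_surj (u : 'rV[R]_(#|V| * 4)) : exists m, u = flatten_row m.
Proof.
exists (fun v => \col_k vec_mx u (enum_rank v) k).
rewrite /flatten_row -[LHS]vec_mxK; congr mxvec.
by apply/matrixP => i k; rewrite [RHS]mxE mxE enum_valK.
Qed.

Lemma flatten_row_inj m m' : flatten_row m = flatten_row m' -> m =1 m'.
Proof.
move=> /(can_inj mxvecK) /matrixP h v; apply/colP => k.
by have := h (enum_rank v) k; rewrite !mxE enum_rankK.
Qed.

Lemma flatten_row_sum k (c : 'I_k -> R) (r : 'I_k -> V -> 'cV[R]_4) :
  (\row_i c i) *m (\matrix_i flatten_row (r i))
    = flatten_row (fun v => \sum_i c i *: r i v).
Proof.
apply/rowP => j; rewrite mxE; case: (mxvec_indexP j) => v l.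
rewrite mxvecE !mxE summxE; apply: eq_bigr => i _.
by rewrite mxE mxE mxvecE !mxE.
Qed.

Lemma edge_row_dot q m u v : u != v ->
  \sum_w dot (edge_row q [set u; v] w) (m w) = dot (m u - m v) (q u - q v).
Proof.
move=> uv; rewrite (bigD1 u) //= (bigD1 v) /=; last by rewrite eq_sym.
rewrite big1 ?addr0 => [|w /andP[wu wv]]; last first.
  by rewrite /edge_row !inE (negbTE wu) (negbTE wv) dot0l.
rewrite /edge_row set21 set22 setU1K ?inE // big_set1 setUC setU1K ?inE 1?eq_sym // big_set1.
by rewrite !dotE [dot (m u) _]dotC [dot (m v) _]dotC [dot (m u) _]dotC [dot (m v) _]dotC; ring.
Qed.

Lemma vertex_row_dot q m v :
  \sum_w dot (vertex_row q v w) (m w) = dot (proj (m v)) (proj (q v)).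
Proof.
rewrite (bigD1 v) //= big1 => [|w /negbTE wv]; last by rewrite /vertex_row wv dot0l.
rewrite addr0 /vertex_row eqxx /dot [LHS](@big_split_ord R _ _ 3 1) /= [X in _ + X]big1 ?addr0.
  by apply: eq_bigr => i _; rewrite (@col_mxEu R 3 1 1) [RHS]mulrC; congr (_ * _); rewrite mxE.
by move=> i _; rewrite (@col_mxEd R 3 1 1) mxE mul0r.
Qed.

Lemma mul_rigidity_matrix E q m : simple_graph E ->
  rigidity_matrix E q *m (flatten_row m)^T = 0 <-> infinitesimal_flex E q m.
Proof.
move=> simple.
have rowE k (r : 'I_k -> V -> 'cV[R]_4) i :
    ((\matrix_i flatten_row (r i)) *m (flatten_row m)^T) i 0 = \sum_w dot (r i w) (m w).
  by rewrite -flatten_row_dot !mxE; apply: eq_bigr => j _; rewrite !mxE.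
rewrite mul_col_mx; split=> [/eqP|[h1 h2]].
  rewrite col_mx_eq0 => /andP[/eqP h1 /eqP h2]; split=> [u v uv|v].
    have ne : u != v by have := simple _ uv; rewrite cards2; case: (u != v).
    have /colP/(_ (enum_rank_in uv [set u; v])) := h1.
    by rewrite rowE enum_rankK_in // edge_row_dot // mxE.
  by have /colP/(_ (enum_rank v)) := h2; rewrite rowE enum_rankK vertex_row_dot mxE.
apply/eqP; rewrite col_mx_eq0; apply/andP; split; apply/eqP/colP => i; rewrite rowE mxE.
  have hi := enum_valP i; have /eqP/cards2P[u [v [uv e]]] := simple _ hi.
  by rewrite e edge_row_dot // h1 // -e.
by rewrite vertex_row_dot.
Qed.

Lemma flexS_flex E q m : flexS (fun x y => [set x; y] \in E) set0 q m <-> infinitesimal_flex E q m.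
Proof.
split=> [[h1 h2 _]|[h1 h2]].
  by split=> // v; rewrite dot_proj dot_hatC dotC.
split=> // [v|v]; last by rewrite inE.
by rewrite -dot_proj dotC.
Qed.

(** The [k] forms stacked below the rigidity matrix leave no kernel, so the stack has full column
    rank. *)
Lemma flexdim_rank E q k : simple_graph E ->
  flexdim_le (fun x y => [set x; y] \in E) set0 k q ->
  (#|V| * 4 <= \rank (rigidity_matrix E q) + k)%N.
Proof.
move=> simple [a ha]; pose F := \matrix_i flatten_row (a i).
set M := rigidity_matrix E q.
suff : row_free (col_mx M F)^T.
  rewrite -row_leq_rank mxrank_tr => /leq_trans; apply.
  rewrite -addsmxE; apply: leq_trans (mxrank_adds_leqif _ _) _.
  by rewrite leq_add2l rank_leq_row.
rewrite -kermx_eq0; apply/eqP/row_matrixP => i; rewrite row0.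
have /sub_kermxP := row_sub i (kermx (col_mx M F)^T).
have [m ->] := flatten_row_surj (row i (kermx (col_mx M F)^T)).
move=> /(congr1 trmx); rewrite trmx_mul trmxK trmx0 mul_col_mx => /eqP.
rewrite col_mx_eq0 => /andP[/eqP/mul_rigidity_matrix-/(_ simple)/flexS_flex fl /eqP h].
have m0 : forall x, m x = 0.
  apply: ha fl _ => j; rewrite -flatten_row_dot.
  by have /colP/(_ j) := h; rewrite [RHS]mxE => <-; rewrite !mxE; apply: eq_bigr => l _; rewrite !mxE.
by apply/rowP => j; case: (mxvec_indexP j) => v l; rewrite mxvecE !mxE m0 mxE.
Qed.

(* Spanned by the rotations about the three axes and the vertical translation. *)
Definition spin (u : 'I_4 -> R) : 'M[R]_4 :=
  let i0 : 'I_4 := inord 0 in let i1 := inord 1 in let i2 := inord 2 in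
  u i0 *: (delta_mx i0 i1 - delta_mx i1 i0) + u i1 *: (delta_mx i0 i2 - delta_mx i2 i0)
  + u i2 *: (delta_mx i1 i2 - delta_mx i2 i1).

Definition screw (u : 'I_4 -> R) (x : 'cV[R]_4) := spin u *m x + u ord_max *: axis R.

Lemma ord4P (P : 'I_4 -> Prop) : P (inord 0) -> P (inord 1) -> P (inord 2) -> P ord_max ->
  forall i, P i.
Proof.
move=> h0 h1 h2 h3 [[|[|[|[|i]]]] hi] //.
- by rewrite (_ : Ordinal _ = inord 0) //; apply: val_inj; rewrite /= inordK.
- by rewrite (_ : Ordinal _ = inord 1) //; apply: val_inj; rewrite /= inordK.
- by rewrite (_ : Ordinal _ = inord 2) //; apply: val_inj; rewrite /= inordK.
- by rewrite (_ : Ordinal _ = ord_max) //; apply: val_inj.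
Qed.

Lemma ord4_neq : ((inord 0 == inord 1 :> 'I_4) = false) * ((inord 0 == inord 2 :> 'I_4) = false)
  * ((inord 1 == inord 2 :> 'I_4) = false) * ((inord 0 == ord_max :> 'I_4) = false)
  * ((inord 1 == ord_max :> 'I_4) = false) * ((inord 2 == ord_max :> 'I_4) = false)
  * ((inord 1 == inord 0 :> 'I_4) = false) * ((inord 2 == inord 0 :> 'I_4) = false)
  * ((inord 2 == inord 1 :> 'I_4) = false) * ((ord_max == inord 0 :> 'I_4) = false)
  * ((ord_max == inord 1 :> 'I_4) = false) * ((ord_max == inord 2 :> 'I_4) = false).
Proof. by do !split; rewrite -val_eqE /= ?inordK. Qed.

Lemma spin_skew u : (spin u)^T = - spin u.
Proof. by apply/matrixP => i j; rewrite !mxE ![(j == _) && _]andbC; ring. Qed.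

Lemma spin_max u i : spin u i ord_max = 0.
Proof. by rewrite !mxE !ord4_neq !andbF; ring. Qed.

Lemma skew_spin (M : 'M[R]_4) t : M^T = - M -> (forall i, M i ord_max = 0) ->
  exists u, u ord_max = t /\ M = spin u.
Proof.
move=> sk h; have sk' i j : M j i = - M i j by have /matrixP/(_ i j) := sk; rewrite !mxE.
have d i : M i i = 0 by have := sk' i i; lra.
exists (fun j => [:: M (inord 0) (inord 1); M (inord 0) (inord 2); M (inord 1) (inord 2); t]`_j).
split=> //; apply/matrixP => i j; move: i j.
by apply: ord4P; apply: ord4P; rewrite !mxE ?ord4_neq ?eqxx /= ?inordK //= ?h ?d
  ?[M _ (inord 0)]sk' ?[M (inord 2) (inord 1)]sk' ?[M ord_max _]sk' ?h; ring.
Qed.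

Lemma spin_eq0 u i : spin u = 0 -> i != ord_max -> u i = 0.
Proof.
move=> /matrixP h; move: i; apply: ord4P => // _.
- by have := h (inord 0) (inord 1); rewrite !mxE !ord4_neq !eqxx /=; lra.
- by have := h (inord 0) (inord 2); rewrite !mxE !ord4_neq !eqxx /=; lra.
- by have := h (inord 1) (inord 2); rewrite !mxE !ord4_neq !eqxx /=; lra.
Qed.

Lemma dot_skew n (M : 'M[R]_n) x : M^T = - M -> dot (M *m x) x = 0.
Proof.
have dE (y z : 'cV[R]_n) : dot y z = (y^T *m z) 0 0.
  by rewrite mxE; apply: eq_bigr => i _; rewrite mxE.
move=> sk; have : dot (M *m x) x = - dot x (M *m x).
  by rewrite !dE trmx_mul sk mulmxN mulNmx mxE mulmxA.
by rewrite [dot x _]dotC; lra.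
Qed.

Lemma spin_hat u x : spin u *m hat x = spin u *m x.
Proof.
rewrite [in RHS](hatE x) mulmxDr -scalemxAr (_ : spin u *m axis R = 0) ?scaler0 ?addr0 //.
apply/colP => i; rewrite mxE (bigD1 ord_max) //= spin_max mul0r add0r mxE big1 // => j /negbTE h.
by rewrite [axis R _ _]mxE h mulr0.
Qed.

Lemma dot_hat_screw u x : dot (hat x) (screw u x) = 0.
Proof.
rewrite /screw dotDr dotZr dot_axisr height_hat mulr0 addr0 -spin_hat dotC.
exact: dot_skew (spin_skew u).
Qed.

Lemma screw_cylinder u : cylinder_motion (spin u) (u ord_max *: axis R).
Proof.
split=> [|x _]; first exact: spin_skew.
by rewrite dot_proj dot_hatC dotC dot_hat_screw.
Qed.

Lemma cylinder_screw (M : 'M[R]_4) c : cylinder_motion M c ->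
  exists u, forall x, rigid_motion M c x = screw u x.
Proof.
case=> sk h.
have sk' i j : M j i = - M i j by have /matrixP/(_ i j) := sk; rewrite !mxE.
have d i : M i i = 0 by have := sk' i i; lra.
(* Tangency at the point of height [t] above the [i]-th horizontal unit vector. The values 0 and 1
   of [t] separate the two terms, so only rotations about the axis directions of 3-space and
   vertical translations survive. *)
have key i t : i != ord_max -> t * M i ord_max + c i 0 = 0.
  move=> ni; pose e : 'cV[R]_4 := delta_mx i 0.
  have he : hat e = e := hat_delta _ ni.
  have de y : dot e y = y i 0 := dot_delta i y.
  pose x := e + t *: axis R.
  have hx : hat x = e by rewrite /x !hatl he scaler0 addr0.
  have ei : e i 0 = 1 by rewrite mxE !eqxx.
  have sx : hypercylinder x by rewrite /hypercylinder dot_proj hx de mxE ei mxE mxE (negbTE ni) mulr0 addr0.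
  have := h x sx; rewrite dot_proj dot_hatC hx dotC de /rigid_motion mxE.
  have -> : M *m x = col i M + t *: col ord_max M.
    rewrite mulmxDr -colE -scalemxAr (_ : axis R = delta_mx ord_max 0) -?colE //.
    by apply/colP => j; rewrite !mxE eqxx andbT.
  by rewrite !mxE d add0r.
have M0 i : M i ord_max = 0.
  have [->|ni] := eqVneq i ord_max; first exact: d.
  by have := key i 0 ni; have := key i 1 ni; lra.
have [u [ut ->]] := skew_spin (c ord_max 0) sk M0.
exists u => x; rewrite /rigid_motion /screw ut; congr (_ + _).
rewrite {1}(hatE c) (_ : hat c = 0) ?add0r //.
apply/colP => i; rewrite !mxE; case: eqP => // /eqP ni.
by have := key i 0 ni; lra.
Qed.

Lemma trivial_flexP q m : trivial_flex q m <-> exists u, forall v, m v = screw u (q v).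
Proof.
split=> [[M [c [cm h]]]|[u h]].
  by have [u hu] := cylinder_screw cm; exists u => v; rewrite h hu.
by exists (spin u), (u ord_max *: axis R); split; [exact: screw_cylinder|].
Qed.

Lemma screw_flex E q u : infinitesimal_flex E q (fun v => screw u (q v)).
Proof.
split=> [x y _|v]; last by rewrite dot_proj dot_hatC dotC dot_hat_screw.
rewrite /screw opprD addrACA subrr addr0 -mulmxBr.
exact: dot_skew (spin_skew u).
Qed.

Definition screw_mx q : 'M[R]_(4, #|V| * 4) :=
  \matrix_i flatten_row (fun v => screw (fun j => (j == i)%:R) (q v)).

Lemma screw_mxE q u : (\row_i u i) *m screw_mx q = flatten_row (fun v => screw u (q v)).
Proof.
rewrite flatten_row_sum; congr flatten_row; apply: funext => v.
have sum4 (F : 'I_4 -> 'cV[R]_4) :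
    \sum_j F j = F (inord 0) + F (inord 1) + F (inord 2) + F ord_max.
  rewrite !big_ord_recl big_ord0 addr0 !addrA; congr (_ + _ + _ + _);
  by congr F; apply: val_inj; rewrite /= ?inordK.
rewrite sum4 /screw /spin !ord4_neq !eqxx !scale0r !scale1r !addr0 !add0r.
by rewrite !mulmxDl -!scalemxAl !mulmxDl mul0mx add0r.
Qed.

Lemma trivial_flex_submx q m : trivial_flex q m <-> (flatten_row m <= screw_mx q)%MS.
Proof.
rewrite trivial_flexP; split=> [[u h]|/submxP[u e]].
  by apply/submxP; exists (\row_i u i); rewrite screw_mxE; congr flatten_row; apply: funext.
exists (u 0); apply: flatten_row_inj; rewrite e -screw_mxE; congr (_ *m _).
by apply/rowP => i; rewrite mxE.
Qed.

Lemma flex_submx E q m : simple_graph E ->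
  infinitesimal_flex E q m <-> (flatten_row m <= kermx (rigidity_matrix E q)^T)%MS.
Proof.
move=> simple; rewrite -(mul_rigidity_matrix _ _ simple); split=> [h|/sub_kermxP h].
  by apply/sub_kermxP/trmx_inj; rewrite trmx_mul trmxK h trmx0.
by apply: trmx_inj; rewrite trmx_mul trmxK h trmx0.
Qed.

(** If a screw vanishes at every vertex, its translation is zero because [spin] has no vertical
    component; each row of [spin] is then orthogonal to three independent horizontal vectors. *)
Lemma screw_mx_free q w x y : indep3 q w x y -> row_free (screw_mx q).
Proof.
move=> ind; rewrite -kermx_eq0; apply/eqP/row_matrixP => i; rewrite row0.
have /sub_kermxP := row_sub i (kermx (screw_mx q)); set r := row i _ => h.
have {h} hs v : screw (r 0) (q v) = 0.
  have : flatten_row (fun v => screw (r 0) (q v)) = flatten_row (fun=> 0).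
    rewrite -screw_mxE (_ : \row_i r 0 i = r); last by apply/rowP => j; rewrite mxE.
    rewrite h; apply/rowP => j; case: (mxvec_indexP j) => a b.
    by rewrite mxvecE !mxE.
  by move/flatten_row_inj.
have low : (spin (r 0) *m q w) ord_max 0 = 0.
  rewrite mxE big1 // => j _.
  by have /matrixP/(_ j ord_max) := spin_skew (r 0); rewrite mxE [RHS]mxE => ->; rewrite spin_max oppr0 mul0r.
have r3 : r 0 ord_max = 0.
  by have /colP/(_ ord_max) := hs w; rewrite mxE low [RHS]mxE mxE [axis _ _ _]mxE eqxx mulr1 add0r.
have sp : spin (r 0) = 0.
  apply/row_matrixP => k; rewrite row0; apply: trmx_inj; rewrite trmx0.
  have e0 v : dot (hat (q v)) (row k (spin (r 0)))^T = 0.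
    have /colP/(_ k) := hs v; rewrite /screw r3 scale0r addr0 -spin_hat [RHS]mxE => <-.
    by rewrite mxE; apply: eq_bigr => j _; rewrite mulrC !mxE.
  by apply: ind => //; rewrite /height 2!mxE spin_max.
apply/rowP => j; rewrite [RHS]mxE.
have [->//|nj] := eqVneq j ord_max; exact: spin_eq0 sp nj.
Qed.

Lemma rigid_rank E q : simple_graph E -> infinitesimally_rigid E q ->
  (#|V| * 4 <= \rank (rigidity_matrix E q) + 4)%N.
Proof.
move=> simple rig; set K := kermx (rigidity_matrix E q)^T.
have : (K <= screw_mx q)%MS.
  apply/row_subP => i; have [m e] := flatten_row_surj (row i K).
  by rewrite e; apply/trivial_flex_submx/rig/(flex_submx _ _ simple); rewrite -e row_sub.
move=> /mxrankS; rewrite mxrank_ker mxrank_tr => h.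
have := leq_trans h (rank_leq_row _); lia.
Qed.

(** The trivial flexes lie in the kernel of the rigidity matrix and have dimension 4; the kernel has
    dimension at most 4, so the two spaces coincide. *)
Lemma flexdim_rigid E q w x y : simple_graph E -> indep3 q w x y ->
  flexdim_le (fun x y => [set x; y] \in E) set0 4 q -> infinitesimally_rigid E q.
Proof.
move=> simple ind fd m fl; apply/trivial_flex_submx.
have sk : (screw_mx q <= kermx (rigidity_matrix E q)^T)%MS.
  apply/row_subP => i; rewrite rowK; apply/(flex_submx _ _ simple)/screw_flex.
have h4 : \rank (screw_mx q) = 4%N by apply/eqP; exact: screw_mx_free ind.
have := flexdim_rank simple fd => rk.
have e : (screw_mx q == kermx (rigidity_matrix E q)^T)%MS.
  rewrite -(geq_leqif (mxrank_leqif_eq sk)) h4 mxrank_ker mxrank_tr; lia.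
by rewrite (eqmxP e); apply/(flex_submx _ _ simple).
Qed.

End RigidityMatrix.

(** * From the given definitions to the theorem *)

Lemma sphere_triangulation_tri (V : finType) (P : {set {set V}}) : sphere_triangulation P ->
  #|P| + 6 = 3 * #|V| /\ (4 <= #|V| -> exists n, tri [set: V] (fun x y => [set x; y] \in P) n).
Proof.
case=> V3 [simple /pmap_of_planar[nd pm] maxP].
have max u v : u != v -> [set u; v] \notin P -> forall nd', ~ pmap ([set u; v] |: P) nd'.
  by move=> uv h nd' /planar_of_pmap; apply: maxP => //; rewrite cards2 uv.
split; first exact: card_edges simple pm V3 max.
by move=> V4; exists (third P nd); exact: triangulation_tri simple pm V3 max V4.
Qed.

(** On three vertices the three edges of a triangulation already exhaust all pairs. *)
Lemma simple_nonedge_card4 (V : finType) (P : {set {set V}}) x y : simple_graph P ->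
  3 <= #|V| -> #|P| + 6 = 3 * #|V| -> x != y -> [set x; y] \notin P -> 4 <= #|V|.
Proof.
move=> simple V3 cP xy nP; rewrite ltn_neqAle V3 andbT; apply/eqP => cV.
have : #|[set x; y] |: P| <= 'C(#|V|, 2).
  rewrite -card_draws; apply: subset_leq_card; apply/subsetP => A.
  by rewrite !inE => /orP[/eqP->|/simple->//]; rewrite cards2 xy.
by rewrite cardsU1 nP bin2 -cV /= (_ : #|P| = 3) //; lia.
Qed.

Lemma braced2_rigid (R : realType) (V : finType) (G : {set {set V}}) :
  braced_triangulation 2 G -> [/\ simple_graph G, #|G| + 4 = 3 * #|V| & rigid R G].
Proof.
case=> P [B [sP sB dPB cB ->]]; have [V3 [simple _ _]] := sP.
have [cP] := sphere_triangulation_tri sP.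
have sG : simple_graph (P :|: B) by move=> A; rewrite inE => /orP[/simple|/sB].
have disj A : A \in P -> A \notin B by move=> h; rewrite (disjointFr dPB h).
have cG : #|P :|: B| + 4 = 3 * #|V| by rewrite cardsU (disjoint_setI0 dPB) cards0 cB; lia.
have V4 : 4 <= #|V|.
  have /card_gt0P[A hA] : 0 < #|B| by rewrite cB.
  have /eqP/cards2P[x [y [xy e]]] := sB _ hA.
  apply: (simple_nonedge_card4 simple V3 cP xy); rewrite -e.
  by apply/negP => /disj; rewrite hA.
move=> /(_ V4)[n t].
have gen : generic (flexdim_le (R := R) (grel (fun x y => [set x; y] \in P) B) (~: [set: V]) (6 - #|B|)).
  apply: braced_flexdim t _ _ _ _; rewrite ?cardsT ?cB //; last by move=> x y; exact: disj.
  by move=> A hA; rewrite subsetT (sB _ hA).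
rewrite cB in gen.
have [_ [q [pq [[_ ind _ _] fd0]]]] := generic_and (general_position_generic R V) gen.
have fd : flexdim_le (fun x y => [set x; y] \in P :|: B) set0 4 q.
  by apply: flexdim_sub fd0 => [x y|]; rewrite ?setCT ?sub0set // inE; left.
have [w [x [y u3]]] : exists w x y : V, uniq [:: w; x; y].
  have : 3 <= size (enum V) by rewrite -cardE; exact: ltnW.
  by have := enum_uniq V; case: (enum V) => [|w [|x [|y s]]] //= h _; exists w, x, y;
    move: h; rewrite !inE !negb_or -!andbA => /and5P[-> -> _ -> _].
split=> //; exists q; split; last exact: (flexdim_rigid sG (ind _ _ _ u3) fd).
(* Regularity comes from the count: the rank at [q] equals the number of rows, which bounds the rank
   everywhere. *)
split=> // q' _; apply: leq_trans (rank_leq_row _) _.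
by have := flexdim_rank sG fd; lia.
Qed.

Lemma rigid_card_edges (R : realType) (V : finType) (E : {set {set V}}) :
  simple_graph E -> rigid R E -> 3 * #|V| <= #|E| + 4.
Proof.
move=> simple [q [_ /(rigid_rank simple)]].
have := rank_leq_row (rigidity_matrix E q); lia.
Qed.

Theorem theorem5p11 (R : realType) (V : finType) (G : {set {set V}}) :
  braced_triangulation 2 G -> minimally_rigid R G.
Proof.
move=> /(braced2_rigid R)[simple cG rig]; split=> // e eG /rigid_card_edges h.
have : simple_graph (G :\ e) by move=> A /setD1P[_ /simple].
by move/h; have := cardsD1 e G; rewrite eG; lia.
Qed.
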